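(* Suppose $\rho_m\to0$, $\sqrt m\,\rho_m\to\infty$ and $\gamma_m=O_p(1)$. (Rectangular case) If the constraint nondegeneracy condition $\mathcal{R}_\alpha(\{H:\overline U_2^{\mathbb{T}}H\overline V_2=0\})=\mathbb{R}^{d_1}$ holds at $\overline X$ and $$\big\|\mathcal{B}_2^{-1}\mathcal{B}_1\big(\mathrm{Diag}(\widehat g(\overline X))\big)\big\|<1,$$ then the estimator $\widehat X_m$ from problem (RC) is rank consistent. (Positive semidefinite case) If $\overline X$ is positive semidefinite, the Slater condition holds, the constraint nondegeneracy condition $\mathcal{R}_\alpha(\{H\in\mathbb{S}^n:\overline P_2^{\mathbb{T}}H\overline P_2=0\})=\mathbb{R}^{d_1}$ holds at $\overline X$, and $$I_{n-r}+\mathcal{B}_2^{-1}\mathcal{B}_1\big(\mathrm{Diag}(\widehat g(\overline X))\big)\ \text{is positive definite},$$ then the estimator $\widehat X_m$ from problem (RC+) is rank consistent. Here rank consistency means $\lim_{m\to\infty}\Pr(\mathrm{rank}(\widehat X_m)=\mathrm{rank}(\overline X))=1$.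
   Context: Let $\mathbb{V}^{n_1\times n_2}$ denote one of $\mathbb{R}^{n_1\times n_2}$, $\mathbb{C}^{n_1\times n_2}$, the real symmetric $n\times n$ matrices, or the Hermitian $n\times n$ matrices ($\mathbb{S}^n$ denotes the latter two; $n_1=n_2=n$ there, otherwise $n=\min(n_1,n_2)$), a real inner product space with $\langle X,Y\rangle=\mathrm{Re}\,\mathrm{Tr}(X^{\mathbb{T}}Y)$ ($^{\mathbb{T}}$ = transpose or conjugate transpose); $\|\cdot\|$, $\|\cdot\|_*$, $\|\cdot\|_F$ are spectral, nuclear, Frobenius norms. $\{\Theta_1,\dots,\Theta_d\}$ is an orthonormal basis, $\alpha\subseteq\{1,\dots,d\}$, $\beta$ its complement, $d_1=|\alpha|$, $\mathcal{R}_\pi(X)=(\langle\Theta_k,X\rangle)_{k\in\pi}$. Let $p_k>0$ ($k\in\beta$), $\sum_{k\in\beta}p_k=1$, $\mathcal{Q}_\beta^\dagger(X)=\sum_{k\in\beta}p_k^{-1}\langle\Theta_k,X\rangle\Theta_k$. The unknown $\overline X$ has rank $r\ge1$ with SVD $\overline X=\overline U\mathrm{Diag}(\sigma(\overline X))\overline V^{\mathbb{T}}$, $\overline U=[\overline U_1\ \overline U_2]$, $\overline V=[\overline V_1\ \overline V_2]$, $\overline U_1,\overline V_1$ having $r$ columns; in the positive semidefinite case use an eigendecomposition $\overline X=\overline P\mathrm{Diag}(\lambda(\overline X))\overline P^{\mathbb{T}}$ and $\overline U_i=\overline V_i=\overline P_i$. Observations: $\omega_1,\dots,\omega_m$ i.i.d.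 with $\Pr(\omega_i=k)=p_k$ for $k\in\beta$, $0$ for $k\in\alpha$; $\xi_i$ i.i.d., independent of the $\omega_i$, $\mathbb{E}\xi_i=0$, $\mathbb{E}\xi_i^2=1$; $\nu>0$; $y_i=\langle\Theta_{\omega_i},\overline X\rangle+\nu\xi_i$; $\mathcal{R}_\Omega(X)=(\langle\Theta_{\omega_i},X\rangle)_{i=1}^m$. $F$ is the spectral operator $F(X)=U\mathrm{Diag}(f(\sigma(X)))V^{\mathbb{T}}$ (for an SVD of $X$; for positive semidefinite $X=P\mathrm{Diag}(\lambda(X))P^{\mathbb{T}}$ this is $P\mathrm{Diag}(f(\lambda(X)))P^{\mathbb{T}}$) of a symmetric $f:\mathbb{R}^n\to\mathbb{R}^n$ ($f(x)=Q^{\mathbb{T}}f(Qx)$ for all signed permutation matrices $Q$). Problem (RC): $\min_X \frac1{2m}\|y-\mathcal{R}_\Omega(X)\|_2^2+\rho_m(\|X\|_*-\langle F(\widetilde X_m),X\rangle+\frac{\gamma_m}2\|X-\widetilde X_m\|_F^2)$ s.t. $\mathcal{R}_\alpha(X)=\mathcal{R}_\alpha(\overline X)$. Problem (RC+): $\min_{X\in\mathbb{S}^n}\frac1{2m}\|y-\mathcal{R}_\Omega(X)\|_2^2+\rho_m(\langle I_n-F(\widetilde X_m),X\rangle+\frac{\gamma_m}2\|X-\widetilde X_m\|_F^2)$ s.t. $\mathcal{R}_\alpha(X)=\mathcal{R}_\alpha(\overline X)$, $X$ positive semidefinite (with $\widetilde X_m$ positive semidefinite). Here $\rho_m>0$,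 $\gamma_m\ge0$, and $\widehat X_m$ is an optimal solution. Slater condition: some positive definite $X^0$ has $\mathcal{R}_\alpha(X^0)=\mathcal{R}_\alpha(\overline X)$. Define $\mathcal{B}_1(Y)=\overline U_2^{\mathbb{T}}\mathcal{Q}_\beta^\dagger(\overline U_1Y\overline V_1^{\mathbb{T}})\overline V_2$ for $Y\in\mathbb{V}^{r\times r}$, $\mathcal{B}_2(Z)=\overline U_2^{\mathbb{T}}\mathcal{Q}_\beta^\dagger(\overline U_2Z\overline V_2^{\mathbb{T}})\overline V_2$ for $Z\in\mathbb{V}^{(n_1-r)\times(n_2-r)}$ (invertible under constraint nondegeneracy), and $\widehat g(\overline X)=(1-f_1(\sigma(\overline X)),\dots,1-f_r(\sigma(\overline X)))^{\mathbb{T}}\in\mathbb{R}^r$. Standing assumptions: dimensions fixed, $m\to\infty$; $F$ continuous at $\overline X$; $\widetilde X_m\xrightarrow{p}\overline X$. *)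

(* Defs.v *)
(* Scalars: R : realType, complex
   scalars R[i] (mathcomp-real-closed).  All four matrix spaces V are
   realised as real subspaces of complex matrices 'M[R[i]]_(n1,n2). *)
From HB Require Import structures.
From mathcomp Require Import all_boot all_order all_algebra all_fingroup.
From mathcomp Require Import all_classical all_reals all_analysis.
From mathcomp Require Import complex.
Set Implicit Arguments. Unset Strict Implicit. Unset Printing Implicit Defensive.
Import Order.TTheory GRing.Theory Num.Theory.
Import numFieldNormedType.Exports.
Local Open Scope classical_set_scope.
Local Open Scope ring_scope.

Inductive space_kind := KReal | KComplex | KSym | KHerm.
Definition kind_real k := match k with KReal | KSym => true | _ => false end.
Definition kind_sym k := match k with KSym | KHerm => true | _ => false end.

Section Linalg.
Variable R : realType.
Local Notation C := R[i].

Definition rC (x : R) : C := Complex x 0.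

Definition ctr m n (A : 'M[C]_(m, n)) : 'M[C]_(n, m) := map_mx (@conjc R) A^T.

Definition realmx m n (A : 'M[C]_(m, n)) := forall i j, complex.Im (A i j) = 0.

Definition ent m n (A : 'M[C]_(m, n)) (i j : nat) : C :=
  match (insub i : option 'I_m), (insub j : option 'I_n) with
  | Some i', Some j' => A i' j'
  | _, _ => 0
  end.

Definition inV k m n (A : 'M[C]_(m, n)) : Prop :=
  (kind_real k -> realmx A) /\
  (kind_sym k -> m = n /\ forall i j : nat, ent A i j = conjc (ent A j i)).

Definition ip m n (A B : 'M[C]_(m, n)) : R := complex.Re (\tr (ctr A *m B)).
Definition frob m n (A : 'M[C]_(m, n)) : R := Num.sqrt (ip A A).

Definition is_unitary n (U : 'M[C]_n) := ctr U *m U = 1%:M.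

Definition diagmx m n (s : nat -> R) : 'M[C]_(m, n) :=
  \matrix_(i, j) (if (i : nat) == (j : nat) then rC (s i) else 0).

Definition is_svd (realb : bool) m n (X : 'M[C]_(m, n)) (U : 'M[C]_m) (s : nat -> R)
    (V : 'M[C]_n) : Prop :=
  [/\ is_unitary U /\ is_unitary V, (realb -> realmx U /\ realmx V),
      (forall i j : nat, (i <= j)%N -> (j < minn m n)%N -> s j <= s i),
      (forall i : nat, 0 <= s i) /\ (forall i : nat, (minn m n <= i)%N -> s i = 0) &
      X = U *m diagmx m n s *m ctr V].

Definition singvals m n (X : 'M[C]_(m, n)) : nat -> R :=
  xget (fun _ => 0) [set s | exists U V, is_svd false X U s V].
Definition nucnorm m n (X : 'M[C]_(m, n)) : R := \sum_(i < minn m n) singvals X i.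
Definition specnorm m n (X : 'M[C]_(m, n)) : R := singvals X 0%N.

Definition tocv k (s : nat -> R) : 'cV[R]_k := \col_i s i.
Definition ofcv k (v : 'cV[R]_k) : nat -> R :=
  fun i => match (insub i : option 'I_k) with Some i' => v i' 0 | None => 0 end.

Definition signed_perm k (Q : 'M[R]_k) : Prop :=
  exists (s : 'S_k) (e : 'I_k -> bool),
    Q = \matrix_(i, j) (if s i == j then (-1) ^+ e i else 0).
Definition symmetric_fun k (f : 'cV[R]_k -> 'cV[R]_k) : Prop :=
  forall Q, signed_perm Q -> forall x, f x = Q^T *m f (Q *m x).

Definition specop (k : space_kind) m n (f : 'cV[R]_(minn m n) -> 'cV[R]_(minn m n))
    (X : 'M[C]_(m, n)) : 'M[C]_(m, n) :=
  xget 0 [set M | exists U s V, is_svd (kind_real k) X U s V /\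
                   M = U *m diagmx m n (ofcv (f (tocv (minn m n) s))) *m ctr V].

Definition specop_continuous_at k m n (f : 'cV[R]_(minn m n) -> 'cV[R]_(minn m n))
    (Xb : 'M[C]_(m, n)) : Prop :=
  forall eps : R, 0 < eps -> exists2 del : R, 0 < del &
    forall X, inV k X -> frob (X - Xb) < del ->
      frob (specop k f X - specop k f Xb) < eps.

Definition is_psd n (X : 'M[C]_n) : Prop :=
  ctr X = X /\ forall v : 'cV[C]_n, 0 <= complex.Re ((ctr v *m X *m v) 0 0).
Definition is_pd n (X : 'M[C]_n) : Prop :=
  ctr X = X /\ forall v : 'cV[C]_n, v != 0 -> 0 < complex.Re ((ctr v *m X *m v) 0 0).

Definition lcols m n r (U : 'M[C]_(m, n)) : 'M[C]_(m, r) := \matrix_(i, j) ent U i j.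
Definition rcols m n r (U : 'M[C]_(m, n)) : 'M[C]_(m, n - r) :=
  \matrix_(i, j) ent U i (r + j).

Definition onb_of k m n d (Th : 'I_d -> 'M[C]_(m, n)) : Prop :=
  [/\ forall j, inV k (Th j),
      forall i j, ip (Th i) (Th j) = (i == j)%:R &
      forall X, inV k X -> X = \sum_j rC (ip (Th j) X) *: Th j].

Definition prob_weights d (al : {set 'I_d}) (p : 'I_d -> R) : Prop :=
  (forall j, j \in ~: al -> 0 < p j) /\ \sum_(j in ~: al) p j = 1.

Definition Qdag m n d (Th : 'I_d -> 'M[C]_(m, n)) (al : {set 'I_d}) (p : 'I_d -> R)
    (X : 'M[C]_(m, n)) : 'M[C]_(m, n) :=
  \sum_(j in ~: al) rC ((p j)^-1 * ip (Th j) X) *: Th j.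

Definition B1 m n d (Th : 'I_d -> 'M[C]_(m, n)) (al : {set 'I_d}) (p : 'I_d -> R) (r : nat) (U : 'M[C]_m) (V : 'M[C]_n)
    (Y : 'M[C]_r) : 'M[C]_(m - r, n - r) :=
  ctr (rcols r U) *m Qdag Th al p (lcols r U *m Y *m ctr (lcols r V)) *m rcols r V.
Definition B2 m n d (Th : 'I_d -> 'M[C]_(m, n)) (al : {set 'I_d}) (p : 'I_d -> R) (r : nat) (U : 'M[C]_m) (V : 'M[C]_n)
    (Z : 'M[C]_(m - r, n - r)) : 'M[C]_(m - r, n - r) :=
  ctr (rcols r U) *m Qdag Th al p (rcols r U *m Z *m ctr (rcols r V)) *m rcols r V.
Definition B2inv k m n d (Th : 'I_d -> 'M[C]_(m, n)) (al : {set 'I_d}) (p : 'I_d -> R) (r : nat) (U : 'M[C]_m) (V : 'M[C]_n)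
    (W : 'M[C]_(m - r, n - r)) : 'M[C]_(m - r, n - r) :=
  xget 0 [set Z | inV k Z /\ B2 Th al p U V Z = W].

Definition ghat_diag m n (f : 'cV[R]_(minn m n) -> 'cV[R]_(minn m n)) (s : nat -> R)
    (r : nat) : 'M[C]_r :=
  \matrix_(i, j) (if i == j then rC (1 - ofcv (f (tocv (minn m n) s)) i) else 0).

Definition constraint_nondegenerate k m n d (Th : 'I_d -> 'M[C]_(m, n)) (al : {set 'I_d})
    m' n' (U2 : 'M[C]_(m, m')) (V2 : 'M[C]_(n, n')) : Prop :=
  forall c : 'I_d -> R, exists H : 'M[C]_(m, n),
    [/\ inV k H, ctr U2 *m H *m V2 = 0 & forall j, j \in al -> ip (Th j) H = c j].

Definition fixed_coef m n d (Th : 'I_d -> 'M[C]_(m, n)) (al : {set 'I_d})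
    (Xb X : 'M[C]_(m, n)) : Prop :=
  forall j, j \in al -> ip (Th j) X = ip (Th j) Xb.

End Linalg.

Section Prob.
Variables (R : realType) (dT : measure_display) (T : measurableType dT)
  (P : probability T R).
Local Notation C := R[i].

Definition indep_family (I : eqType) (X : I -> T -> R) : Prop :=
  (forall i, measurable_fun setT (X i)) /\
  forall (J : seq I) (B : I -> set R), uniq J -> (forall j, measurable (B j)) ->
    P (\big[setI/setT]_(j <- J) (X j @^-1` B j)) = (\prod_(j <- J) P (X j @^-1` B j))%E.

Definition sampling_model d (al : {set 'I_d}) (p : 'I_d -> R)
    (om : nat -> T -> 'I_d) (xi : nat -> T -> R) : Prop :=
  [/\ forall i j, measurable [set w | om i w = j],
      forall i j, P [set w | om i w = j] = (if j \in al then 0 else p j)%:E,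
      forall i (B : set R), measurable B -> P (xi i @^-1` B) = P (xi 0%N @^-1` B),
      forall i, [/\ P.-integrable setT (EFin \o xi i),
                    ('E_P[xi i] = 0)%E & ('E_P[fun w => (xi i w ^+ 2)%R] = 1)%E] &
      indep_family (fun z : nat + nat => match z with
                                         | inl i => fun w => ((om i w : nat)%:R : R)
                                         | inr i => xi i end)].

Definition random_matrix m n (X : T -> 'M[C]_(m, n)) : Prop :=
  forall i j, measurable_fun setT (fun w => complex.Re (X w i j)) /\
              measurable_fun setT (fun w => complex.Im (X w i j)).

Definition cvg_in_prob m n (X : nat -> T -> 'M[C]_(m, n)) (L : 'M[C]_(m, n)) : Prop :=
  (forall q, random_matrix (X q)) /\
  forall eps : R, 0 < eps ->
    (fun q => P [set w | eps < frob (X q w - L)]) @ \oo --> 0%E.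

Definition bounded_in_prob (g : nat -> T -> R) : Prop :=
  (forall q, measurable_fun setT (g q)) /\
  forall eps : R, 0 < eps -> exists (M : R) (q0 : nat),
    forall q, (q0 <= q)%N -> (P [set w | (M < `|g q w|)%R] < eps%:E)%E.

Definition obs m n d (Th : 'I_d -> 'M[C]_(m, n)) (Xb : 'M[C]_(m, n))
    (om : nat -> T -> 'I_d) (xi : nat -> T -> R) (nu : R) (i : nat) (w : T) : R :=
  ip (Th (om i w)) Xb + nu * xi i w.
Definition lsq_loss m n d (Th : 'I_d -> 'M[C]_(m, n)) (Xb : 'M[C]_(m, n))
    (om : nat -> T -> 'I_d) (xi : nat -> T -> R) (nu : R) (q : nat) (w : T)
    (X : 'M[C]_(m, n)) : R :=
  (2 * q%:R)^-1 * \sum_(i < q) (obs Th Xb om xi nu i w - ip (Th (om i w)) X) ^+ 2.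

Definition RC_objective k m n d (Th : 'I_d -> 'M[C]_(m, n)) (Xb : 'M[C]_(m, n))
    (om : nat -> T -> 'I_d) (xi : nat -> T -> R) (nu : R)
    (f : 'cV[R]_(minn m n) -> 'cV[R]_(minn m n)) (rho : nat -> R)
    (gam : nat -> T -> R) (Xt : nat -> T -> 'M[C]_(m, n)) (q : nat) (w : T)
    (X : 'M[C]_(m, n)) : R :=
  lsq_loss Th Xb om xi nu q w X +
  rho q * (nucnorm X - ip (specop k f (Xt q w)) X + gam q w / 2 * frob (X - Xt q w) ^+ 2).
Definition RC_optimal k m n d (Th : 'I_d -> 'M[C]_(m, n)) al (Xb : 'M[C]_(m, n))
    om xi nu f rho gam Xt (q : nat) (w : T) (Xh : 'M[C]_(m, n)) : Prop :=
  [/\ inV k Xh, fixed_coef Th al Xb Xh &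
      forall X, inV k X -> fixed_coef Th al Xb X ->
        RC_objective k Th Xb om xi nu f rho gam Xt q w Xh <=
        RC_objective k Th Xb om xi nu f rho gam Xt q w X].

Definition RCplus_objective k n d (Th : 'I_d -> 'M[C]_(n, n)) (Xb : 'M[C]_n)
    (om : nat -> T -> 'I_d) (xi : nat -> T -> R) (nu : R)
    (f : 'cV[R]_(minn n n) -> 'cV[R]_(minn n n)) (rho : nat -> R)
    (gam : nat -> T -> R) (Xt : nat -> T -> 'M[C]_n) (q : nat) (w : T)
    (X : 'M[C]_n) : R :=
  lsq_loss Th Xb om xi nu q w X +
  rho q * (ip (1%:M - specop k f (Xt q w)) X + gam q w / 2 * frob (X - Xt q w) ^+ 2).
Definition RCplus_optimal k n d (Th : 'I_d -> 'M[C]_(n, n)) al (Xb : 'M[C]_n)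
    om xi nu f rho gam Xt (q : nat) (w : T) (Xh : 'M[C]_n) : Prop :=
  [/\ inV k Xh, is_psd Xh, fixed_coef Th al Xb Xh &
      forall X, inV k X -> is_psd X -> fixed_coef Th al Xb X ->
        RCplus_objective k Th Xb om xi nu f rho gam Xt q w Xh <=
        RCplus_objective k Th Xb om xi nu f rho gam Xt q w X].

End Prob.

(* Main.v *)
(* Expanding the square, (RC) and (RC+) depend on the sample only through the
   empirical frequencies of the basis elements and the averaged noise attached to
   each.  By Chebyshev's inequality the former are close to p_k and the latter is
   O_p(m^(-1/2)) = o_p(rho_m), so with probability tending to 1 the objective is a
   perturbation of size o(rho_m) of a deterministic one.

   For such a perturbation (Xhat - Xb) / rho_m is close to the minimiser Dh of a
   limiting quadratic problem with linear term given by F(Xb) - W0, where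
   W0 = U1 V1^* - U2 Lam V2^* and Lam = B2^-1 B1 (Diag ghat) are chosen so that
   U2^* Dh V2 = 0.  The hypothesis on Lam says that W0 is a strictly interior
   subgradient: |Lam| < 1, or in the semidefinite case 1 + Lam positive definite.
   If rank Xhat <> rank Xb, there is a bounded feasible direction at Xhat along which
   the nuclear norm (or the trace) grows more slowly than <W0, .> by a fixed margin,
   and this contradicts the first-order optimality of Xhat combined with the
   stationarity of Dh. *)
Require Import Defs.
From HB Require Import structures.
From mathcomp Require Import all_boot all_order all_algebra all_fingroup.
From mathcomp Require Import all_classical all_reals all_analysis.
From mathcomp Require Import complex ring lra measurable_realfun.
Set Implicit Arguments. Unset Strict Implicit. Unset Printing Implicit Defensive.
Import Order.TTheory GRing.Theory Num.Theory.
Import numFieldNormedType.Exports.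
Local Open Scope classical_set_scope.
Local Open Scope ring_scope.

(** * Complex matrices as a real inner product space *)

(** Every limit is made quantitative: there are [eps] and [rho0] such that data within [eps] of
    their limits and any [rho <= rho0] force the rank. Probability then enters only through a union
    bound, and no limit law for the minimiser has to be established. The obstacle is that neither
    the nuclear norm nor the semidefinite constraint is smooth at [Xb]. Both are handled by one
    linear minorant: [ip W0] lies below the regulariser on its whole domain and touches it at [Xb].
    Lower bounds come from this minorant, upper bounds from one-sided derivatives along tangent
    directions [X M + N X], where the growth is linear to first order. A vanishing (2,2) block is
    exactly what makes [Dh] tangent, so the two bounds meet along it. In the semidefinite case a
    tangent direction may leave the cone at second order; [Dh] is therefore tilted by a small
    multiple of a feasible [J] that is positive on the kernel of [Xb]. Since singular values are
    defined through complex decompositions, directions are built over the complex numbers and made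
    real, when needed, by taking entrywise real parts. *)

Section MatrixInner.
Variable R : realType.
Local Notation C := R[i].
Implicit Types (m n l : nat) (t : R).

Lemma rC0 : rC (0 : R) = 0. Proof. by []. Qed.
Lemma rC1 : rC (1 : R) = 1. Proof. by []. Qed.
Lemma rCD (a b : R) : rC (a + b) = rC a + rC b.
Proof. by rewrite /rC; simpc. Qed.
Lemma rCM (a b : R) : rC (a * b) = rC a * rC b.
Proof. by rewrite /rC; simpc. Qed.
Lemma rCN (a : R) : rC (- a) = - rC a.
Proof. by rewrite /rC; simpc. Qed.
Lemma conj_rC (a : R) : conjc (rC a) = rC a.
Proof. by rewrite /rC /= oppr0. Qed.
Lemma rC_inj : injective (@rC R).
Proof. by move=> a b []. Qed.

Lemma ReD (a b : C) : complex.Re (a + b) = complex.Re a + complex.Re b.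
Proof. by case: a b => [? ?] []. Qed.

Lemma ReN (a : C) : complex.Re (- a) = - complex.Re a.
Proof. by case: a. Qed.

Lemma ctrE m n (A : 'M[C]_(m, n)) i j : ctr A i j = conjc (A j i).
Proof. by rewrite !mxE. Qed.
Lemma ctrK m n (A : 'M[C]_(m, n)) : ctr (ctr A) = A.
Proof. by apply/matrixP => i j; rewrite !ctrE conjcK. Qed.
Lemma ctrM m n l (A : 'M[C]_(m, n)) (B : 'M[C]_(n, l)) :
  ctr (A *m B) = ctr B *m ctr A.
Proof. by rewrite /ctr trmx_mul map_mxM. Qed.
Lemma ctrD m n (A B : 'M[C]_(m, n)) : ctr (A + B) = ctr A + ctr B.
Proof. by rewrite /ctr linearD /= map_mxD. Qed.
Lemma ctrN m n (A : 'M[C]_(m, n)) : ctr (- A) = - ctr A.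
Proof. by rewrite /ctr linearN /= map_mxN. Qed.
Lemma ctrB m n (A B : 'M[C]_(m, n)) : ctr (A - B) = ctr A - ctr B.
Proof. by rewrite ctrD ctrN. Qed.
Lemma ctr0 m n : ctr (0 : 'M[C]_(m, n)) = 0.
Proof. by rewrite /ctr trmx0 map_mx0. Qed.
Lemma ctr1 n : ctr (1%:M : 'M[C]_n) = 1%:M.
Proof. by rewrite /ctr trmx1 map_mx1. Qed.
Lemma ctrZ m n t (A : 'M[C]_(m, n)) : ctr (rC t *: A) = rC t *: ctr A.
Proof. by apply/matrixP => i j; rewrite ctrE !mxE -[in RHS](conj_rC t); exact: rmorphM. Qed.
Lemma ctr_sum m n I (r : seq I) (P : pred I) (F : I -> 'M[C]_(m, n)) :
  ctr (\sum_(i <- r | P i) F i) = \sum_(i <- r | P i) ctr (F i).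
Proof.
by elim/big_rec2: _ => [|i A B _ <-]; rewrite ?ctr0 // ctrD.
Qed.

Lemma ipE m n (A B : 'M[C]_(m, n)) :
  ip A B = \sum_i \sum_j (complex.Re (A i j) * complex.Re (B i j)
                          + complex.Im (A i j) * complex.Im (B i j)).
Proof.
have ReS I (r : seq I) (P : pred I) (F : I -> C) :
  complex.Re (\sum_(i <- r | P i) F i) = \sum_(i <- r | P i) complex.Re (F i).
  by elim/big_rec2: _ => // i c [a b] _ <-; case: (F i).
rewrite /ip /mxtrace ReS exchange_big /=; apply: eq_bigr => i _.
rewrite mxE ReS; apply: eq_bigr => j _; rewrite ctrE.
by case: (A j i) => a b; case: (B j i) => c d /=; ring.
Qed.

Lemma ipC m n (A B : 'M[C]_(m, n)) : ip A B = ip B A.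
Proof. by rewrite !ipE; do 2!apply: eq_bigr => ? _; ring. Qed.
Lemma ipDr m n (A B D : 'M[C]_(m, n)) : ip A (B + D) = ip A B + ip A D.
Proof. by rewrite /ip mulmxDr mxtraceD ReD. Qed.
Lemma ipNr m n (A B : 'M[C]_(m, n)) : ip A (- B) = - ip A B.
Proof. by rewrite /ip mulmxN raddfN /= ReN. Qed.
Lemma ipBr m n (A B D : 'M[C]_(m, n)) : ip A (B - D) = ip A B - ip A D.
Proof. by rewrite ipDr ipNr. Qed.
Lemma ipZr m n t (A B : 'M[C]_(m, n)) : ip A (rC t *: B) = t * ip A B.
Proof.
rewrite /ip -scalemxAr mxtraceZ; case: (\tr _) => a b /=; ring.
Qed.
Lemma ip0r m n (A : 'M[C]_(m, n)) : ip A 0 = 0.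
Proof. by rewrite /ip mulmx0 linear0. Qed.
Lemma ipDl m n (A B D : 'M[C]_(m, n)) : ip (B + D) A = ip B A + ip D A.
Proof. by rewrite ![ip _ A]ipC ipDr. Qed.
Lemma ipNl m n (A B : 'M[C]_(m, n)) : ip (- B) A = - ip B A.
Proof. by rewrite ![ip _ A]ipC ipNr. Qed.
Lemma ipBl m n (A B D : 'M[C]_(m, n)) : ip (B - D) A = ip B A - ip D A.
Proof. by rewrite ![ip _ A]ipC ipBr. Qed.
Lemma ipZl m n t (A B : 'M[C]_(m, n)) : ip (rC t *: B) A = t * ip B A.
Proof. by rewrite ![ip _ A]ipC ipZr. Qed.
Lemma ip0l m n (A : 'M[C]_(m, n)) : ip 0 A = 0.
Proof. by rewrite ipC ip0r. Qed.
Lemma ip_sumr m n I (r : seq I) (P : pred I) (F : I -> 'M[C]_(m, n)) A :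
  ip A (\sum_(i <- r | P i) F i) = \sum_(i <- r | P i) ip A (F i).
Proof. by elim/big_rec2: _ => [|i a B _ <-]; rewrite ?ip0r // ipDr. Qed.
Definition ip_lin := (ipDl, ipDr, ipBl, ipBr, ipNl, ipNr, ipZl, ipZr, ip0l, ip0r).

Lemma ip_ge0 m n (A : 'M[C]_(m, n)) : 0 <= ip A A.
Proof. by rewrite ipE; do 2!apply: sumr_ge0 => ? _; rewrite addr_ge0 // -expr2 sqr_ge0. Qed.

Lemma ip_eq0 m n (A : 'M[C]_(m, n)) : ip A A = 0 -> A = 0.
Proof.
rewrite ipE => /eqP; rewrite psumr_eq0 => [/allP h|i _]; last first.
  by apply: sumr_ge0 => ? _; rewrite addr_ge0 // -expr2 sqr_ge0.
apply/matrixP => i j; move: (h i (mem_index_enum _)) => /=.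
rewrite psumr_eq0 => [/allP/(_ j (mem_index_enum _))|k _]; last first.
  by rewrite addr_ge0 // -expr2 sqr_ge0.
rewrite mxE /= -!expr2 paddr_eq0 ?sqr_ge0 // !sqrf_eq0.
by case: (A i j) => a b /= /andP[/eqP -> /eqP ->].
Qed.

Lemma ip_mull m n l (A : 'M[C]_(m, n)) (B : 'M[C]_(n, l)) D :
  ip (A *m B) D = ip B (ctr A *m D).
Proof. by rewrite /ip ctrM mulmxA. Qed.
Lemma ip_mulr m n l (A : 'M[C]_(m, n)) (B : 'M[C]_(n, l)) D :
  ip (A *m B) D = ip A (D *m ctr B).
Proof. by rewrite /ip ctrM -mulmxA mxtrace_mulC mulmxA. Qed.
Lemma ip_ctr m n (A B : 'M[C]_(m, n)) : ip (ctr A) (ctr B) = ip A B.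
Proof.
rewrite !ipE exchange_big; apply: eq_bigr => i _; apply: eq_bigr => j _.
by rewrite !ctrE; case: (A _ _) (B _ _) => [a b] [c d] /=; ring.
Qed.

Lemma frobE m n (A : 'M[C]_(m, n)) : frob A ^+ 2 = ip A A.
Proof. by rewrite sqr_sqrtr // ip_ge0. Qed.
Lemma frob_ge0 m n (A : 'M[C]_(m, n)) : 0 <= frob A.
Proof. exact: sqrtr_ge0. Qed.
Hint Resolve frob_ge0 : core.
Lemma frob0 m n : frob (0 : 'M[C]_(m, n)) = 0.
Proof. by rewrite /frob ip0r sqrtr0. Qed.
Lemma frob_eq0 m n (A : 'M[C]_(m, n)) : frob A = 0 -> A = 0.
Proof. by move=> h; apply: ip_eq0; rewrite -frobE h expr0n. Qed.
Lemma frobN m n (A : 'M[C]_(m, n)) : frob (- A) = frob A.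
Proof. by rewrite /frob !ip_lin opprK. Qed.
Lemma frobZ m n t (A : 'M[C]_(m, n)) : frob (rC t *: A) = `|t| * frob A.
Proof. by rewrite /frob !ip_lin mulrA -expr2 sqrtrM ?sqr_ge0 // sqrtr_sqr. Qed.
Lemma frob_ctr m n (A : 'M[C]_(m, n)) : frob (ctr A) = frob A.
Proof. by rewrite /frob ip_ctr. Qed.

Lemma ip_cauchy m n (A B : 'M[C]_(m, n)) : ip A B <= frob A * frob B.
Proof.
have [A0|A0] := eqVneq (frob A) 0; first by rewrite (frob_eq0 A0) ip0l frob0 mul0r.
have [B0|B0] := eqVneq (frob B) 0; first by rewrite (frob_eq0 B0) ip0r frob0 mulr0.
have ha : 0 < frob A by rewrite lt_def A0 /=.
have hb : 0 < frob B by rewrite lt_def B0 /=.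
have := ip_ge0 (rC (frob B) *: A - rC (frob A) *: B).
rewrite !ip_lin (ipC B A) -!frobE => h.
rewrite -(ler_pM2l (mulr_gt0 ha hb)); nra.
Qed.
Lemma ip_cauchy_abs m n (A B : 'M[C]_(m, n)) : `|ip A B| <= frob A * frob B.
Proof.
rewrite ler_norml ip_cauchy andbT lerNl -ipNl.
by rewrite -(frobN A) ip_cauchy.
Qed.

Lemma frobD m n (A B : 'M[C]_(m, n)) : frob (A + B) <= frob A + frob B.
Proof.
rewrite -(@ler_pXn2r _ 2) ?nnegrE ?addr_ge0 // frobE !ip_lin -!frobE (ipC B A).
by have := ip_cauchy A B; nra.
Qed.
Lemma frobB m n (A B : 'M[C]_(m, n)) : frob (A - B) <= frob A + frob B.
Proof. by rewrite -(frobN B) frobD. Qed.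
Lemma frob_sum m n I (r : seq I) (P : pred I) (F : I -> 'M[C]_(m, n)) :
  frob (\sum_(i <- r | P i) F i) <= \sum_(i <- r | P i) frob (F i).
Proof.
elim/big_rec2: _ => [|i a B _ h]; rewrite ?frob0 //.
by apply: (le_trans (frobD _ _)); rewrite lerD2l.
Qed.

Lemma ipsq_mul11 n (z : 'M[C]_1) (c : 'rV[C]_n) : ip (z *m c) (z *m c) = ip z z * ip c c.
Proof.
rewrite !ipE !big_ord1 mulr_sumr; apply: eq_bigr => j _.
rewrite !mxE big_ord1; case: (z 0 0) (c 0 j) => [a b] [x y] /=; ring.
Qed.

(** [ip] sees only the real part of the scalar [a *m b]. Moving that scalar to the other side of
    [ip] supplies the missing phase, and one factor [frob (a *m b)] cancels. *)
Lemma frob_rowcol n (a : 'rV[C]_n) (b : 'cV[C]_n) : ip (a *m b) (a *m b) <= ip a a * ip b b.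
Proof.
have h : ip (a *m b) (a *m b) <= frob a * (frob (a *m b) * frob b).
  rewrite {1}ip_mulr; apply: (le_trans (ip_cauchy _ _)).
  rewrite ler_wpM2l // -(@ler_pXn2r _ 2) ?nnegrE ?mulr_ge0 //.
  by rewrite frobE ipsq_mul11 exprMn !frobE ip_ctr.
rewrite -!frobE in h *.
have [->|ne] := eqVneq (frob (a *m b)) 0; first by rewrite expr0n -exprMn sqr_ge0.
have p : 0 < frob (a *m b) by rewrite lt_def ne /=.
rewrite -exprMn ler_pXn2r ?nnegrE ?mulr_ge0 //.
by rewrite -(ler_pM2l p) -expr2 mulrCA.
Qed.

Lemma ip_rows m n (A : 'M[C]_(m, n)) : ip A A = \sum_i ip (row i A) (row i A).
Proof.
rewrite ipE; apply: eq_bigr => i _; rewrite ipE big_ord1.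
by apply: eq_bigr => j _; rewrite !mxE.
Qed.
Lemma ip_cols m n (A : 'M[C]_(m, n)) : ip A A = \sum_j ip (col j A) (col j A).
Proof.
rewrite ipE exchange_big; apply: eq_bigr => i _; rewrite ipE.
by apply: eq_bigr => j _; rewrite big_ord1 !mxE.
Qed.

Lemma frobM m n l (A : 'M[C]_(m, n)) (B : 'M[C]_(n, l)) :
  frob (A *m B) <= frob A * frob B.
Proof.
rewrite -(@ler_pXn2r _ 2) ?nnegrE ?mulr_ge0 // exprMn !frobE (ip_rows (A *m B)).
rewrite (ip_rows A) mulr_suml; apply: ler_sum => i _.
rewrite ip_cols (ip_cols B) mulr_sumr; apply: ler_sum => j _.
have -> : col j (row i (A *m B)) = row i A *m col j B.
  by rewrite row_mul; apply/matrixP => x y; rewrite !mxE; apply: eq_bigr => k _; rewrite !mxE.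
exact: frob_rowcol.
Qed.

(** Spectral norm at most 1, tested against matrices with any number of columns so that no singular
    values are involved. *)
Definition contr m n (W : 'M[C]_(m, n)) :=
  forall l (Q : 'M[C]_(n, l)), ip (W *m Q) (W *m Q) <= ip Q Q.

Lemma frob_contr m n l (W : 'M[C]_(m, n)) (Q : 'M[C]_(n, l)) :
  contr W -> frob (W *m Q) <= frob Q.
Proof. by move=> cW; rewrite ler_wsqrtr. Qed.

(** The square of [frob (ctr W *m Q)] is [ip Q (W *m (ctr W *m Q))], at most
    [frob Q * frob (ctr W *m Q)]; one factor cancels. *)
Lemma contr_ctr m n (W : 'M[C]_(m, n)) : contr W -> contr (ctr W).
Proof.
move=> cW l Q; rewrite -!frobE ler_pXn2r ?nnegrE //.
have h : frob (ctr W *m Q) ^+ 2 <= frob Q * frob (ctr W *m Q).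
  rewrite frobE ip_mull ctrK; apply: (le_trans (ip_cauchy _ _)).
  by rewrite ler_wpM2l // frob_contr.
have [->//|ne] := eqVneq (frob (ctr W *m Q)) 0.
by rewrite -(@ler_pM2r _ (frob (ctr W *m Q))) -?expr2 // lt_def ne /=.
Qed.

Lemma contr_iso m n (U : 'M[C]_(m, n)) : ctr U *m U = 1%:M -> contr U.
Proof. by move=> h l Q; rewrite ip_mull mulmxA h mul1mx. Qed.

Lemma ip_iso m n l (U : 'M[C]_(m, n)) (A B : 'M[C]_(n, l)) :
  ctr U *m U = 1%:M -> ip (U *m A) (U *m B) = ip A B.
Proof. by move=> h; rewrite ip_mull mulmxA h mul1mx. Qed.

Lemma unitary_ctr n (U : 'M[C]_n) : ctr U *m U = 1%:M -> U *m ctr U = 1%:M.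
Proof. exact: mulmx1C. Qed.

Lemma frob1_sqr n : frob (1%:M : 'M[C]_n) ^+ 2 = n%:R.
Proof.
rewrite frobE ipE (eq_bigr (fun=> 1)) ?sumr_const ?card_ord // => i _.
rewrite (bigD1 i) //= !mxE eqxx /= mulr1 mulr0 addr0 big1 ?addr0 // => j ne.
by rewrite !mxE eq_sym (negPf ne) /= !mulr0 addr0.
Qed.

(** The constant is the Frobenius norm of the identity, since [W = W *m 1]. *)
Lemma ip_contr_frob m n (W A : 'M[C]_(m, n)) :
  contr W -> ip W A <= Num.sqrt n%:R * frob A.
Proof.
move=> cW; apply: (le_trans (ip_cauchy _ _)); rewrite ler_wpM2r //.
rewrite -(mulmx1 W); apply: (le_trans (frob_contr _ cW)).
by rewrite -frob1_sqr sqrtr_sqr ger0_norm.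
Qed.

End MatrixInner.
#[local] Hint Extern 0 (is_true (_ <= frob _)) => (exact: frob_ge0) : core.

(** * Existence of singular value decompositions *)

Section SVD.
Variable R : realType.
Local Notation C := R[i].
Implicit Types (m n l r : nat).

Lemma conj_rCM (a : R) (z : C) : conjc (rC a * z) = rC a * conjc z.
Proof. by rewrite -[in RHS](conj_rC a); exact: rmorphM. Qed.

Lemma ctr_diag m n (s : nat -> R) : ctr (diagmx m n s) = diagmx n m s.
Proof.
apply/matrixP => i j; rewrite ctrE !mxE eq_sym.
by case: eqP => [->|_]; rewrite ?conj_rC ?conjc0.
Qed.

Lemma diag_mul m k n (a b : nat -> R) :
  (forall i, (k <= i)%N -> (i < minn m n)%N -> a i * b i = 0) ->
  diagmx m k a *m diagmx k n b = diagmx m n (fun i => a i * b i).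
Proof.
move=> h; apply/matrixP => i j; rewrite !mxE.
case: (ltnP i k) => ik; last first.
  rewrite big1 => [|l _]; last first.
    rewrite !mxE; case: eqP => [e|]; last by rewrite mul0r.
    by move: ik; rewrite e leqNgt ltn_ord.
  by case: eqP => // e; rewrite h // leq_min ltn_ord e ltn_ord.
rewrite (bigD1 (Ordinal ik)) //= big1 ?addr0 => [|l ne].
  by rewrite !mxE /= eqxx; case: eqP => // _; rewrite ?rCM ?mulr0.
rewrite !mxE; case: eqP => [e|]; last by rewrite mul0r.
by case/eqP: ne; apply: val_inj.
Qed.

Lemma diag_one n : diagmx n n (fun=> 1 : R) = 1%:M.
Proof. by apply/matrixP => i j; rewrite !mxE; case: eqP => [/val_inj ->|ne]; rewrite ?eqxx //; case: eqP => // e; case: ne; rewrite e. Qed.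

Lemma mul_diag_col m n l (U : 'M[C]_(l, m)) (s : nat -> R) (i : 'I_l) (j : 'I_n) :
  (U *m diagmx m n s) i j = if insub (j : nat) is Some k then U i k * rC (s j) else 0.
Proof.
rewrite mxE; case: insubP => [k _ e|].
  rewrite (bigD1 k) //= big1 ?addr0 => [|k' ne]; first by rewrite !mxE e eqxx.
  rewrite !mxE; case: eqP => [e'|]; last by rewrite mulr0.
  by case/eqP: ne; apply: val_inj; rewrite /= e e'.
rewrite -leqNgt => h; rewrite big1 // => k _; rewrite !mxE.
by case: eqP => [e|]; rewrite ?mulr0 //; move: h; rewrite -e leqNgt ltn_ord.
Qed.

(** The missing columns are conjugate transposes of a Gram-Schmidt basis of the left kernel of [B],
    which has rank [m - r]. *)
Lemma unitary_completion m r (B : 'M[C]_(m, r)) : ctr B *m B = 1%:M ->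
  (r <= m)%N /\ exists2 U : 'M[C]_m, ctr U *m U = 1%:M &
    forall i (j : 'I_r) (j' : 'I_m), j' = j :> nat -> U i j' = B i j.
Proof.
move=> hB.
have rB : \rank B = r.
  apply/eqP; rewrite eqn_leq rank_leq_col /= -[X in (X <= _)%N](mxrank1 C r) -hB.
  exact: mxrankM_maxr.
have rm : (r <= m)%N by rewrite -rB rank_leq_row.
split=> //.
pose N := schmidt (row_base (kermx B)).
have NN : N *m ctr N = 1%:M.
  by apply/unitarymxP/schmidt_unitarymx/rank_leq_col.
have NB : N *m B = 0.
  apply/sub_kermxP; rewrite eqmx_schmidt_free ?row_base_free //.
  by rewrite eq_row_base.
pose K := col_mx (ctr B) N.
have KK : K *m ctr K = 1%:M.
  rewrite /K /ctr tr_col_mx map_row_mx -!/(ctr _) mul_col_row ctrK hB NB NN.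
  have -> : ctr B *m ctr N = 0 by rewrite -ctrM NB ctr0.
  by rewrite scalar_mx_block.
have e : (r + \rank (kermx B) = m)%N by rewrite mxrank_ker rB subnKC.
have cast_unit p q s (ee : p = s) (A : 'M[C]_(p, q)) : A *m ctr A = 1%:M ->
    castmx (ee, erefl q) A *m ctr (castmx (ee, erefl q) A) = 1%:M.
  by case: s / ee => h; rewrite castmx_id.
exists (ctr (castmx (e, erefl m) K)).
  by rewrite ctrK cast_unit.
move=> i j j' ejj; rewrite ctrE castmxE /= cast_ord_id.
have -> : cast_ord (esym e) j' = lshift _ j by apply: val_inj.
by rewrite /K col_mxEu ctrE conjcK.
Qed.

(** The spectral theorem gives real eigenvalues in no particular order; sorting them permutes the
    rows of the diagonalising matrix. *)
Lemma herm_spectral n (A : 'M[C]_n) : ctr A = A ->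
  exists (V : 'M[C]_n) (d : nat -> R), [/\ ctr V *m V = 1%:M,
    A = V *m diagmx n n d *m ctr V &
    forall i j, (i <= j)%N -> (j < n)%N -> d j <= d i].
Proof.
move=> hA.
have Ah : A \is hermsymmx.
  by apply/is_hermitianmxP; rewrite expr0 scale1r; exact: esym hA.
have /orthomx_spectralP eA := hermitian_normalmx Ah.
have rD := hermitian_spectral_diag_real Ah.
set P := spectralmx A in eA; set D := spectral_diag A in eA rD.
have PP : P *m ctr P = 1%:M by apply/unitarymxP/spectral_unitarymx.
rewrite (invmx_unitary (spectral_unitarymx A)) -/P -/(ctr P) in eA.
pose Dr i := complex.Re (D 0 i).
have DE i : D 0 i = rC (Dr i).
  have /mxOverP/(_ 0 i)/RRe_real := rD; by rewrite /rC /Dr => <-.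
pose t := [tuple Dr i | i < n].
have /tuple_permP[p ep] : perm_eq (sort (fun x y => y <= x) t) t.
  by rewrite perm_sort.
pose d i := nth 0 (sort (fun x y : R => y <= x) t) i.
have dE (i : 'I_n) : d i = Dr (p i).
  by rewrite /d ep -tnth_nth !tnth_mktuple.
exists (ctr (row_perm p P)), d; split.
- rewrite ctrK; apply/matrixP => i j; have /matrixP/(_ (p i) (p j)) := PP.
  rewrite !mxE (inj_eq perm_inj) => <-; apply: eq_bigr => k _.
  by rewrite !mxE.
- rewrite ctrK {1}eA; apply/matrixP => i j; rewrite !mxE.
  rewrite (reindex_inj (@perm_inj _ p)); apply: eq_bigr => k _.
  rewrite mul_diag_col; case: insubP => [k' _ /val_inj ->|]; last by rewrite ltn_ord.
  rewrite !mxE dE -DE; congr (_ * _).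
  rewrite (bigD1 (p k)) //= big1 ?addr0 => [|l ne]; first by rewrite !mxE eqxx mulr1n.
  by rewrite !mxE (negPf ne) mulr0n mulr0.
- move=> i j ij jn; rewrite /d.
  have so : sorted (fun x y : R => y <= x) (sort (fun x y : R => y <= x) t).
    by apply: sort_sorted => x y; exact: le_total.
  have := sorted_leq_nth _ _ 0 so; apply => //.
  + by move=> x y z h1 h2; exact: le_trans h2 h1.
  + by rewrite inE size_sort size_tuple (leq_ltn_trans ij).
  + by rewrite inE size_sort size_tuple.
Qed.

(** Diagonalise [X^* X] by [V]: the columns of [X V] are orthogonal with squared norms [d i]. The
    nonzero ones, normalised, are completed to a unitary [U]. *)
Lemma svd_exists m n (X : 'M[C]_(m, n)) : exists U s V, is_svd false X U s V.
Proof.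
have [V [d [VV AE dS]]] : exists (V : 'M[C]_n) (d : nat -> R), [/\ ctr V *m V = 1%:M,
    ctr X *m X = V *m diagmx n n d *m ctr V &
    forall i j, (i <= j)%N -> (j < n)%N -> d j <= d i].
  by apply: herm_spectral; rewrite ctrM ctrK.
have VV' := unitary_ctr VV.
have [Y YE] : exists Y, Y = X *m V by exists (X *m V).
have YY : ctr Y *m Y = diagmx n n d.
  by rewrite YE ctrM !mulmxA -(mulmxA (ctr V)) AE !mulmxA VV mul1mx -mulmxA VV mulmx1.
have YYe (i j : 'I_n) : \sum_k conjc (Y k i) * Y k j = if i == j then rC (d i) else 0.
  have /matrixP/(_ i j) := YY; rewrite !mxE => <-.
  by apply: eq_bigr => k _; rewrite ctrE.
have d_ip (i : 'I_n) : d i = ip (col i Y) (col i Y).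
  have := YYe i i; rewrite eqxx /ip /mxtrace big_ord1 => e.
  rewrite -[LHS]/(complex.Re (rC (d i))) -e mxE.
  by congr complex.Re; apply: eq_bigr => k _; rewrite !mxE.
(* As [d] is nonincreasing, the first index with [d i <= 0] separates the positive eigenvalues from
   the null ones. *)
pose r := find (fun i => d i <= 0) (iota 0 n).
have rn : (r <= n)%N by rewrite -[X in (_ <= X)%N](size_iota 0 n) find_size.
have dpos i : (i < r)%N -> 0 < d i.
  move=> h; have := before_find 0%N h.
  by rewrite nth_iota ?(leq_trans h) // add0n => /negbT; rewrite -ltNge.
have dzero i : (r <= i)%N -> (i < n)%N -> d i = 0.
  move=> ri iN; have iO := d_ip (Ordinal iN).
  apply/le_anti/andP; split; last by rewrite iO ip_ge0.
  have rN : (r < n)%N by exact: leq_ltn_trans ri iN.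
  have := @nth_find _ 0%N (fun i => d i <= 0) (iota 0 n).
  rewrite has_find -/r size_iota => /(_ rN); rewrite nth_iota // add0n.
  by apply: le_trans; exact: dS.
pose B : 'M[C]_(m, r) := \matrix_(i, j) (rC (Num.sqrt (d j))^-1 * Y i (widen_ord rn j)).
have sd i : (i < r)%N -> Num.sqrt (d i) != 0 by move=> /dpos h; rewrite gt_eqF // sqrtr_gt0.
have BB : ctr B *m B = 1%:M.
  apply/matrixP => i j; rewrite !mxE.
  rewrite (eq_bigr (fun k => rC (Num.sqrt (d i))^-1 * rC (Num.sqrt (d j))^-1 *
     (conjc (Y k (widen_ord rn i)) * Y k (widen_ord rn j)))) => [|k _]; last first.
    by rewrite ctrE !mxE conj_rCM; ring.
  rewrite -mulr_sumr YYe -val_eqE /=; case: (eqVneq i j) => [->|ne].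
    rewrite eqxx -!rCM -expr2 exprVn sqr_sqrtr ?mulVf //; first by rewrite gt_eqF // dpos.
    by rewrite ltW // dpos.
  by rewrite ifN ?mulr0 //; apply: contraNneq ne => /val_inj ->.
have [rm [U UU UB]] := unitary_completion BB.
pose s i := if (i < n)%N then Num.sqrt (d i) else 0.
have UY : ctr U *m Y = diagmx m n s.
  apply/matrixP => i j; rewrite !mxE /s.
  case: (ltnP j r) => jr.
    have e k : Y k j = rC (s j) * U k (widen_ord rm (Ordinal jr)).
      rewrite (UB _ (Ordinal jr)) // mxE mulrA /s ltn_ord -rCM mulfV ?sd // rC1 mul1r.
      by congr (Y _ _); apply: val_inj.
    rewrite (eq_bigr (fun k => rC (s j) * (ctr U i k * U k (widen_ord rm (Ordinal jr))))).
      rewrite -mulr_sumr; have /matrixP/(_ i (widen_ord rm (Ordinal jr))) := UU.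
      rewrite !mxE => ->; rewrite -val_eqE /= /s ltn_ord.
      by case: eqP => [->|_]; rewrite ?ltn_ord ?mulr1 ?mulr0.
    by move=> k _; rewrite e; ring.
  have Y0 : col j Y = 0 by apply: ip_eq0; rewrite -d_ip dzero.
  rewrite big1 => [|k _]; last first.
    by move/matrixP/(_ k 0): Y0; rewrite !mxE => ->; rewrite mulr0.
  by case: eqP => // e; rewrite e ltn_ord dzero // sqrtr0.
exists U, s, V; split => //.
- move=> i j ij; rewrite leq_min => /andP[jm jn]; rewrite /s jn (leq_ltn_trans ij jn).
  by rewrite ler_wsqrtr // dS.
- split=> i; first by rewrite /s; case: ifP => // _; exact: sqrtr_ge0.
  rewrite /s geq_min; case: ltnP => // iN; rewrite orbF => mi.
  by rewrite dzero ?sqrtr0 // (leq_trans rm).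
- by rewrite -UY YE !mulmxA (unitary_ctr UU) mul1mx -mulmxA VV' mulmx1.
Qed.

Lemma singvalsP m n (X : 'M[C]_(m, n)) : exists U V, is_svd false X U (singvals X) V.
Proof.
have [U [s [V h]]] := svd_exists X.
exact: (@xgetPex _ (fun=> 0) [set s | exists U V, is_svd false X U s V]
  (ex_intro _ s (ex_intro _ U (ex_intro _ V h)))).
Qed.

End SVD.

(** * Nuclear norm and polar factors *)

Section NuclearNorm.
Variable R : realType.
Local Notation C := R[i].
Implicit Types (m n l : nat).

Lemma eq_diag m n (a b : nat -> R) : (forall i, (i < minn m n)%N -> a i = b i) ->
  diagmx m n a = diagmx m n b.
Proof.
move=> h; apply/matrixP => i j; rewrite !mxE; case: eqP => // e.
by rewrite h // leq_min ltn_ord e ltn_ord.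
Qed.

Lemma ip_diag_sq n l (t : nat -> R) (Q : 'M[C]_(n, l)) :
  ip Q (diagmx n n t *m Q) = \sum_(i < n) t i * ip (row i Q) (row i Q).
Proof.
rewrite ipE; apply: eq_bigr => i _; rewrite ipE big_ord1 mulr_sumr.
apply: eq_bigr => j _; rewrite !mxE (bigD1 i) //= big1 ?addr0 => [|k ne].
  rewrite !mxE eqxx /rC; case: (Q i j) => a b /=; ring.
by rewrite !mxE val_eqE eq_sym (negPf ne) mul0r.
Qed.

Lemma diag_bound m n l (s : nat -> R) (c : R) (Q : 'M[C]_(n, l)) :
  (forall i, (i < minn m n)%N -> `|s i| <= c) ->
  ip (diagmx m n s *m Q) (diagmx m n s *m Q) <= c ^+ 2 * ip Q Q.
Proof.
move=> h; pose s' i := if (i < minn m n)%N then s i else 0.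
rewrite (@eq_diag m n s s') => [|i hi]; last by rewrite /s' hi.
rewrite ip_mull mulmxA ctr_diag diag_mul => [|i mi _]; last first.
  by rewrite /s' leq_min [(i < m)%N]ltnNge mi mul0r.
rewrite ip_diag_sq (ip_rows Q) mulr_sumr; apply: ler_sum => i _.
rewrite ler_wpM2r ?ip_ge0 // -expr2 /s'; case: ifP => hi; last by rewrite expr0n sqr_ge0.
by rewrite -real_normK ?num_real // lerXn2r ?nnegrE ?h // (le_trans _ (h _ hi)).
Qed.

(* Since [X = P Q^*] with [P = W Q] and [Q = W^* P], the contraction [W] is a
   subgradient of the nuclear norm at [X] ([polar_nuc], [nuc_ge]). *)
Definition polar m n (X W : 'M[C]_(m, n)) := contr W /\
  exists l (P : 'M[C]_(m, l)) (Q : 'M[C]_(n, l)),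
    [/\ X = P *m ctr Q, W *m Q = P & ctr W *m P = Q].

Lemma polar_ip m n l (P : 'M[C]_(m, l)) (Q : 'M[C]_(n, l)) W :
  W *m Q = P -> ctr W *m P = Q ->
  ip W (P *m ctr Q) = ip P P /\ ip W (P *m ctr Q) = ip Q Q.
Proof.
move=> h1 h2; have -> : ip W (P *m ctr Q) = ip (W *m Q) P by rewrite ip_mulr.
by rewrite {1}h1; split=> //; rewrite ip_mull h2.
Qed.

(** [W] keeps the singular vectors and replaces every singular value by 1; [P] and [Q] share the
    singular values as square roots. *)
Lemma svd_polar b m n (X : 'M[C]_(m, n)) U s V : is_svd b X U s V ->
  exists2 W, polar X W & ip W X = \sum_(i < minn m n) s i.
Proof.
case=> -[UU VV] _ _ [s0 sz] XE.
pose K := minn m n; pose q i := Num.sqrt (s i).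
pose P := U *m diagmx m K q; pose Q := V *m diagmx n K q.
pose chi i : R := (i < K)%N%:R.
pose W := U *m diagmx m n chi *m ctr V.
have qq i : q i * q i = s i by rewrite -expr2 sqr_sqrtr.
have XPQ : X = P *m ctr Q.
  rewrite /P /Q ctrM ctr_diag XE -!mulmxA; congr (_ *m _); rewrite !mulmxA.
  rewrite diag_mul => [|i h1 h2]; last by rewrite leqNgt h2 in h1.
  by congr (_ *m _); apply: eq_diag => i _.
have cq l (h : (K <= l)%N) k : diagmx k l chi *m diagmx l K q = diagmx k K q.
  rewrite diag_mul => [|i h1 h2]; last first.
    by rewrite /chi ltnNge (leq_trans h h1) mul0r.
  by apply: eq_diag => i; rewrite leq_min /chi => /andP[_ ->]; rewrite mul1r.
have WQ : W *m Q = P.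
  by rewrite /W /Q mulmxA -(mulmxA _ (ctr V)) VV mulmx1 -mulmxA cq // geq_minr.
have WP : ctr W *m P = Q.
  rewrite /W /P !ctrM ctrK ctr_diag mulmxA -!mulmxA (mulmxA (ctr U)) UU mul1mx.
  by rewrite cq // geq_minl.
exists W; last first.
  rewrite XPQ (polar_ip WQ WP).2 /Q ip_iso // /ip ctr_diag diag_mul; last first.
    by move=> i h1; rewrite minnn ltnNge (leq_trans (geq_minr m n) h1).
  rewrite /mxtrace -/K.
  have e : \sum_(i < K) diagmx K K (fun i => q i * q i) i i = rC (\sum_(i < K) s i).
    elim/big_rec2: _ => // i x y _ ->; rewrite mxE eqxx qq rCD //.
  by rewrite e.
split; last by exists K, P, Q.
rewrite /W => l A; rewrite -mulmxA -mulmxA ip_iso //.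
apply: (le_trans (@diag_bound _ _ _ _ 1 _ _)) => [i hi|].
  by rewrite /chi /K hi normr1.
rewrite expr1n mul1r; apply: contr_iso.
by rewrite ctrK unitary_ctr.
Qed.

Lemma nuc_polar m n (X : 'M[C]_(m, n)) : exists2 W, polar X W & ip W X = nucnorm X.
Proof. by have [U [V /svd_polar]] := singvalsP X. Qed.

Lemma ip_contr_factor m n l (W : 'M[C]_(m, n)) (P : 'M[C]_(m, l)) (Q : 'M[C]_(n, l)) :
  contr W -> ip W (P *m ctr Q) <= (ip P P + ip Q Q) / 2.
Proof.
move=> cW; have -> : ip W (P *m ctr Q) = ip (W *m Q) P by rewrite ip_mulr.
apply: (le_trans (ip_cauchy _ _)); rewrite -(frobE P) -(frobE Q).
have := frob_contr Q cW; have := frob_ge0 P; have := sqr_ge0 (frob P - frob Q); nra.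
Qed.

(** One half of the duality between nuclear and spectral norms: for a polar factorisation of [Y] the
    bound of [ip_contr_factor] is attained, because [ip P P] and [ip Q Q] both equal the nuclear
    norm. *)
Lemma nuc_ge m n (W Y : 'M[C]_(m, n)) : contr W -> ip W Y <= nucnorm Y.
Proof.
move=> cW; have [W0 [cW0 [l [P [Q [YE h1 h2]]]]] <-] := nuc_polar Y.
rewrite {}YE; apply: (le_trans (ip_contr_factor P Q cW)).
by have [e1 e2] := polar_ip h1 h2; rewrite -e1 -e2; lra.
Qed.

Lemma nuc_factor m n l (P : 'M[C]_(m, l)) (Q : 'M[C]_(n, l)) :
  nucnorm (P *m ctr Q) <= (ip P P + ip Q Q) / 2.
Proof. by have [W [cW _] <-] := nuc_polar (P *m ctr Q); exact: ip_contr_factor. Qed.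

Lemma polar_nuc m n (X W : 'M[C]_(m, n)) : polar X W -> ip W X = nucnorm X.
Proof.
case=> cW [l [P [Q [XE h1 h2]]]]; apply/le_anti; rewrite nuc_ge //= XE.
apply: (le_trans (nuc_factor _ _)).
by have [e1 e2] := polar_ip h1 h2; rewrite -e1 -e2; lra.
Qed.

Lemma nucD m n (A B : 'M[C]_(m, n)) : nucnorm (A + B) <= nucnorm A + nucnorm B.
Proof. by have [W [cW _] <-] := nuc_polar (A + B); rewrite ipDr lerD ?nuc_ge. Qed.

Lemma nuc_frob m n (A : 'M[C]_(m, n)) : nucnorm A <= Num.sqrt n%:R * frob A.
Proof. by have [W [cW _] <-] := nuc_polar A; exact: ip_contr_frob. Qed.

Lemma nucZ m n (t : R) (A : 'M[C]_(m, n)) : 0 <= t -> nucnorm (rC t *: A) <= t * nucnorm A.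
Proof. by move=> t0; have [W [cW _] <-] := nuc_polar (rC t *: A); rewrite ipZr ler_wpM2l ?nuc_ge. Qed.

Definition conjM m n (A : 'M[C]_(m, n)) : 'M[C]_(m, n) := map_mx (@conjc R) A.
(** The entrywise real part, written as an average so that a convex function invariant under
    conjugation cannot increase. *)
Definition reM m n (A : 'M[C]_(m, n)) : 'M[C]_(m, n) := rC (2^-1) *: (A + conjM A).

Lemma conjMK m n (A : 'M[C]_(m, n)) : conjM (conjM A) = A.
Proof. by apply/matrixP => i j; rewrite !mxE conjcK. Qed.
Lemma conjMM m n l (A : 'M[C]_(m, n)) (B : 'M[C]_(n, l)) : conjM (A *m B) = conjM A *m conjM B.
Proof. exact: map_mxM. Qed.
Lemma conjM_ctr m n (A : 'M[C]_(m, n)) : conjM (ctr A) = ctr (conjM A).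
Proof. by apply/matrixP => i j; rewrite !mxE. Qed.
Lemma ip_conjM m n (A B : 'M[C]_(m, n)) : ip (conjM A) (conjM B) = ip A B.
Proof.
rewrite !ipE; do 2!apply: eq_bigr => ? _; rewrite !mxE.
by case: (A _ _) (B _ _) => [a b] [c d] /=; ring.
Qed.
Lemma frob_conjM m n (A : 'M[C]_(m, n)) : frob (conjM A) = frob A.
Proof. by rewrite /frob ip_conjM. Qed.
Lemma contr_conjM m n (W : 'M[C]_(m, n)) : contr W -> contr (conjM W).
Proof.
by move=> cW l Q; have := cW l (conjM Q); rewrite -ip_conjM conjMM conjMK ip_conjM.
Qed.
Lemma nuc_conjM m n (A : 'M[C]_(m, n)) : nucnorm (conjM A) <= nucnorm A.
Proof.
have [W [cW _] <-] := nuc_polar (conjM A).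
by rewrite -{1}(conjMK W) ip_conjM nuc_ge //; exact: contr_conjM.
Qed.
Lemma nuc_reM m n (A : 'M[C]_(m, n)) : nucnorm (reM A) <= nucnorm A.
Proof.
apply: (le_trans (nucZ _ _)); first by rewrite invr_ge0.
by have := nucD A (conjM A); have := nuc_conjM A; lra.
Qed.

Lemma specnorm_bound m n l (L : 'M[C]_(m, n)) (Q : 'M[C]_(n, l)) :
  ip (L *m Q) (L *m Q) <= specnorm L ^+ 2 * ip Q Q.
Proof.
have [U [V [[UU VV] _ sS [s0 sz] LE]]] := singvalsP L.
rewrite {1 2}LE -!mulmxA ip_iso //.
apply: (le_trans (@diag_bound _ _ _ _ (specnorm L) _ _)) => [i hi|].
  by rewrite ger0_norm // sS.
rewrite ler_wpM2l ?sqr_ge0 //; apply: contr_iso.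
by rewrite ctrK unitary_ctr.
Qed.
Lemma specnorm_ge0 m n (L : 'M[C]_(m, n)) : 0 <= specnorm L.
Proof. by have [U [V [_ _ _ [s0 _] _]]] := singvalsP L; exact: s0. Qed.

Lemma ip_specnorm_rank1 m n (L : 'M[C]_(m, n)) (u : 'cV[C]_m) (v : 'cV[C]_n) :
  ip L (u *m ctr v) <= specnorm L * frob u * frob v.
Proof.
have -> : ip L (u *m ctr v) = ip (L *m v) u by rewrite ip_mulr.
apply: (le_trans (ip_cauchy _ _)).
rewrite mulrAC ler_wpM2r // -(@ler_pXn2r _ 2) ?nnegrE ?mulr_ge0 ?specnorm_ge0 //.
by rewrite exprMn !frobE specnorm_bound.
Qed.

(** Dimension count: [A *m ctr B] has rank at most that of [B], so the row space of [A] meets the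
    kernel of [ctr B]. It serves both directions of the rank comparison near [Xb]. *)
Lemma rank_sep m n (A B : 'M[C]_(m, n)) : (\rank B < \rank A)%N ->
  exists2 b : 'rV[C]_m, b *m A != 0 & b *m A *m ctr B = 0.
Proof.
move=> h; have e := mxrank_mul_ker A (ctr B).
have h1 : (\rank (A *m ctr B) <= \rank B)%N.
  by apply: (leq_trans (mxrankM_maxr _ _)); rewrite /ctr mxrank_map mxrank_tr.
have : (A :&: kermx (ctr B))%MS != 0.
  apply/eqP => z; move: e; rewrite z mxrank0 addn0 => e.
  by move: (leq_ltn_trans h1 h); rewrite e ltnn.
case/rowV0Pn => v; rewrite sub_capmx => /andP[/submxP[b ->] /sub_kermxP k0] ne.
by exists b.
Qed.

Lemma ip_quad n (X : 'M[C]_n) (v : 'cV[C]_n) :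
  complex.Re ((ctr v *m X *m v) 0 0) = ip v (X *m v).
Proof. by rewrite /ip mulmxA trace_mx11. Qed.

End NuclearNorm.

#[local] Opaque ip frob nucnorm specnorm.

(** * Spectral operators *)

Section SpectralOperator.
Variable R : realType.
Local Notation C := R[i].
Implicit Types (m n l : nat).

Lemma mul_diag_row m n l (V : 'M[C]_(n, l)) (s : nat -> R) (i : 'I_m) (j : 'I_l) :
  (diagmx m n s *m V) i j = if insub (i : nat) is Some k then rC (s i) * V k j else 0.
Proof.
rewrite mxE; case: insubP => [k _ e|].
  rewrite (bigD1 k) //= big1 ?addr0 => [|k' ne]; first by rewrite !mxE e eqxx.
  rewrite !mxE; case: eqP => [e'|]; last by rewrite mul0r.
  by case/eqP: ne; apply: val_inj; rewrite /= e e'.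
rewrite -leqNgt => h; rewrite big1 // => k _; rewrite !mxE.
by case: eqP => [e|]; rewrite ?mul0r //; move: h; rewrite e leqNgt ltn_ord.
Qed.

Lemma char_poly_unitary_conj n (V D : 'M[C]_n) : ctr V *m V = 1%:M ->
  char_poly (V *m D *m ctr V) = char_poly D.
Proof.
move=> VV; have VV' := unitary_ctr VV.
pose p (A : 'M[C]_n) := map_mx (@polyC C) A.
have pM (A B : 'M[C]_n) : p (A *m B) = p A *m p B by rewrite /p map_mxM.
have E : char_poly_mx (V *m D *m ctr V) = p V *m char_poly_mx D *m p (ctr V).
  rewrite /char_poly_mx -/(p _) -/(p D) !pM mulmxBr mulmxBl; congr (_ - _).
  by rewrite scalar_mxC -mulmxA -pM VV' /p map_mx1 mulmx1.
by rewrite /char_poly E !det_mulmx mulrAC -det_mulmx -pM VV' /p map_mx1 det1 mul1r.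
Qed.

(** The squares of the singular values, padded by zeros up to [n], are the roots of the
    characteristic polynomial of [X^* X]. Monotonicity fixes their order and nonnegativity the
    square root. *)
Lemma svd_unique b b' m n (X : 'M[C]_(m, n)) U s V U' s' V' :
  is_svd b X U s V -> is_svd b' X U' s' V' -> forall i, s i = s' i.
Proof.
have gram b0 (U0 : 'M[C]_m) s0 (V0 : 'M[C]_n) : is_svd b0 X U0 s0 V0 ->
    char_poly (ctr X *m X) = \prod_(z <- [seq rC (s0 i ^+ 2) | i <- iota 0 n]) ('X - z%:P).
  case=> -[UU VV] _ _ [p0 pz] ->.
  rewrite !ctrM ctrK ctr_diag !mulmxA -(mulmxA _ (ctr U0) U0) UU mulmx1 -(mulmxA V0) diag_mul; last first.
    by move=> i mi _; rewrite pz ?mul0r // geq_min mi.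
  rewrite char_poly_unitary_conj // char_poly_trig.
    rewrite big_map -[iota 0 n]val_enum_ord big_map big_enum /=.
    by apply: eq_bigr => i _; rewrite !mxE eqxx -expr2.
  by apply/is_trig_mxP => i j ij; rewrite !mxE ltn_eqF.
move=> h h' i.
have := gram _ _ _ _ h'; rewrite (gram _ _ _ _ h) => /prod_XsubC_eq pe.
case: h h' => _ _ so [p0 pz] _ [_ _ so' [p0' pz'] _].
have [iK|Ki] := ltnP i (minn m n); last by rewrite pz ?pz'.
have iN : (i < n)%N by move: iK; rewrite leq_min => /andP[].
have rel : perm_eq [seq s0 ^+ 2 | s0 <- mkseq s n] [seq s0 ^+ 2 | s0 <- mkseq s' n].
  rewrite -!map_comp; apply/(perm_map_inj (@rC_inj R)).
  by rewrite -!map_comp.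
have srt (t : nat -> R) : (forall i j, (i <= j)%N -> (j < minn m n)%N -> t j <= t i) ->
    (forall i, 0 <= t i) -> (forall i, (minn m n <= i)%N -> t i = 0) ->
    sorted (fun x y : R => y <= x) [seq s0 ^+ 2 | s0 <- mkseq t n].
  move=> to t0 tz; rewrite -map_comp.
  have : sorted leq (iota 0 n) by exact: iota_sorted.
  apply: homo_sorted => a c ab /=.
  have [bK|Kb] := ltnP c (minn m n); last by rewrite (tz _ Kb) expr0n sqr_ge0.
  by rewrite lerXn2r ?nnegrE ?t0 ?to.
have tr : transitive (fun x y : R => y <= x) by move=> x y z h1 h2; exact: le_trans h2 h1.
have an : antisymmetric (fun x y : R => y <= x).
  by move=> x y; rewrite andbC; exact: le_anti.
have e := sorted_eq tr an (srt s so p0 pz) (srt s' so' p0' pz') rel.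
move/(congr1 (fun t => nth 0 t i)): e.
rewrite -!map_comp !(nth_map 0%N) ?size_iota // nth_iota // add0n /=.
by move/eqP; rewrite eqrXn2 // => /eqP.
Qed.

Lemma signed_perm_mul k (p : 'S_k) (e : 'I_k -> bool) (x : 'cV[R]_k) a :
  ((\matrix_(i, j) (if p i == j then (-1) ^+ e i else 0)) *m x) a 0 = (-1) ^+ e a * x (p a) 0.
Proof.
rewrite mxE (bigD1 (p a)) //= big1 ?addr0 => [|b ne]; first by rewrite mxE eqxx.
by rewrite mxE eq_sym (negPf ne) mul0r.
Qed.

Lemma signed_perm_tr_mul k (p : 'S_k) (e : 'I_k -> bool) (x : 'cV[R]_k) a :
  ((\matrix_(i, j) (if p i == j then (-1) ^+ e i else 0))^T *m x) (p a) 0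
  = (-1) ^+ e a * x a 0.
Proof.
rewrite mxE (bigD1 a) //= big1 ?addr0 => [|b ne]; first by rewrite !mxE eqxx.
by rewrite !mxE (inj_eq perm_inj) (negPf ne) mul0r.
Qed.

(** Invariance under the transposition that exchanges two equal entries. *)
Lemma symmetric_fun_eq k (f : 'cV[R]_k -> 'cV[R]_k) (s : nat -> R) i j :
  symmetric_fun f -> (i < k)%N -> (j < k)%N -> s i = s j ->
  ofcv (f (tocv k s)) i = ofcv (f (tocv k s)) j.
Proof.
move=> sf ik jk sij; rewrite /ofcv !insubT.
set a : 'I_k := Sub i ik; set b : 'I_k := Sub j jk.
pose p : 'S_k := tperm a b.
pose Q := \matrix_(x, y) (if p x == y then (-1) ^+ false else 0 : R).
have QP : signed_perm Q by exists p, (fun=> false).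
have Qx : Q *m tocv k s = tocv k s.
  apply/matrixP => x y; rewrite ord1 signed_perm_mul mul1r !mxE /p.
  by case: tpermP => // ->.
have := sf _ QP (tocv k s); rewrite Qx => /matrixP/(_ (p a) 0).
by rewrite signed_perm_tr_mul mul1r tpermL => ->.
Qed.

(** Flipping the sign of a zero entry leaves the argument unchanged, so the value there is its own
    opposite. *)
Lemma symmetric_fun_zero k (f : 'cV[R]_k -> 'cV[R]_k) (s : nat -> R) i :
  symmetric_fun f -> s i = 0 -> ofcv (f (tocv k s)) i = 0.
Proof.
move=> sf si; rewrite /ofcv; case: insubP => // a _ ai.
pose e (x : 'I_k) := x == a.
pose Q := \matrix_(x, y) (if (1%g : 'S_k) x == y then (-1) ^+ e x else 0 : R).
have QP : signed_perm Q by exists 1%g, e.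
have Qx : Q *m tocv k s = tocv k s.
  apply/matrixP => x y; rewrite ord1 signed_perm_mul !mxE perm1 /e.
  by case: eqP => [->|_]; rewrite ?expr1 ?expr0 ?mul1r // ai si mulr0.
have := sf _ QP (tocv k s); rewrite Qx => /matrixP/(_ ((1%g : 'S_k) a) 0).
by rewrite signed_perm_tr_mul perm1 /e eqxx expr1; lra.
Qed.

(** [A] and [B], the changes of singular bases, intertwine the two copies of [diagmx m n s], so
    [s j ^+ 2 - s i ^+ 2] annihilates [A i j] and [B i j]. Only blocks of equal singular values
    survive, and [g] is constant on them. *)
Lemma svd_fun_unique m n (U U' : 'M[C]_m) (V V' : 'M[C]_n) (s g : nat -> R) :
  ctr U *m U = 1%:M -> ctr U' *m U' = 1%:M -> ctr V *m V = 1%:M -> ctr V' *m V' = 1%:M ->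
  (forall i, 0 <= s i) ->
  (forall i j, (i < minn m n)%N -> (j < minn m n)%N -> s i = s j -> g i = g j) ->
  (forall i, s i = 0 -> g i = 0) ->
  U *m diagmx m n s *m ctr V = U' *m diagmx m n s *m ctr V' ->
  U *m diagmx m n g *m ctr V = U' *m diagmx m n g *m ctr V'.
Proof.
move=> UU UU' VV VV' s0 geq g0 E.
pose A := ctr U' *m U; pose B := ctr V' *m V.
have E1 : A *m diagmx m n s = diagmx m n s *m B.
  have := congr1 (fun M => ctr U' *m M *m V) E; rewrite /A /B !mulmxA UU' mul1mx.
  by rewrite -(mulmxA _ (ctr V)) VV mulmx1.
have E2 : B *m diagmx n m s = diagmx n m s *m A.
  have := congr1 (fun M => ctr V' *m ctr M *m U) E; rewrite /A /B !ctrM !ctrK !ctr_diag !mulmxA.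
  by rewrite VV' mul1mx -(mulmxA _ (ctr U)) UU mulmx1.
suff E3 : A *m diagmx m n g = diagmx m n g *m B.
  have -> : U = U' *m A by rewrite /A mulmxA (unitary_ctr UU') mul1mx.
  rewrite -(mulmxA U') E3 -!mulmxA /B; congr (_ *m _); congr (_ *m _).
  by rewrite (unitary_ctr VV) mulmx1.
apply/matrixP => i j; move/matrixP/(_ i j): E1.
rewrite !mul_diag_col !mul_diag_row.
case: insubP => [j' jm ej|_]; case: insubP => [i' im ei|_] //.
- move=> h1; move/matrixP/(_ i' j'): E2; rewrite mul_diag_col mul_diag_row.
  change (nat_of_ord j' = j) in ej; change (nat_of_ord i' = i) in ei.
  rewrite ej ei.
  have -> : insub (j : nat) = Some j by exact: valK.
  have -> : insub (i : nat) = Some i by exact: valK.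
  move=> h2.
  have [es|ne] := eqVneq (s i) (s j).
    have iK : (i < minn m n)%N by rewrite leq_min ltn_ord.
    have jK : (j < minn m n)%N by rewrite leq_min ltn_ord andbT.
    rewrite (geq _ _ iK jK es) mulrC; have [z|nz] := eqVneq (s j) 0.
      by rewrite (g0 _ z) rC0 !mul0r.
    congr (_ * _); move: h1; rewrite es mulrC; apply: mulfI.
    by apply: contra_neq nz; exact: (@rC_inj R).
  have nz : rC (s j ^+ 2 - s i ^+ 2) != 0.
    apply: contra_neq ne => /(@rC_inj R _ 0) /eqP.
    by rewrite subr_eq0 eqrXn2 // => /eqP.
  have A0 : A i j' = 0.
    apply: (mulfI nz); rewrite mulr0 rCD rCN !expr2 !rCM mulrBl.
    have -> : rC (s j) * rC (s j) * A i j' = rC (s i) * (B i' j * rC (s j)).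
      by rewrite mulrA -h1; ring.
    by rewrite h2 mulrA subrr.
  have B0 : B i' j = 0.
    apply: (mulfI nz); rewrite mulr0 rCD rCN !expr2 !rCM mulrBl.
    have -> : rC (s i) * rC (s i) * B i' j = rC (s i) * (A i j' * rC (s j)).
      by rewrite h1; ring.
    have -> : rC (s j) * rC (s j) * B i' j = rC (s j) * (rC (s i) * A i j').
      by rewrite -h2; ring.
    by ring.
  by rewrite A0 B0 mul0r mulr0.
- move/eqP; rewrite mulf_eq0 => /orP[/eqP->|/eqP z]; first by rewrite mul0r.
  by rewrite g0 ?mulr0 //; exact: (@rC_inj R).
- move=> /esym/eqP; rewrite mulf_eq0 => /orP[/eqP z|/eqP->]; last by rewrite mulr0.
  by rewrite g0 ?mul0r //; exact: (@rC_inj R).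
Qed.

(** Makes the choice inside [specop] harmless: any decomposition of [X] may be used to compute
    it. *)
Lemma specop_svd k m n (f : 'cV[R]_(minn m n) -> 'cV[R]_(minn m n))
    (X : 'M[C]_(m, n)) U s V : symmetric_fun f -> is_svd (kind_real k) X U s V ->
  specop k f X = U *m diagmx m n (ofcv (f (tocv (minn m n) s))) *m ctr V.
Proof.
move=> sf h.
have [] := @xgetPex _ (0 : 'M[C]_(m, n)) [set M | exists U s V, is_svd (kind_real k) X U s V /\
  M = U *m diagmx m n (ofcv (f (tocv (minn m n) s))) *m ctr V].
  by exists (U *m diagmx m n (ofcv (f (tocv (minn m n) s))) *m ctr V), U, s, V.
move=> U' [s' [V' [h' E]]]; rewrite -/(specop k f X) in E; rewrite {}E.
have es : s' = s by apply/funext => i; exact: svd_unique h' h i.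
subst s'; case: h h' => -[UU VV] _ _ [s0 sz] XE [[UU' VV'] _ _ _ XE'].
apply: (@svd_fun_unique _ _ _ _ _ _ s) => //; last by rewrite -XE -XE'.
- by move=> i j; exact: symmetric_fun_eq.
- by move=> i; exact: symmetric_fun_zero.
Qed.

(** If [k] singular values are positive, [diagmx m n s] is [pid_mx k] times an invertible diagonal,
    padded by 1 from index [k] on. *)
Lemma svd_rank b m n (X : 'M[C]_(m, n)) U s V : is_svd b X U s V ->
  forall i, (0 < s i) = (i < \rank X)%N.
Proof.
case=> -[UU VV] _ so [s0 sz] XE.
pose K := minn m n; pose k := find (fun i => s i <= 0) (iota 0 K).
have kK : (k <= K)%N by rewrite -[X in (_ <= X)%N](size_iota 0 K) find_size.
have spos i : (0 < s i) = (i < k)%N.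
  case: ltnP => [h|h].
    have := before_find 0%N h.
    by rewrite nth_iota ?(leq_trans h) // add0n => /negbT; rewrite -ltNge.
  apply/negbTE; rewrite -leNgt; have [iK|/sz ->//] := ltnP i K.
  have kK' := leq_ltn_trans h iK.
  have := @nth_find _ 0%N (fun i => s i <= 0) (iota 0 K).
  rewrite has_find -/k size_iota => /(_ kK'); rewrite nth_iota // add0n.
  by apply: le_trans; exact: so.
suff -> : \rank X = k by [].
have Uu : U \in unitmx by case/mulmx1_unit: UU.
have Vu : ctr V \in unitmx by case/mulmx1_unit: VV.
rewrite XE mxrankMfree ?row_free_unit // -mxrank_tr trmx_mul mxrankMfree; last first.
  by rewrite row_free_unit unitmx_tr.
rewrite mxrank_tr.
pose g i : R := if (i < k)%N then s i else 1.
have gn i : g i != 0.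
  by rewrite /g; case: ifP => h; rewrite ?oner_eq0 // gt_eqF // spos.
have -> : diagmx m n s = (pid_mx k : 'M[C]_(m, n)) *m diagmx n n g.
  apply/matrixP => i j; rewrite mul_diag_col; case: insubP => [j' _ /val_inj ->|]; last by rewrite ltn_ord.
  rewrite !mxE /g; case: eqP => //= [e|_]; last by rewrite mul0r.
  case: ltnP => h; first by rewrite -e h mul1r.
  by have := s0 i; rewrite mul0r le_eqVlt spos ltnNge h orbF => /eqP <-.
rewrite mxrankMfree ?rank_pid_mx //.
- by rewrite (leq_trans kK) // geq_minl.
- by rewrite (leq_trans kK) // geq_minr.
rewrite row_free_unit.
have : diagmx n n g *m diagmx n n (fun i => (g i)^-1) = 1%:M.
  rewrite diag_mul => [|i h]; last by rewrite minnn ltnNge h.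
  by rewrite -diag_one; apply: eq_diag => i _; rewrite mulfV.
by case/mulmx1_unit.
Qed.

End SpectralOperator.

(** * Directional estimates for the nuclear norm *)

Section FirstOrder.
Variable R : realType.
Local Notation C := R[i].
Implicit Types (m n l d : nat).

(* [a] bounds the upper one-sided directional derivative of [phi] at [X] along
   [H]; unlike a derivative it can be combined with errors that are only O(t). *)
Definition dini m n (phi : 'M[C]_(m, n) -> R) (dom : 'M[C]_(m, n) -> Prop) X H (a : R) :=
  forall e, 0 < e -> exists2 t0 : R, 0 < t0 & forall t, 0 < t -> t < t0 ->
    dom (X + rC t *: H) /\ phi (X + rC t *: H) <= phi X + t * (a + e).

(** Both sides equal [Q *m ctr Q]. *)
Lemma polar_sym m n (X W : 'M[C]_(m, n)) : polar X W -> ctr W *m X = ctr X *m W.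
Proof.
case=> _ [l [P [Q [-> h1 h2]]]].
rewrite mulmxA h2 ctrM ctrK -mulmxA; congr (_ *m _).
by rewrite -{1}h2 ctrM ctrK.
Qed.

Lemma mulr_le_half_sqrD (a b : R) : a * b <= (b ^+ 2 + a ^+ 2) / 2.
Proof. by have := sqr_ge0 (a - b); nra. Qed.

Lemma sq_expand_le (p w z t B : R) : z <= B ->
  p + t * w + (t * w + t * (t * z)) <= p + 2 * t * w + t ^+ 2 * B.
Proof. by move=> /(ler_wpM2l (sqr_ge0 t)); lra. Qed.

Lemma tangent_scalar (x y p q f s t w1 w2 v A B f3 n1 n2 : R) :
  0 <= x -> 0 <= y -> 0 <= p -> 0 <= q -> 0 <= f -> 0 <= s -> 0 <= t ^+ 2 ->
  n1 <= (A + B) / 2 -> n2 <= s * (t ^+ 2 * f3) -> f3 <= f * ((x + y) / 2) ->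
  A <= v + 2 * t * w2 + t ^+ 2 * (y * p) -> B <= v + 2 * t * w1 + t ^+ 2 * (x * q) ->
  n1 + n2 <= v + t * (w1 + w2) + (p + q + s * f) * (x + y) * t ^+ 2.
Proof.
move: (t ^+ 2) => T x0 y0 p0 q0 f0 s0 T0 h1 h2 h3 h4 h5.
have b1 : 0 <= T * (x * p) by apply: mulr_ge0 => //; exact: mulr_ge0.
have b2 : 0 <= T * (y * q) by apply: mulr_ge0 => //; exact: mulr_ge0.
have b3 : 0 <= T * (x * q) by apply: mulr_ge0 => //; exact: mulr_ge0.
have b4 : 0 <= T * (y * p) by apply: mulr_ge0 => //; exact: mulr_ge0.
have sT : 0 <= s * T by exact: mulr_ge0.
have b5 : 0 <= s * T * (f * ((x + y) / 2)).
  by apply: mulr_ge0 => //; apply: mulr_ge0 => //; apply: divr_ge0 => //; exact: addr_ge0.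
have := ler_wpM2l sT h3; lra.
Qed.

(* Factor [X = P Q^*]; then [X + t (X M + N X)] equals [(P + t N P) (Q + t M^* Q)^*]
   up to O(t^2), and a product [A B^*] has nuclear norm at most [(|A|^2 + |B|^2) / 2]. *)
Lemma nuc_tangent m n (X W : 'M[C]_(m, n)) : polar X W -> exists2 K : R, 0 <= K &
  forall M N t, nucnorm (X + rC t *: (X *m M + N *m X)) <=
    nucnorm X + t * ip W (X *m M + N *m X) + K * (frob M ^+ 2 + frob N ^+ 2) * t ^+ 2.
Proof.
move=> pXW; have eX := polar_nuc pXW.
case: pXW => cW [l [P [Q [XE h1 h2]]]].
pose s := Num.sqrt (n%:R : R).
exists (frob P ^+ 2 + frob Q ^+ 2 + s * frob X).
  by rewrite !addr_ge0 ?sqr_ge0 // mulr_ge0 // sqrtr_ge0.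
move=> M N t.
pose P' := P + rC t *: (N *m P); pose Q' := Q + rC t *: (ctr M *m Q).
have E : X + rC t *: (X *m M + N *m X) = P' *m ctr Q' + rC (- t ^+ 2) *: (N *m X *m M).
  rewrite /P' /Q' ctrD ctrZ ctrM ctrK XE mulmxDl !mulmxDr -!scalemxAl -!scalemxAr.
  rewrite scalerA -rCM -expr2 rCN scaleNr !mulmxA addrA addrK.
  by rewrite scalerDr addrA.
have e1 : ip W (N *m X) = ip P (N *m P).
  have -> : N *m X = (N *m P) *m ctr Q by rewrite XE mulmxA.
  by rewrite -ip_mulr h1.
have e2 : ip W (X *m M) = ip Q (ctr M *m Q).
  have -> : X *m M = P *m ctr (ctr M *m Q) by rewrite XE ctrM ctrK mulmxA.
  by rewrite -ip_mulr ip_mull h2 ipC.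
rewrite E; apply: (le_trans (nucD _ _)).
have s0 : 0 <= s by exact: sqrtr_ge0.
have n1 := nuc_factor P' Q'.
have n2 := nuc_frob (rC (- t ^+ 2) *: (N *m X *m M)).
rewrite frobZ normrN (ger0_norm (sqr_ge0 t)) in n2.
have n3 : frob (N *m X *m M) <= frob X * ((frob M ^+ 2 + frob N ^+ 2) / 2).
  have := frobM (N *m X) M; have := frobM N X => a1 a2.
  apply: (le_trans a2); apply: (@le_trans _ _ (frob N * frob X * frob M)).
    by rewrite ler_wpM2r.
  by rewrite (mulrC (frob N)) -mulrA ler_wpM2l // mulr_le_half_sqrD.
have a1 : ip P' P' <= ip P P + 2 * t * ip W (N *m X) + t ^+ 2 * (frob N ^+ 2 * frob P ^+ 2).
  have h : ip (N *m P) (N *m P) <= frob N ^+ 2 * frob P ^+ 2.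
    by rewrite -frobE -exprMn lerXn2r ?nnegrE ?mulr_ge0 ?frobM.
  rewrite /P' !ip_lin e1 (ipC (N *m P) P); exact: sq_expand_le.
have a2 : ip Q' Q' <= ip Q Q + 2 * t * ip W (X *m M) + t ^+ 2 * (frob M ^+ 2 * frob Q ^+ 2).
  have h : ip (ctr M *m Q) (ctr M *m Q) <= frob M ^+ 2 * frob Q ^+ 2.
    by rewrite -frobE -exprMn -(frob_ctr M) lerXn2r ?nnegrE ?mulr_ge0 ?frobM.
  rewrite /Q' !ip_lin e2 (ipC (ctr M *m Q) Q); exact: sq_expand_le.
have [p1 p2] := polar_ip h1 h2; rewrite -XE eX in p1 p2.
rewrite -p1 in a1; rewrite -p2 in a2; rewrite ipDr.
apply: (tangent_scalar _ _ _ _ _ s0 _ n1 n2 n3 a1 a2); by [exact: sqr_ge0 | exact: frob_ge0].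
Qed.

(** [E] need not be tangent: the triangle inequality charges its full nuclear norm, which is
    affordable when [E] is small. *)
Lemma dini_nuc m n (X W M N E : 'M[C]_(m, n)) (M' : 'M[C]_n) (N' : 'M[C]_m) : polar X W ->
  dini (@nucnorm R m n) (fun=> True) X (X *m M' + N' *m X + E)
    (ip W (X *m M' + N' *m X) + nucnorm E).
Proof.
move=> /nuc_tangent[K K0 h] e e0.
pose c := K * (frob M' ^+ 2 + frob N' ^+ 2).
have c0 : 0 <= c by rewrite mulr_ge0 // addr_ge0 ?sqr_ge0.
exists (e / (c + 1)); first by rewrite divr_gt0 // ltr_wpDl.
move=> t t0; rewrite ltr_pdivlMr ?ltr_wpDl // => te; split=> //.
rewrite [rC t *: (_ + E)]scalerDr addrA; apply: (le_trans (nucD _ _)).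
have := h M' N' t; have := nucZ E (ltW t0); rewrite -/c; nra.
Qed.

(** All subgradients at [Xb] agree on tangent directions, so those at nearby points almost agree
    there. Testing [W] at [Xb + s T] bounds [s * ip (W - W0) T] by a curvature term of order
    [s ^+ 2] and a displacement term of order [frob (X - Xb)]. *)
Lemma polar_close m n (Xb W0 : 'M[C]_(m, n)) (c eta : R) : polar Xb W0 -> 0 < eta ->
  exists2 delta : R, 0 < delta & forall X W, polar X W -> frob (X - Xb) <= delta ->
    forall M N, frob M <= c -> frob N <= c ->
    ip (W - W0) (Xb *m M + N *m Xb) <= eta.
Proof.
move=> pW0 eta0; have [K K0 hK] := nuc_tangent pW0.
have cW0 := pW0.1.
pose k := K * (c ^+ 2 + c ^+ 2) + 1.
have k0 : 0 < k by rewrite ltr_wpDl // mulr_ge0 // addr_ge0 ?sqr_ge0.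
(* With this step length the curvature costs at most [s * eta / 2]; [delta] below makes the
   displacement cost no more than that. *)
pose s := eta / (2 * k); have s0 : 0 < s by rewrite divr_gt0 // mulr_gt0.
pose q := 2 * Num.sqrt (n%:R : R) + 1.
have q0 : 0 < q by rewrite ltr_wpDl // mulr_ge0 // sqrtr_ge0.
exists (s * eta / (2 * q)); first by apply: divr_gt0; apply: mulr_gt0.
move=> X W pW hD M N hM hN; have cW := pW.1.
set T := Xb *m M + N *m Xb.
have h1 := le_trans (nuc_ge (Xb + rC s *: T) cW) (hK M N s).
rewrite -/T ipDr ipZr in h1.
have h2 := nuc_ge X cW0; have h3 := polar_nuc pW0; have h4 := polar_nuc pW.
have d1 := ip_contr_frob (X - Xb) cW.
have d2 : - ip W0 (X - Xb) <= Num.sqrt n%:R * frob (X - Xb).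
  by rewrite -ipNr -(frobN (X - Xb)); exact: ip_contr_frob.
rewrite !ipBr in d1 d2.
have hq : (Num.sqrt n%:R * 2) * frob (X - Xb) <= s * eta / 2.
  apply: (@le_trans _ _ (q * frob (X - Xb))).
    by rewrite ler_wpM2r // /q mulrC lerDl.
  apply: (le_trans (ler_wpM2l (ltW q0) hD)).
  by rewrite le_eqVlt; apply/orP; left; apply/eqP; field; rewrite gt_eqF.
have hk : K * (frob M ^+ 2 + frob N ^+ 2) * s <= eta / 2.
  have -> : eta / 2 = k * s by rewrite /s; field; rewrite gt_eqF.
  rewrite ler_pM2r // /k; apply: (@le_trans _ _ (K * (c ^+ 2 + c ^+ 2))); last by rewrite lerDl.
  have c0 := le_trans (frob_ge0 M) hM.
  by rewrite ler_wpM2l // lerD // lerXn2r ?nnegrE.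
have hk2 : K * (frob M ^+ 2 + frob N ^+ 2) * s ^+ 2 <= s * (eta / 2).
  have := ler_wpM2r (ltW s0) hk.
  by rewrite -(mulrA _ s s) -(expr2 s) [eta / 2 * s]mulrC.
rewrite ipBl -(ler_pM2l s0); lra.
Qed.

(* The orthogonal projection onto the real matrices when [k] is a real kind. It
   lets complex singular vectors be used without a real SVD of the estimator. *)
Definition pV (k : space_kind) m n (A : 'M[C]_(m, n)) := if kind_real k then reM A else A.

Lemma realmx_conjM m n (A : 'M[C]_(m, n)) : Defs.realmx A <-> conjM A = A.
Proof.
split=> [h|/matrixP h i j].
  apply/matrixP => i j; rewrite mxE; have := h i j; case: (A i j) => a b /= ->.
  by rewrite oppr0.
by have := h i j; rewrite mxE; case: (A i j) => a b /= [] /eqP; rewrite eqNr => /eqP.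
Qed.

Lemma conjMD m n (A B : 'M[C]_(m, n)) : conjM (A + B) = conjM A + conjM B.
Proof. exact: map_mxD. Qed.
Lemma conjMZ m n t (A : 'M[C]_(m, n)) : conjM (rC t *: A) = rC t *: conjM A.
Proof. by apply/matrixP => i j; rewrite !mxE conj_rCM. Qed.

Lemma reM_conjM m n (A : 'M[C]_(m, n)) : conjM (reM A) = reM A.
Proof. by rewrite /reM conjMZ conjMD conjMK addrC. Qed.
Lemma reM_id m n (A : 'M[C]_(m, n)) : Defs.realmx A -> reM A = A.
Proof.
move=> /realmx_conjM h; rewrite /reM h.
have -> : A + A = rC (1 + 1) *: A by rewrite rCD scalerDl scale1r.
by rewrite scalerA -rCM mulVf ?scale1r // pnatr_eq0.
Qed.

Lemma pVD k m n (A B : 'M[C]_(m, n)) : pV k (A + B) = pV k A + pV k B.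
Proof. by rewrite /pV; case: ifP => // _; rewrite /reM conjMD -scalerDr addrACA. Qed.
Lemma pVZ k m n t (A : 'M[C]_(m, n)) : pV k (rC t *: A) = rC t *: pV k A.
Proof.
by rewrite /pV; case: ifP => // _; rewrite /reM conjMZ -scalerDr !scalerA mulrC.
Qed.
Lemma pV_id k m n (A : 'M[C]_(m, n)) : inV k A -> pV k A = A.
Proof. by case=> h _; rewrite /pV; case: ifP => // /h /reM_id. Qed.
Lemma ip_pV k m n (A B : 'M[C]_(m, n)) : inV k A -> ip A (pV k B) = ip A B.
Proof.
case=> h _; rewrite /pV; case: ifP => // /h /realmx_conjM e.
by rewrite /reM ipZr ipDr -{2}e ip_conjM; field.
Qed.
Lemma frob_pV k m n (A : 'M[C]_(m, n)) : frob (pV k A) <= frob A.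
Proof.
rewrite /pV; case: ifP => // _; rewrite /reM frobZ ger0_norm ?invr_ge0 //.
by have := frobD A (conjM A); rewrite frob_conjM; lra.
Qed.
Lemma nuc_pV k m n (A : 'M[C]_(m, n)) : nucnorm (pV k A) <= nucnorm A.
Proof. by rewrite /pV; case: ifP => // _; exact: nuc_reM. Qed.
Lemma inV_rect k m n (A : 'M[C]_(m, n)) : k = KReal \/ k = KComplex ->
  (inV k A <-> (kind_real k -> conjM A = A)).
Proof.
by case=> ->; rewrite /inV /=; split=> [[h _]|h] //; [move=> _; apply/realmx_conjM/h | split=> // _; apply/realmx_conjM/h].
Qed.
Lemma inV_pV_rect k m n (A : 'M[C]_(m, n)) : k = KReal \/ k = KComplex -> inV k (pV k A).
Proof. by move=> hk; apply/(inV_rect _ hk) => kr; rewrite /pV kr reM_conjM. Qed.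

Lemma dini_pV k m n phi dom (X H : 'M[C]_(m, n)) a :
  (forall Y, phi (pV k Y) <= phi Y) -> (forall Y, dom Y -> dom (pV k Y)) -> inV k X ->
  dini phi dom X H a -> dini phi dom X (pV k H) a.
Proof.
move=> hphi hdom /pV_id hX h e /h[t0 t00 ht]; exists t0 => // t tp tt.
have [h1 h2] := ht _ tp tt.
have -> : X + rC t *: pV k H = pV k (X + rC t *: H) by rewrite pVD pVZ hX.
by split; [exact: hdom | exact: le_trans (hphi _) h2].
Qed.

End FirstOrder.

(** * Descent directions at matrices of larger rank *)

Section Descent.
Variable R : realType.
Local Notation C := R[i].
Implicit Types (m n l d : nat).

Lemma ip_rank1 m n (A : 'M[C]_(m, n)) (u : 'cV[C]_m) (v : 'cV[C]_n) :
  ip A (u *m ctr v) = ip (A *m v) u.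
Proof. by rewrite ip_mulr. Qed.

Lemma frob_outer m n (u : 'cV[C]_m) (v : 'cV[C]_n) : frob (u *m ctr v) <= frob u * frob v.
Proof. by apply: (le_trans (frobM _ _)); rewrite frob_ctr. Qed.

(** If the rank dropped, some nonzero [v] in the range of [ctr Xb] would be killed by [X]. There
    [G *m Xb] acts as the identity, so [v = - G (X - Xb) v], which is too short. *)
Lemma rank_le_near m n (Xb X : 'M[C]_(m, n)) (G : 'M[C]_(n, m)) :
  Xb *m G *m Xb = Xb -> ctr (G *m Xb) = G *m Xb -> frob G * frob (X - Xb) < 1 ->
  (\rank Xb <= \rank X)%N.
Proof.
move=> e1 e2 h; rewrite leqNgt; apply/negP => /rank_sep[a a0 aX].
pose v := ctr (a *m Xb).
have Xv : X *m v = 0 by rewrite -(ctrK (X *m v)) ctrM /v ctrK aX ctr0.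
have vE : v = - (G *m (X - Xb) *m v).
  rewrite mulmxBr mulmxBl -mulmxA Xv mulmx0 sub0r opprK /v -{1}e1 -!mulmxA.
  by rewrite (mulmxA a) ctrM e2 mulmxA.
have hv : frob v <= frob G * frob (X - Xb) * frob v.
  rewrite {1}vE frobN; apply: (le_trans (frobM _ _)).
  by rewrite ler_wpM2r // frobM.
have v0 : 0 < frob v.
  rewrite lt_def frob_ge0 andbT; apply: contraNneq a0 => /frob_eq0 z.
  by rewrite -(ctrK (a *m Xb)) -/v z ctr0.
by have := ltr_pM2r v0 (frob G * frob (X - Xb)) 1; rewrite h mul1r ltNge hv.
Qed.

Lemma rank_gt_witness m n (Xb X : 'M[C]_(m, n)) : (\rank Xb < \rank X)%N ->
  exists (b : 'rV[C]_m) (v : 'cV[C]_n), [/\ ip v v = 1, ctr v = b *m X & Xb *m v = 0].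
Proof.
move=> /rank_sep[a a0 aX].
pose v := ctr (a *m X).
have v0 : frob v != 0.
  apply: contraNneq a0 => /frob_eq0 z.
  by rewrite -(ctrK (a *m X)) -/v z ctr0.
pose t := (frob v)^-1.
exists (rC t *: a), (rC t *: v); split.
- by rewrite ipZl ipZr -frobE /t; field.
- by rewrite ctrZ /v ctrK scalemxAl.
- by rewrite -scalemxAr -(ctrK (Xb *m v)) ctrM /v ctrK aX ctr0 scaler0.
Qed.

Lemma tangent_sum m n d (al : {set 'I_d}) (c : 'I_d -> R) (Xb : 'M[C]_(m, n)) T M N :
  (forall j, T j = Xb *m M j + N j *m Xb) ->
  \sum_(j in al) rC (c j) *: T j =
  Xb *m (\sum_(j in al) rC (c j) *: M j) + (\sum_(j in al) rC (c j) *: N j) *m Xb.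
Proof.
move=> hT; rewrite mulmx_sumr mulmx_suml -big_split; apply: eq_bigr => j _ /=.
by rewrite hT scalerDr scalemxAr scalemxAl.
Qed.

Lemma frob_comb m n d (al : {set 'I_d}) (c c' : 'I_d -> R) (T : 'I_d -> 'M[C]_(m, n)) :
  (forall j, `|c j| <= c' j) ->
  frob (\sum_(j in al) rC (c j) *: T j) <= \sum_(j in al) c' j * frob (T j).
Proof.
move=> h; apply: (le_trans (frob_sum _ _ _)); apply: ler_sum => j _.
by rewrite frobZ ler_wpM2r.
Qed.

(** [T] is dual to the fixed basis elements, so the sum cancels exactly the [al]-coefficients of
    [A]. *)
Lemma feasible_corr k m n d (Th : 'I_d -> 'M[C]_(m, n)) (al : {set 'I_d}) T A :
  (forall i j, i \in al -> j \in al -> ip (Th i) (T j) = (i == j)%:R) ->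
  (forall j, inV k (Th j)) -> forall i, i \in al ->
  ip (Th i) (A + \sum_(j in al) rC (- ip (Th j) A) *: T j) = 0.
Proof.
move=> hT hV i ia; rewrite ipDr ip_sumr (bigD1 i) //= ipZr hT // eqxx big1 ?addr0 => [|j].
  by rewrite mulr1 subrr.
by case/andP=> ja ne; rewrite ipZr hT // eq_sym (negPf ne) mulr0.
Qed.

Lemma rect_descent_scalar (K1 s0 x p r D e Cm n : R) :
  p ^+ 2 <= e ^+ 2 -> 0 <= p -> 0 <= e -> 0 <= n -> x <= e -> r <= 2 * Cm * D + p ->
  2 * Cm * D <= e -> (1 + 5 * n) * e <= (1 - s0) / 2 ->
  x + s0 - 1 + n * p + 2 * (n * r) <= - ((1 - s0) / 2).
Proof.
move=> h1 p0 e0 n0 h2 h3 h4 h5.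
have pe : p <= e by rewrite -(@ler_pXn2r _ 2) ?nnegrE.
have a1 : n * p <= n * e by rewrite ler_wpM2l.
have a2 : n * r <= n * (e + e) by rewrite ler_wpM2l //; lra.
lra.
Qed.

Lemma addr_le_double (x y c d : R) : x <= c * d -> y <= c * d -> x + y <= 2 * c * d.
Proof. lra. Qed.
Lemma le_ratio_bound (c x e : R) : 0 <= c -> 0 <= x -> x <= e / (2 * c + 1) -> 2 * c * x <= e.
Proof. by move=> c0 x0; rewrite ler_pdivlMr; [nra | lra]. Qed.
Lemma sub_opp_opp (a b : R) : a = b - (- a - - b).
Proof. ring. Qed.
Lemma rect_descent_final (q y wE nE w0A h s0 n p r : R) :
  q <= n * p -> nE <= n * r -> - wE <= n * r -> w0A <= s0 ->
  y + s0 - 1 + n * p + 2 * (n * r) <= - ((1 - s0) / 2) ->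
  - (1 - q + (h - y)) - wE + nE <= - (w0A + h) - (1 - s0) / 2.
Proof. lra. Qed.

(* If [rank X > rank Xb], some unit [v] in the row space of [X] is killed by [Xb];
   a polar factor [W] of [X] is isometric there, so [u = W v] is a unit vector.
   Moving along [- u v^*], made feasible by tangent corrections, decreases the
   nuclear norm at unit rate, whereas [W0] only accounts for the rate [s0 < 1]. *)
Lemma rect_descent k m n d (Th : 'I_d -> 'M[C]_(m, n)) (al : {set 'I_d})
    (Xb W0 : 'M[C]_(m, n)) (G : 'M[C]_(n, m)) T M N (s0 : R) :
  k = KReal \/ k = KComplex ->
  (forall j, inV k (Th j)) -> (forall j, inV k (T j)) -> inV k W0 ->
  (forall j, T j = Xb *m M j + N j *m Xb) ->
  (forall i j, i \in al -> j \in al -> ip (Th i) (T j) = (i == j)%:R) ->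
  polar Xb W0 -> Xb *m G *m Xb = Xb -> ctr (Xb *m G) = Xb *m G -> ctr (G *m Xb) = G *m Xb ->
  s0 < 1 ->
  (forall (u : 'cV_m) (v : 'cV_n), frob u <= 1 -> frob v <= 1 -> Xb *m v = 0 ->
     ip W0 ((1%:M - Xb *m G) *m (u *m ctr v)) <= s0) ->
  exists kappa c delta : R, [/\ 0 < kappa, 0 < delta &
    forall X, inV k X -> frob (X - Xb) <= delta -> \rank X <> \rank Xb ->
      exists H a, [/\ inV k H, forall j, j \in al -> ip (Th j) H = 0, frob H <= c,
        dini (@nucnorm R m n) (fun=> True) X H a & a <= ip W0 H - kappa]].
Proof.
move=> hk hTh hTV hW0 hT hdual pW0 XGX XGh GXh s1 hs0.
pose pi := Xb *m G.
pose c1 j := frob (Th j) * frob (1%:M - pi).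
have c10 j : 0 <= c1 j by rewrite mulr_ge0.
pose Cm := \sum_(j in al) c1 j * frob (M j) + \sum_(j in al) c1 j * frob (N j).
have [CM0 CN0] : 0 <= \sum_(j in al) c1 j * frob (M j) /\ 0 <= \sum_(j in al) c1 j * frob (N j).
  by split; apply: sumr_ge0 => j _; rewrite mulr_ge0.
have Cm0 : 0 <= Cm by exact: addr_ge0.
pose cH := frob (1%:M - pi) + \sum_(j in al) c1 j * frob (T j).
pose sn := Num.sqrt (n%:R : R).
have sn0 : 0 <= sn by exact: sqrtr_ge0.
(* The final budget spends [e] on the tangent correction, [sn * e] on [pi *m u] and [4 * sn * e] on
   the error [E]: hence [1 + 5 * sn]. *)
pose e := (1 - s0) / 2 / (1 + 5 * sn).
have s5 : 0 < 1 + 5 * sn by lra.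
have e0 : 0 < e by apply: divr_gt0 => //; lra.
have [d1 d10 hd1] := polar_close Cm pW0 e0.
have [d2 d20 hd2] := polar_close (frob G) pW0 (mulr_gt0 e0 e0).
pose d3 := (frob G + 1)^-1; have d30 : 0 < d3 by rewrite invr_gt0 ltr_wpDl.
pose d4 := e / (2 * Cm + 1); have d40 : 0 < d4 by apply: divr_gt0 => //; lra.
exists ((1 - s0) / 2), cH, (Num.min (Num.min d1 d2) (Num.min (d3 / 2) d4)).
split; [lra | by rewrite !lt_min d10 d20 d40 divr_gt0 |].
move=> X XV; rewrite !le_min => /andP[/andP[D1 D2] /andP[D3 D4]] /eqP rk.
have rle : (\rank Xb <= \rank X)%N.
  apply: (rank_le_near XGX GXh).
  apply: (@le_lt_trans _ _ ((frob G) * (d3 / 2))); first by rewrite ler_wpM2l.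
  have g1 : frob G * d3 < 1 by rewrite ltr_pdivrMr ?mul1r ?ltrDl // ltr_wpDl.
  by have : 0 <= frob G * d3; [rewrite mulr_ge0 // ltW | lra].
have {rk rle} rk : (\rank Xb < \rank X)%N by rewrite ltn_neqAle eq_sym rk.
have [b [v [vv vb Xv]]] := rank_gt_witness rk.
have [W pW _] := nuc_polar X.
have cW := pW.1; have cW0 := pW0.1.
have fv : frob v = 1 by apply/eqP; rewrite -(@eqrXn2 _ 2) ?expr1n // frobE vv.
pose u := W *m v.
have fu : frob u <= 1 by rewrite -fv frob_contr.
have uW : ctr W *m u = v.
  case: pW => _ [l [P [Q [XE h1 h2]]]].
  have -> : v = Q *m (ctr P *m ctr b) by rewrite -(ctrK v) vb XE !ctrM ctrK mulmxA.
  have -> : u = P *m (ctr P *m ctr b).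
    by rewrite /u -(ctrK v) vb XE !ctrM ctrK -mulmxA mulmxA h1.
  by rewrite mulmxA h2.
have fuv : frob (u *m ctr v) <= 1.
  by apply: (le_trans (frob_outer _ _)); rewrite fv mulr1.
(* Removing the [pi] part leaves a direction on which [hs0] bounds [W0] by [s0]. *)
pose A := (1%:M - pi) *m (u *m ctr v).
have fA : frob A <= frob (1%:M - pi).
  by apply: (le_trans (frobM _ _)); rewrite -[X in _ <= X]mulr1 ler_wpM2l.
pose cc j := - ip (Th j) A.
have ccb j : `|cc j| <= c1 j.
  rewrite normrN; apply: (le_trans (ip_cauchy_abs _ _)); by rewrite ler_wpM2l.
pose HT := \sum_(j in al) rC (cc j) *: T j.
pose M1 := \sum_(j in al) rC (cc j) *: M j.
pose N1 := \sum_(j in al) rC (cc j) *: N j.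
have HTE : HT = Xb *m M1 + N1 *m Xb by exact: tangent_sum.
have fM1 : frob M1 <= Cm by apply: (le_trans (frob_comb al M ccb)); rewrite lerDl.
have fN1 : frob N1 <= Cm by apply: (le_trans (frob_comb al N ccb)); rewrite lerDr.
pose Hc := A + HT.
have fHc : frob Hc <= cH by apply: (le_trans (frobD _ _)); rewrite lerD // frob_comb.
pose D := X - Xb.
(* [u *m ctr v] is tangent at [X] because it equals [u *m b *m X]; [E] collects what fails to be
   tangent at [X]. *)
pose E := D *m M1 + N1 *m D + pi *m (u *m ctr v).
pose M2 := - M1; pose N2 := - N1 - u *m b.
have HcE : - Hc = X *m M2 + N2 *m X + E.
  rewrite /Hc HTE /A /M2 /N2 /E /D mulmxBl mul1mx mulmxN mulmxBl mulNmx.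
  rewrite mulmxBl mulmxBr -(mulmxA u) -vb.
  have -> : X *m M1 = Xb *m M1 + (X - Xb) *m M1 by rewrite -mulmxDl addrC subrK.
  by rewrite mulmxBl; apply/matrixP => i j; rewrite !mxE; ring.
pose a := ip W (X *m M2 + N2 *m X) + nucnorm E.
have HV : inV k (pV k (- Hc)) by exact: inV_pV_rect.
have HTpV : pV k HT = HT.
  apply: pV_id; apply/(inV_rect _ hk) => kr; rewrite /HT /conjM map_mx_sum.
  apply: eq_bigr => j _; rewrite -/(conjM _) conjMZ; congr (_ *: _).
  by have /(inV_rect _ hk) := hTV j; apply.
exists (pV k (- Hc)), a; split => //.
- move=> j ja; rewrite ip_pV // ipNr /Hc /HT /cc.
  by rewrite (feasible_corr A hdual hTh ja) oppr0.
- by apply: (le_trans (frob_pV _ _)); rewrite frobN.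
- by apply: dini_pV => //; [exact: nuc_pV | rewrite HcE; exact: dini_nuc].
rewrite ip_pV // /a.
have -> : ip W (X *m M2 + N2 *m X) = ip W (- Hc) - ip W E by rewrite HcE [in RHS]ipDr addrK.
have iWA : ip W A = 1 - ip W (pi *m (u *m ctr v)).
  by rewrite /A mulmxBl mul1mx ipBr ip_rank1 ip_mull uW vv.
have nE := nuc_frob E; have nE' : - ip W E <= sn * frob E.
  by rewrite -ipNr -(frobN E); exact: ip_contr_frob.
pose p := frob (pi *m u).
have nP : ip W (pi *m (u *m ctr v)) <= sn * p.
  apply: (le_trans (ip_contr_frob _ cW)); rewrite ler_wpM2l // mulmxA.
  by apply: (le_trans (frob_outer _ _)); rewrite fv mulr1.
have fE : frob E <= 2 * Cm * frob D + p.
  apply: (le_trans (frobD _ _)); apply: lerD.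
    apply: (le_trans (frobD _ _)).
    have x1 : frob (D *m M1) <= Cm * frob D.
      by apply: (le_trans (frobM _ _)); rewrite mulrC ler_wpM2r.
    have x2 : frob (N1 *m D) <= Cm * frob D.
      by apply: (le_trans (frobM _ _)); rewrite ler_wpM2r.
    exact: addr_le_double x1 x2.
  by rewrite mulmxA; apply: (le_trans (frob_outer _ _)); rewrite fv mulr1.
(* [pi *m u *m ctr v] is tangent at [Xb], so [W] and [W0] almost agree on it; their values are
   [p ^+ 2] and 0. This is why [d2] was taken for the tolerance [e * e]. *)
have pp : p ^+ 2 <= e ^+ 2.
  have pi2 : pi *m pi = pi by rewrite /pi mulmxA XGX.
  have t1 : Xb *m (G *m (u *m ctr v)) + 0 *m Xb = pi *m u *m ctr v.
    by rewrite mul0mx addr0 /pi !mulmxA.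
  have t2 : ip W (pi *m u *m ctr v) = p ^+ 2.
    rewrite ip_rank1 /p frobE -/u ip_mull XGh mulmxA -/pi pi2 //.
  have t3 : ip W0 (pi *m u *m ctr v) = 0.
    rewrite ip_rank1 ipC -mulmxA ip_mull.
    rewrite (mulmxA (ctr Xb)) -(polar_sym pW0) -mulmxA Xv mulmx0.
    by rewrite ip0r.
  have := hd2 X W pW D2 (G *m (u *m ctr v)) 0.
  rewrite t1 ipBl t2 t3 subr0 -expr2; apply; last by rewrite frob0.
  by apply: (le_trans (frobM _ _)); rewrite -[X in _ <= X]mulr1 ler_wpM2l.
have xx := hd1 X W pW D1 (- M1) (- N1).
rewrite !frobN mulmxN mulNmx -opprD -HTE in xx.
have {}xx := xx fM1 fN1.
have sA : ip W0 A <= s0 by apply: hs0 => //; rewrite fv.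
have h4 : 2 * Cm * frob D <= e.
  exact: le_ratio_bound Cm0 (frob_ge0 _) D4.
have h5 : (1 + 5 * sn) * e <= (1 - s0) / 2.
  by rewrite /e mulrC divfK // lt0r_neq0.
have x2 : ip W HT = ip W0 HT - ip (W - W0) (- HT) by rewrite ipBl !ipNr; exact: sub_opp_opp.
have := rect_descent_scalar 0 pp (frob_ge0 _) (ltW e0) sn0 xx fE h4 h5.
rewrite /Hc (ipNr W) (ipNr W0) (ipDr W A HT) (ipDr W0 A HT) iWA x2.
exact: rect_descent_final nP nE nE' sA.
Qed.

End Descent.

(** * Positive semidefinite matrices: tangent and descent directions *)

Section Psd.
Variable R : realType.
Local Notation C := R[i].
Implicit Types (m n l d : nat).

Lemma psdP n (X : 'M[C]_n) : is_psd X <-> ctr X = X /\ forall v : 'cV[C]_n, 0 <= ip v (X *m v).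
Proof. by split=> -[h1 h2]; split=> // v; move: (h2 v); rewrite ip_quad. Qed.

Lemma pdP n (X : 'M[C]_n) : is_pd X <->
  ctr X = X /\ forall v : 'cV[C]_n, v != 0 -> 0 < ip v (X *m v).
Proof. by split=> -[h1 h2]; split=> // v /h2; rewrite ip_quad. Qed.

Lemma inV_sym k n (A : 'M[C]_n) : k = KSym \/ k = KHerm ->
  inV k A <-> (kind_real k -> conjM A = A) /\ ctr A = A.
Proof.
move=> hk; have ks : kind_sym k by case: hk => ->.
split=> [[h1 h2]|[h1 h2]]; split=> //.
- by move=> /h1 /realmx_conjM.
- have [_ h] := h2 ks; apply/matrixP => i j; rewrite ctrE.
  by have := h i j; rewrite /ent !valK => ->.
- by move=> /h1 /realmx_conjM.
move=> _; split=> // i j; rewrite /ent.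
case: insubP => [i' _ ei|_]; case: insubP => [j' _ ej|_]; rewrite ?conjc0 //.
by rewrite -{1}h2 ctrE.
Qed.

Lemma ctr_conjM m n (A : 'M[C]_(m, n)) : ctr (conjM A) = conjM (ctr A).
Proof. by rewrite conjM_ctr. Qed.

Lemma inV_pV_sym k n (A : 'M[C]_n) : k = KSym \/ k = KHerm -> ctr A = A -> inV k (pV k A).
Proof.
move=> hk hA; apply/(inV_sym _ hk); split=> [kr|]; first by rewrite /pV kr reM_conjM.
by rewrite /pV; case: ifP => // _; rewrite /reM ctrZ ctrD ctr_conjM hA.
Qed.

Lemma inV1 k n : k = KSym \/ k = KHerm -> inV k (1%:M : 'M[C]_n).
Proof. by move=> hk; apply/(inV_sym _ hk); rewrite ctr1 /conjM map_mx1. Qed.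

Lemma psd_pV k n (A : 'M[C]_n) : is_psd A -> is_psd (pV k A).
Proof.
rewrite /pV; case: ifP => // _ /psdP[h1 h2]; apply/psdP; split.
  by rewrite /reM ctrZ ctrD ctr_conjM h1.
move=> v; rewrite /reM -scalemxAl mulmxDl ipZr ipDr.
apply: mulr_ge0; first by rewrite invr_ge0.
apply: addr_ge0; first exact: h2.
by rewrite -(conjMK v) -conjMM ip_conjM.
Qed.

Lemma psd_tangent_scalar (t b c x y z q : R) : 0 <= t -> t * (b + 1) <= c -> 0 <= x ->
  0 <= z -> c * x <= y -> q <= b * x -> 0 <= z - t ^+ 2 * q + t * y.
Proof.
move=> t0 tc x0 z0 h1 h2.
have a1 : t ^+ 2 * q <= t ^+ 2 * (b * x) by rewrite ler_wpM2l // sqr_ge0.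
have a2 : t * (c * x) <= t * y by rewrite ler_wpM2l.
have tx : 0 <= t * x by rewrite mulr_ge0.
have a3 : t * (b + 1) * (t * x) <= c * (t * x) by rewrite ler_wpM2r.
have a4 : 0 <= t * (t * x) by rewrite mulr_ge0.
lra.
Qed.

(** The tangent part is the congruence of [X] by [1 + t M], which preserves positivity, minus
    [t^2 M^* X M]. For small [t] the term [t E], with [E] at least [c], absorbs this loss. *)
Lemma psd_tangent n (X M E : 'M[C]_n) (c : R) : is_psd X -> ctr E = E -> 0 < c ->
  (forall v : 'cV[C]_n, c * ip v v <= ip v (E *m v)) ->
  exists2 t0 : R, 0 < t0 & forall t, 0 < t -> t < t0 ->
    is_psd (X + rC t *: (X *m M + ctr M *m X + E)).
Proof.
move=> /psdP[hX pX] hE c0 pE.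
pose b := frob X * frob M ^+ 2.
have b0 : 0 <= b by rewrite mulr_ge0 // sqr_ge0.
exists (c / (b + 1)); first by apply: divr_gt0 => //; rewrite ltr_wpDl.
move=> t t0; rewrite ltr_pdivlMr ?ltr_wpDl // => tc.
apply/psdP; split; first by rewrite ctrD ctrZ !ctrD !ctrM ctrK hX hE [_ *m X + _]addrC.
move=> v; pose w := v + rC t *: (M *m v).
have E1 : ip v ((X + rC t *: (X *m M + ctr M *m X + E)) *m v) =
    ip w (X *m w) - t ^+ 2 * ip (M *m v) (X *m (M *m v)) + t * ip v (E *m v).
  rewrite /w mulmxDl -scalemxAl !mulmxDl mulmxDr -scalemxAr.
  rewrite !(ipDr, ipDl, ipZr, ipZl) -!mulmxA (ip_mull M v (X *m v)).
  move: (ip v (X *m v)) (ip v (X *m (M *m v))) (ip v (ctr M *m (X *m v))) (ip v (E *m v)).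
  by move: (ip (M *m v) (X *m (M *m v))) => x1 x2 x3 x4 x5; ring.
have h1 : ip (M *m v) (X *m (M *m v)) <= b * ip v v.
  apply: (le_trans (ip_cauchy _ _)).
  apply: (@le_trans _ _ (frob (M *m v) * (frob X * frob (M *m v)))).
    by rewrite ler_wpM2l // frobM.
  rewrite mulrCA -expr2 /b -mulrA ler_wpM2l // -frobE -exprMn.
  by rewrite lerXn2r ?nnegrE ?mulr_ge0 // frobM.
rewrite E1; exact: psd_tangent_scalar (ltW t0) (ltW tc) (ip_ge0 v) (pX w) (pE v) h1.
Qed.

(** The trace is linear, so the growth bound is exact; only membership in the cone has content. *)
Lemma dini_psd n (X M E : 'M[C]_n) (c : R) : is_psd X -> ctr E = E -> 0 < c ->
  (forall v : 'cV[C]_n, c * ip v v <= ip v (E *m v)) ->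
  dini (ip 1%:M) (@is_psd R n) X (X *m M + ctr M *m X + E)
    (ip 1%:M (X *m M + ctr M *m X + E)).
Proof.
move=> pX hE c0 pE e e0; have [t0 t00 h] := psd_tangent M pX hE c0 pE.
exists t0 => // t tp tt; split; first exact: h.
rewrite (ipDr _ X) ipZr lerD2l; apply: ler_wpM2l; first exact: ltW.
by rewrite lerDl ltW.
Qed.

Lemma psd_descent_scalar (D cm c b1 : R) : 0 <= D -> 0 <= cm -> 0 < c -> 0 <= b1 ->
  D <= c / (4 * (cm + c * b1) + 1) -> 2 * (D * (cm + c * b1)) <= c / 2.
Proof.
move=> D0 cm0 c0 b0; have x0 : 0 <= cm + c * b1 by rewrite addr_ge0 // mulr_ge0 // ltW.
by rewrite ler_pdivlMr; [nra | lra].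
Qed.

Lemma psd_descent_final (w c j lam : R) : lam <= w -> c = lam / (2 * (`|j| + 1)) ->
  0 < lam -> - w + c * j <= - (lam / 2).
Proof.
move=> h1 -> l0; have x0 : 0 < `|j| + 1 by rewrite ltr_wpDl.
have : lam / (2 * (`|j| + 1)) * j <= lam / 2.
  rewrite mulrAC ler_pdivrMr ?mulr_gt0 //.
  have := ler_norm j; nra.
lra.
Qed.

(** Tangent plus error at [X]: [A] is split evenly between [X *m B] and [ctr B *m X], and tangents
    at [Xb] become tangents at [X] at the price of terms in [X - Xb]. *)
Lemma psd_direction n (X Xb A B J MT M1 : 'M[C]_n) (c : R) :
  X *m B = A -> ctr B *m X = A -> J = 1%:M + (Xb *m M1 + ctr M1 *m Xb) ->
  rC c *: J - (A + (Xb *m MT + ctr MT *m Xb)) =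
  X *m (- (MT - rC c *: M1) - rC 2^-1 *: B) + ctr (- (MT - rC c *: M1) - rC 2^-1 *: B) *m X
  + ((X - Xb) *m (MT - rC c *: M1) + ctr (MT - rC c *: M1) *m (X - Xb) + rC c *: 1%:M).
Proof.
move=> e1 e2 ->; rewrite !(ctrB, ctrN, ctrZ).
have : rC (2^-1) + rC 2^-1 = 1 :> C.
  by rewrite -rCD (_ : 2^-1 + 2^-1 = 1 :> R) //; field.
move: (rC c) (rC 2^-1) (ctr MT) (ctr M1) (ctr B) e2 => a z MT' M1' B' e2 zz.
have e3 : A = z *: A + z *: A by rewrite -scalerDl zz scale1r.
have l1 : X *m (- (MT - a *: M1) - z *: B) = - (X *m MT) + a *: (X *m M1) - z *: A.
  by rewrite mulmxBr mulmxN mulmxBr opprB addrC -!scalemxAr e1 [a *: _ - _]addrC addrC.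
have l2 : (- (MT' - a *: M1') - z *: B') *m X = - (MT' *m X) + a *: (M1' *m X) - z *: A.
  by rewrite mulmxBl mulNmx mulmxBl opprB addrC -!scalemxAl e2 [a *: _ - _]addrC addrC.
have l3 : (X - Xb) *m (MT - a *: M1) =
    X *m MT - Xb *m MT - a *: (X *m M1) + a *: (Xb *m M1).
  by rewrite mulmxBr !mulmxBl -!scalemxAr opprB addrA addrAC.
have l4 : (MT' - a *: M1') *m (X - Xb) =
    MT' *m X - MT' *m Xb - a *: (M1' *m X) + a *: (M1' *m Xb).
  by rewrite mulmxBr !mulmxBl -!scalemxAl opprB addrA addrAC; apply/matrixP => i j; rewrite !mxE; ring.
rewrite l1 l2 l3 l4 {1}e3 !scalerDr.
move: (z *: A) (a *: 1%:M) (Xb *m MT) (MT' *m Xb) (X *m MT) (MT' *m X).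
move: (a *: (Xb *m M1)) (a *: (M1' *m Xb)) (a *: (X *m M1)) (a *: (M1' *m X)).
by move=> a1 a2 a3 a4 a5 a6 a7 a8 a9 a10; apply/matrixP => i j; rewrite !mxE; ring.
Qed.

Lemma herm_tangent n (X M : 'M[C]_n) : ctr X = X ->
  ctr (X *m M + ctr M *m X) = X *m M + ctr M *m X.
Proof. by move=> h; rewrite ctrD !ctrM ctrK h addrC. Qed.

Lemma herm_error n (D A : 'M[C]_n) c : ctr D = D ->
  ctr (D *m A + ctr A *m D + rC c *: 1%:M) = D *m A + ctr A *m D + rC c *: 1%:M.
Proof. by move=> h; rewrite ctrD herm_tangent // ctrZ ctr1. Qed.

Lemma psd_error n (D A : 'M[C]_n) c (w : 'cV[C]_n) : 2 * (frob D * frob A) <= c / 2 ->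
  c / 2 * ip w w <= ip w ((D *m A + ctr A *m D + rC c *: 1%:M) *m w).
Proof.
move=> h.
have h1 : - (frob D * frob A * ip w w) <= ip w (D *m A *m w).
  rewrite lerNl -ipNr; apply: (le_trans (ip_cauchy _ _)); rewrite frobN.
  rewrite -frobE expr2 mulrCA ler_wpM2l //; apply: (le_trans (frobM _ _)).
  by rewrite ler_wpM2r // frobM.
have h2 : - (frob D * frob A * ip w w) <= ip w (ctr A *m D *m w).
  rewrite lerNl -ipNr; apply: (le_trans (ip_cauchy _ _)); rewrite frobN.
  rewrite -frobE expr2 mulrCA ler_wpM2l //; apply: (le_trans (frobM _ _)).
  by rewrite ler_wpM2r // [X in _ <= X]mulrC -(frob_ctr A) frobM.
rewrite !mulmxDl -scalemxAl mul1mx !ipDr ipZr.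
have h3 := ler_wpM2r (ip_ge0 w) h.
move: h1 h2 h3; move: (ip w _) (ip w _) (ip w w) (frob D * _) => x1 x2 x3 x4; lra.
Qed.

(* The argument of [rect_descent] with [u = v].  The extra multiple of [J] along the
   direction keeps [X + tH] positive semidefinite. *)
Lemma psd_descent k n d (Th : 'I_d -> 'M[C]_n) (al : {set 'I_d})
    (Xb W0 G J M1 : 'M[C]_n) (T M : 'I_d -> 'M[C]_n) (lam : R) :
  k = KSym \/ k = KHerm ->
  (forall j, inV k (Th j)) -> (forall j, inV k (T j)) -> inV k W0 ->
  (forall j, T j = Xb *m M j + ctr (M j) *m Xb) ->
  (forall i j, i \in al -> j \in al -> ip (Th i) (T j) = (i == j)%:R) ->
  inV k J -> J = 1%:M + (Xb *m M1 + ctr M1 *m Xb) ->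
  (forall j, j \in al -> ip (Th j) J = 0) ->
  is_psd Xb -> W0 *m Xb = Xb ->
  Xb *m G *m Xb = Xb -> ctr (G *m Xb) = G *m Xb -> 0 < lam ->
  (forall v : 'cV_n, ip v v = 1 -> Xb *m v = 0 -> lam <= ip (1%:M - W0) (v *m ctr v)) ->
  exists kappa c delta : R, [/\ 0 < kappa, 0 < delta &
    forall X, inV k X -> is_psd X -> frob (X - Xb) <= delta -> \rank X <> \rank Xb ->
      exists H a, [/\ inV k H, forall j, j \in al -> ip (Th j) H = 0, frob H <= c,
        dini (ip 1%:M) (@is_psd R n) X H a & a <= ip W0 H - kappa]].
Proof.
move=> hk hTh hTV hW0 hT hdual hJ JE hJa /psdP[Xbh _] W0X XGX GXh l0 hlam.
have W0h : ctr W0 = W0 by have /(inV_sym _ hk)[] := hW0.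
pose c1 j := frob (Th j).
have c10 j : 0 <= c1 j by exact: frob_ge0.
pose Cm := \sum_(j in al) c1 j * frob (M j).
have Cm0 : 0 <= Cm by apply: sumr_ge0 => j _; rewrite mulr_ge0.
(* Small enough that adding [c J] costs at most half of the gain [lam]. *)
pose c := lam / (2 * (`|ip (1%:M - W0) J| + 1)).
have c0 : 0 < c.
  by apply: divr_gt0 => //; apply: mulr_gt0 => //; rewrite ltr_wpDl.
pose cH := 1 + \sum_(j in al) c1 j * frob (T j) + c * frob J.
pose d3 := (frob G + 1)^-1; have d30 : 0 < d3 by rewrite invr_gt0 ltr_wpDl.
(* Within this distance the displacement terms are at most [c / 2], so the error matrix stays
   bounded below by [c / 2]. *)
pose d4 := c / (4 * (Cm + c * frob M1) + 1).
have d40 : 0 < d4.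
  apply: divr_gt0 => //; rewrite ltr_wpDl // mulr_ge0 // addr_ge0 // mulr_ge0 //.
  exact: ltW.
exists (lam / 2), cH, (Num.min (d3 / 2) d4).
split; [exact: divr_gt0 | by rewrite lt_min d40 divr_gt0 |].
move=> X XV pX; rewrite !le_min => /andP[D3 D4] /eqP rk.
have rle : (\rank Xb <= \rank X)%N.
  apply: (rank_le_near XGX GXh).
  apply: (@le_lt_trans _ _ ((frob G) * (d3 / 2))); first by rewrite ler_wpM2l.
  have g1 : frob G * d3 < 1 by rewrite ltr_pdivrMr ?mul1r ?ltrDl // ltr_wpDl.
  by have : 0 <= frob G * d3; [rewrite mulr_ge0 // ltW | lra].
have {rk rle} rk : (\rank Xb < \rank X)%N by rewrite ltn_neqAle eq_sym rk.
have [b [v [vv vb Xv]]] := rank_gt_witness rk.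
have Xh : ctr X = X by case/psdP: pX.
have vE : v = X *m ctr b by rewrite -(ctrK v) vb ctrM Xh.
have fv : frob v = 1 by apply/eqP; rewrite -(@eqrXn2 _ 2) ?expr1n // frobE vv.
pose A := v *m ctr v.
have fA : frob A <= 1 by apply: (le_trans (frob_outer _ _)); rewrite fv mulr1.
pose cc j := - ip (Th j) A.
have ccb j : `|cc j| <= c1 j.
  rewrite normrN; apply: (le_trans (ip_cauchy_abs _ _)).
  by rewrite -[X in _ <= X]mulr1 ler_wpM2l.
pose HT := \sum_(j in al) rC (cc j) *: T j.
pose MT := \sum_(j in al) rC (cc j) *: M j.
have HTE : HT = Xb *m MT + ctr MT *m Xb.
  have -> : ctr MT = \sum_(j in al) rC (cc j) *: ctr (M j).
    by rewrite /MT ctr_sum; apply: eq_bigr => j _; rewrite ctrZ.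
  exact: (tangent_sum al cc hT).
have fMT : frob MT <= Cm by exact: (frob_comb al M ccb).
pose Hc := rC c *: J - (A + HT).
have fHc : frob Hc <= cH.
  apply: (le_trans (frobB _ _)); rewrite frobZ (gtr0_norm c0) addrC lerD2r.
  by apply: (le_trans (frobD _ _)); rewrite lerD // frob_comb.
pose D := X - Xb.
pose A' := MT - rC c *: M1.
pose E := D *m A' + ctr A' *m D + rC c *: 1%:M.
pose M2 := - A' - rC 2^-1 *: (ctr b *m ctr v).
have HcE : Hc = X *m M2 + ctr M2 *m X + E.
  rewrite /Hc HTE; apply: psd_direction JE; first by rewrite mulmxA -vE.
  by rewrite ctrM !ctrK -mulmxA -vb.
have Eh : ctr E = E.
  have Dh : ctr D = D by rewrite /D ctrB Xh Xbh.
  exact: herm_error.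
have fA' : frob A' <= Cm + c * frob M1.
  by apply: (le_trans (frobB _ _)); rewrite frobZ (gtr0_norm c0) lerD2r.
have pE (w : 'cV_n) : c / 2 * ip w w <= ip w (E *m w).
  apply: psd_error; apply: le_trans (psd_descent_scalar (frob_ge0 D) Cm0 c0 (frob_ge0 M1) D4).
  by rewrite ler_pM2l // ler_wpM2l.
have dn := dini_psd M2 pX Eh (divr_gt0 c0 (ltr0Sn R 1)) pE.
rewrite -HcE in dn.
have Ah : ctr A = A by rewrite /A ctrM ctrK.
have HTh : ctr HT = HT by rewrite HTE; exact: herm_tangent.
have Jh : ctr J = J by have /(inV_sym _ hk)[] := hJ.
have Hch : ctr Hc = Hc by rewrite /Hc ctrB ctrZ ctrD Ah HTh Jh.
have HV := inV_pV_sym hk Hch.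
exists (pV k Hc), (ip 1%:M Hc); split => //.
- move=> j ja; rewrite ip_pV // /Hc ipBr ipZr hJa // mulr0 sub0r.
  by rewrite /HT /cc (feasible_corr A hdual hTh ja) oppr0.
- exact: le_trans (frob_pV _ _) fHc.
- apply: dini_pV => //; last by move=> Y; exact: psd_pV.
  by move=> Y; rewrite ip_pV //; exact: inV1.
rewrite ip_pV //.
(* [HT] is tangent at [Xb], where the trace and [W0] agree. *)
have z : ip (1%:M - W0) HT = 0.
  have z1 : (1%:M - W0) *m Xb = 0 by rewrite mulmxBl mul1mx W0X subrr.
  have z2 : Xb *m (1%:M - W0) = 0.
    by rewrite -(ctrK (Xb *m _)) ctrM ctrB ctr1 W0h Xbh z1 ctr0.
  rewrite HTE ipDr [X in X + _]ipC ip_mull Xbh z2 ip0r add0r.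
  by rewrite ipC ip_mulr Xbh z1 ip0r.
have e : ip (1%:M - W0) Hc = - ip (1%:M - W0) A + c * ip (1%:M - W0) J.
  by rewrite /Hc ipBr (ipDr _ A HT) z addr0 ipZr addrC.
have -> : ip 1%:M Hc = ip W0 Hc + ip (1%:M - W0) Hc by rewrite ipBl addrC subrK.
rewrite e lerD2l; exact: psd_descent_final (hlam v vv Xv) erefl l0.
Qed.

(** Supplies admissible approximations of [Dh]: the identity contained in [J] is the positive part
    that [dini_psd] asks for. *)
Lemma dini_psd_tangent n (Xb Dh J M0 M1 : 'M[C]_n) (tau : R) :
  is_psd Xb -> 0 < tau -> Dh = Xb *m M0 + ctr M0 *m Xb ->
  J = 1%:M + (Xb *m M1 + ctr M1 *m Xb) ->
  dini (ip 1%:M) (@is_psd R n) Xb (Dh + rC tau *: J) (ip 1%:M (Dh + rC tau *: J)).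
Proof.
move=> pX t0 -> ->.
have -> : Xb *m M0 + ctr M0 *m Xb + rC tau *: (1%:M + (Xb *m M1 + ctr M1 *m Xb)) =
    Xb *m (M0 + rC tau *: M1) + ctr (M0 + rC tau *: M1) *m Xb + rC tau *: 1%:M.
  rewrite ctrD ctrZ mulmxDr mulmxDl -scalemxAr -scalemxAl !scalerDr.
  by apply/matrixP => i j; rewrite !mxE; ring.
apply: (dini_psd _ pX _ t0); first by rewrite ctrZ ctr1.
by move=> v; rewrite -scalemxAl mul1mx ipZr.
Qed.

End Psd.

(** * Perturbed minimisers *)

Section Deterministic.
Variable R : realType.
Local Notation C := R[i].
Variables (k : space_kind) (m n d : nat) (Th : 'I_d -> 'M[C]_(m, n)) (al : {set 'I_d}).
Implicit Types (w e : 'I_d -> R) (X Y D H : 'M[C]_(m, n)).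

Definition wform w D H := \sum_(j in ~: al) w j * (ip (Th j) D * ip (Th j) H).
Definition noise_form e H := \sum_(j in ~: al) e j * ip (Th j) H.

Lemma wformC w D H : wform w D H = wform w H D.
Proof. by apply: eq_bigr => j _; rewrite [X in _ * X]mulrC. Qed.
Lemma wformDr w D H H' : wform w D (H + H') = wform w D H + wform w D H'.
Proof. by rewrite -big_split; apply: eq_bigr => j _ /=; rewrite ipDr !mulrDr. Qed.
Lemma wformZr w t D H : wform w D (rC t *: H) = t * wform w D H.
Proof. by rewrite mulr_sumr; apply: eq_bigr => j _; rewrite ipZr; ring. Qed.
Lemma wformDl w D H H' : wform w (D + H') H = wform w D H + wform w H' H.
Proof. by rewrite wformC wformDr ![wform w H _]wformC. Qed.
Lemma wformZl w t D H : wform w (rC t *: D) H = t * wform w D H.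
Proof. by rewrite wformC wformZr wformC. Qed.
Lemma noise_formD e H H' : noise_form e (H + H') = noise_form e H + noise_form e H'.
Proof. by rewrite -big_split; apply: eq_bigr => j _ /=; rewrite ipDr mulrDr. Qed.
Lemma noise_formZ e t H : noise_form e (rC t *: H) = t * noise_form e H.
Proof. by rewrite mulr_sumr; apply: eq_bigr => j _; rewrite ipZr; ring. Qed.
Lemma wformB w w' D H : wform w D H - wform w' D H = wform (fun j => w j - w' j) D H.
Proof. by rewrite -sumrB; apply: eq_bigr => j _; rewrite mulrBl. Qed.

Hypothesis onb : onb_of k Th.

Lemma ip_Th_le j X : `|ip (Th j) X| <= frob X.
Proof.
have [_ h _] := onb; have := ip_cauchy_abs (Th j) X.
have -> : frob (Th j) = 1; last by rewrite mul1r.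
by apply/eqP; rewrite -(@eqrXn2 _ 2) ?expr1n // frobE h eqxx.
Qed.

Lemma sum_const_le (c : R) : 0 <= c -> \sum_(j in ~: al) c <= c * d%:R.
Proof.
move=> c0; rewrite sumr_const -(mulr_natr c) ler_wpM2l // ler_nat.
by rewrite -[X in (_ <= X)%N]card_ord max_card.
Qed.

Lemma wform_bound w eps D H : 0 <= eps -> (forall j, j \in ~: al -> `|w j| <= eps) ->
  `|wform w D H| <= eps * d%:R * (frob D * frob H).
Proof.
move=> e0 h; apply: (le_trans (ler_norm_sum _ _ _)).
apply: (@le_trans _ _ (\sum_(j in ~: al) eps * (frob D * frob H))).
  apply: ler_sum => j ja; rewrite !normrM; apply: ler_pM => //; last by apply: ler_pM => //; exact: ip_Th_le.
  exact: h.
by rewrite mulrAC sum_const_le // !mulr_ge0.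
Qed.

Lemma noise_form_bound e eps H : 0 <= eps -> (forall j, j \in ~: al -> `|e j| <= eps) ->
  `|noise_form e H| <= eps * d%:R * frob H.
Proof.
move=> e0 h; apply: (le_trans (ler_norm_sum _ _ _)).
apply: (@le_trans _ _ (\sum_(j in ~: al) eps * frob H)).
  by apply: ler_sum => j ja; rewrite !normrM; apply: ler_pM => //; [exact: h | exact: ip_Th_le].
by rewrite mulrAC sum_const_le // mulr_ge0.
Qed.

Lemma parseval X : inV k X -> ip X X = \sum_j ip (Th j) X ^+ 2.
Proof.
case: onb => _ _ h /h e; rewrite {2}e ip_sumr; apply: eq_bigr => j _.
by rewrite ipZr expr2 [ip X _]ipC.
Qed.

Definition feasible X := inV k X /\ forall j, j \in al -> ip (Th j) X = 0.

(** Parseval: a feasible matrix has no [al]-coefficients, so the sampled ones carry its whole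
    norm. *)
Lemma wform_coercive p pm X : feasible X -> (forall j, j \in ~: al -> pm <= p j) ->
  pm * frob X ^+ 2 <= wform p X X.
Proof.
move=> [hV ha] hp; rewrite frobE parseval // (bigID (mem al)) /= big1 ?add0r; last first.
  by move=> j ja; rewrite ha // expr0n.
rewrite mulr_sumr (eq_bigl (fun j => j \in ~: al)) => [|j]; last by rewrite inE.
apply: ler_sum => j ja; rewrite -expr2 ler_wpM2r ?sqr_ge0 //; exact: hp.
Qed.

(* The objective of (RC) or (RC+) up to a constant: [w] holds the empirical
   sampling frequencies, [e] the averaged noise per basis element. *)
Definition obj (phi : 'M[C]_(m, n) -> R) w e rho Ft gam Xt Xb X :=
  2^-1 * wform w (X - Xb) (X - Xb) - noise_form e (X - Xb)
  + rho * (phi X - ip Ft X + gam / 2 * frob (X - Xt) ^+ 2).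

Lemma obj_expand phi w e rho Ft gam Xt Xb X t H :
  obj phi w e rho Ft gam Xt Xb (X + rC t *: H) =
  obj phi w e rho Ft gam Xt Xb X
  + (t * wform w (X - Xb) H + t ^+ 2 * (2^-1 * wform w H H) - t * noise_form e H
     + rho * (phi (X + rC t *: H) - phi X - t * ip Ft H
       + gam * (t * ip (X - Xt) H + t ^+ 2 * (2^-1 * frob H ^+ 2)))).
Proof.
rewrite /obj.
have -> : X + rC t *: H - Xb = (X - Xb) + rC t *: H by rewrite addrAC.
have -> : X + rC t *: H - Xt = (X - Xt) + rC t *: H by rewrite addrAC.
move: (X - Xb) (X - Xt) (phi _) (phi _) => A B p1 p2.
rewrite !frobE !(wformDr, wformDl, wformZr, wformZl, noise_formD, noise_formZ) (wformC w H A).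
rewrite !(ipDr, ipDl, ipZr, ipZl) (ipC H B).
move: (wform w A A) (wform w A H) (wform w H H) (noise_form e A) (noise_form e H) (ip Ft X) (ip Ft H) (ip B B) (ip B H) (ip H H).
by move=> b1 b2 b3 l1 l2 f1 f2 g1 g2 g3; field.
Qed.

Lemma linear_nonneg (u v : R) : (exists2 t0, 0 < t0 & forall t, 0 < t -> t < t0 -> 0 <= u + t * v) -> 0 <= u.
Proof.
case=> t0 t00 h; rewrite leNgt; apply/negP => u0.
pose t := Num.min (t0 / 2) (- u / (2 * (`|v| + 1))).
have v1 : 0 < `|v| + 1 by rewrite ltr_wpDl.
have q0 : 0 < - u / (2 * (`|v| + 1)) by rewrite divr_gt0 ?mulr_gt0 // oppr_gt0.
have t1 : 0 < t by rewrite lt_min q0 divr_gt0.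
have t2 : t < t0 by rewrite gt_min; apply/orP; left; lra.
have t3 : t * (2 * (`|v| + 1)) <= - u by rewrite -ler_pdivlMr ?mulr_gt0 // ge_min lexx orbT.
have := h t t1 t2; have := ler_norm v; nra.
Qed.

Lemma first_order_scalar (t b1 b2 l rho p1 p0 f gam g1 g2 a z : R) :
  0 < t -> 0 < rho -> p1 <= p0 + t * (a + z) ->
  0 <= t * b1 + t ^+ 2 * b2 - t * l + rho * (p1 - p0 - t * f + gam * (t * g1 + t ^+ 2 * g2)) ->
  0 <= (b1 - l + rho * (a - f + gam * g1)) + rho * z + t * (b2 + rho * (gam * g2)).
Proof.
move=> t0 r0 h1 h2; rewrite -(pmulr_rge0 _ t0); apply: (le_trans h2).
rewrite -subr_ge0; set x := (X in 0 <= X).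
have -> : x = rho * (p0 + t * (a + z) - p1) by rewrite /x; ring.
by rewrite pmulr_rge0 // subr_ge0.
Qed.

(** Divide the optimality inequality at [X + t H] by [t] and let [t] tend to 0. The slack [z] of
    [dini] is chosen to use up half of a supposedly negative value. *)
Lemma first_order phi dom w e rho Ft gam Xt Xb X H a :
  0 < rho -> (forall t, inV k (X + rC t *: H)) ->
  (forall Y, inV k Y -> dom Y -> (forall j, j \in al -> ip (Th j) (Y - X) = 0) ->
    obj phi w e rho Ft gam Xt Xb X <= obj phi w e rho Ft gam Xt Xb Y) ->
  (forall j, j \in al -> ip (Th j) H = 0) ->
  dini phi dom X H a ->
  0 <= wform w (X - Xb) H - noise_form e H + rho * (a - ip Ft H + gam * ip (X - Xt) H).
Proof.
move=> r0 XHV opt Ha hd.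
rewrite leNgt; apply/negP => neg.
set u := (X in X < 0) in neg.
pose z := - u / (2 * rho).
have z0 : 0 < z by rewrite divr_gt0 ?mulr_gt0 // oppr_gt0.
have [t0 t00 ht] := hd _ z0.
pose v := 2^-1 * wform w H H + rho * (gam * (2^-1 * frob H ^+ 2)).
have : 0 <= u + rho * z.
  apply: (@linear_nonneg _ v); exists t0 => // t tp tt.
  have [hdom hphi] := ht t tp tt.
  have := opt _ (XHV t) hdom; rewrite obj_expand lerDl => hh.
  have fe j : j \in al -> ip (Th j) (X + rC t *: H - X) = 0.
    by move=> ja; rewrite addrC addKr ipZr Ha // mulr0.
  exact: first_order_scalar tp r0 hphi (hh fe).
have -> : u + rho * z = u / 2 by rewrite /z; field; rewrite gt_eqF.
by rewrite pmulr_lge0 ?invr_gt0 // leNgt neg.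
Qed.

End Deterministic.

(** * Closure of the matrix spaces under real linear combinations *)

Section RealSubspace.
Variable R : realType.
Local Notation C := R[i].

Lemma entD m n (A B : 'M[C]_(m, n)) i j : ent (A + B) i j = ent A i j + ent B i j.
Proof. by rewrite /ent; case: insubP => [? _ _|_]; [case: insubP => [? _ _|_] |]; rewrite ?mxE ?addr0. Qed.
Lemma entZ m n t (A : 'M[C]_(m, n)) i j : ent (rC t *: A) i j = rC t * ent A i j.
Proof. by rewrite /ent; case: insubP => [? _ _|_]; [case: insubP => [? _ _|_] |]; rewrite ?mxE ?mulr0. Qed.

Lemma inVD k m n (A B : 'M[C]_(m, n)) : inV k A -> inV k B -> inV k (A + B).
Proof.
move=> [h1 h2] [h3 h4]; split=> [kr i j|ks].
  by rewrite mxE; have := h1 kr i j; have := h3 kr i j; case: (A i j) (B i j) => [a b] [c e] /= -> ->; rewrite addr0.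
have [e h] := h2 ks; have [_ h'] := h4 ks; split=> // i j.
by rewrite !entD h h' [RHS](rmorphD (@conjc R)).
Qed.
Lemma inVZ k m n t (A : 'M[C]_(m, n)) : inV k A -> inV k (rC t *: A).
Proof.
move=> [h1 h2]; split=> [kr i j|ks].
  by rewrite mxE; have := h1 kr i j; case: (A i j) => a b /= ->; rewrite mulr0 mul0r addr0.
by have [e h] := h2 ks; split=> // i j; rewrite !entZ h conj_rCM.
Qed.
Lemma inVB k m n (A B : 'M[C]_(m, n)) : inV k A -> inV k B -> inV k (A - B).
Proof.
move=> hA hB; have -> : - B = rC (-1) *: B by rewrite rCN rC1 scaleN1r.
by apply: inVD => //; exact: inVZ.
Qed.
Lemma inV_sum k m n I (r : seq I) (P : pred I) (F : I -> 'M[C]_(m, n)) :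
  (forall i, P i -> inV k (F i)) -> inV k (0 : 'M[C]_(m, n)) -> inV k (\sum_(i <- r | P i) F i).
Proof. by move=> h h0; elim/big_rec: _ => // i A Pi hA; apply: inVD => //; exact: h. Qed.
End RealSubspace.

(** * Scalar inequalities behind the perturbation argument *)

Section ScalarEstimates.
Variable R : realType.
Implicit Types (x y b tau eta M : R).

(** Compares the objectives at the minimiser (suffix [D], norm [y]) and at a trial point (suffix
    [T], norm [yT]) after division by [q ^+ 2]. The letters [b] and [p] stand for the empirical and
    the limiting quadratic form. *)
Lemma minimizer_comparison_scalar (q bD bT pD pT cD cT lD lT fD fT FD FT gD gT wD wT wh PD PT : R)
  (y yT eps d gam M tau a : R) :
  0 < q -> 0 <= y -> 0 <= yT -> 0 <= gam -> gam <= M -> 0 <= eps -> 0 <= d ->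
  `|bD - pD| <= eps * d * (y * y) -> `|bT - pT| <= eps * d * (yT * yT) ->
  `|lD| <= (eps * q) * d * y -> `|lT| <= (eps * q) * d * yT ->
  `|fD - FD| <= eps * y -> `|fT - FT| <= eps * yT ->
  `|gD| <= eps * y -> `|gT| <= eps * yT ->
  cD = FD - wD -> cT = FT - wT -> q * wD <= PD -> PT <= q * (a + tau) -> a <= wh + tau ->
  q ^+ 2 * (2^-1 * bD) - q * lD + q * (PD - q * fD + gam * (q * gD + q ^+ 2 * (2^-1 * y ^+ 2)))
  <= q ^+ 2 * (2^-1 * bT) - q * lT + q * (PT - q * fT + gam * (q * gT + q ^+ 2 * (2^-1 * yT ^+ 2))) ->
  pD / 2 - cD <= pT / 2 - cT + (wh - wT) + 2 * tau
   + eps * (d * (y ^+ 2 + yT ^+ 2) / 2 + (d + 1 + M) * (y + yT)) + M * q * yT ^+ 2 / 2.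
Proof.
move=> q0 y0 yT0 g0 gM e0 d0 /ler_normlP[B1 _] /ler_normlP[_ B2] /ler_normlP[_ L1] /ler_normlP[L2 _]
  /ler_normlP[_ F1] /ler_normlP[F2 _] /ler_normlP[G1 _] /ler_normlP[_ G2] -> -> hP hT ha h.
have gy : gam * - gD <= M * (eps * y).
  apply: (@le_trans _ _ (gam * (eps * y))); first by rewrite ler_wpM2l.
  by rewrite ler_wpM2r // mulr_ge0.
have gyT : gam * gT <= M * (eps * yT).
  apply: (@le_trans _ _ (gam * (eps * yT))); first by rewrite ler_wpM2l.
  by rewrite ler_wpM2r // mulr_ge0.
have qy : 0 <= gam * (q * (2^-1 * y ^+ 2)).
  by rewrite !mulr_ge0 ?sqr_ge0 ?invr_ge0 // ltW.
have qyT : gam * (q * (2^-1 * yT ^+ 2)) <= M * (q * (2^-1 * yT ^+ 2)).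
  by rewrite ler_wpM2r // !mulr_ge0 ?sqr_ge0 ?invr_ge0 // ltW.
have h' : q * (2^-1 * bD) - lD + (PD - q * fD + gam * (q * gD + q ^+ 2 * (2^-1 * y ^+ 2)))
  <= q * (2^-1 * bT) - lT + (PT - q * fT + gam * (q * gT + q ^+ 2 * (2^-1 * yT ^+ 2))).
  rewrite -(ler_pM2l q0); lra.
have h2 : 2^-1 * bD - eps * d * y + wD - fD + gam * gD + gam * (q * (2^-1 * y ^+ 2)) <=
  2^-1 * bT + eps * d * yT + (a + tau) - fT + gam * gT + gam * (q * (2^-1 * yT ^+ 2)).
  rewrite -(ler_pM2l q0); lra.
lra.
Qed.

(** [x] is the distance to [Dh]. As [y <= x + b], the errors grow like [1 + x ^+ 2]; the coercive
    side absorbs the quadratic part since [eps * A <= pm / 4], leaving three terms of size at most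
    [pm * eta ^+ 2 / 16]. *)
Lemma scaled_error_scalar (x y yT b w d M K A pm eps tau q eta : R) :
  0 < pm -> 0 < eta -> 0 <= x -> 0 <= y -> 0 <= yT -> 0 <= b -> 0 <= w -> 0 <= d -> 0 <= M ->
  0 <= K -> 0 <= eps -> 0 <= tau -> tau <= 1 -> 0 <= q ->
  y <= x + b -> yT <= b + 1 ->
  A = (d + 2 * K) + (d * b ^+ 2 + d * (b + 1) ^+ 2 / 2 + K * (2 + 2 * b ^+ 2 + b)) ->
  (d + w + 2) * tau <= pm * eta ^+ 2 / 16 ->
  eps * A <= pm / 4 -> eps * A <= pm * eta ^+ 2 / 16 ->
  M * q * (b + 1) ^+ 2 / 2 <= pm * eta ^+ 2 / 16 ->
  pm / 2 * x ^+ 2 <= d / 2 * tau ^+ 2 + w * tau + 2 * tau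
    + eps * (d * (y ^+ 2 + yT ^+ 2) / 2 + K * (y + yT)) + M * q * yT ^+ 2 / 2 ->
  x <= eta.
Proof.
move=> pm0 eta0 x0 y0 yT0 b0 w0 d0 M0 K0 e0 t0 t1 q0 hy hyT AE h1 h2 h3 h4 h.
have tt : d / 2 * tau ^+ 2 <= d * tau.
  have : tau ^+ 2 <= tau by rewrite expr2 ler_piMr.
  move=> /(ler_wpM2l d0); have : 0 <= d * tau by rewrite mulr_ge0.
  lra.
have y2 : y ^+ 2 <= 2 * x ^+ 2 + 2 * b ^+ 2.
  have : y ^+ 2 <= (x + b) ^+ 2 by rewrite lerXn2r ?nnegrE ?addr_ge0.
  have := sqr_ge0 (x - b); lra.
have yT2 : yT ^+ 2 <= (b + 1) ^+ 2 by rewrite lerXn2r ?nnegrE ?addr_ge0.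
have y1 : y <= 1 + 2 * x ^+ 2 + 2 * b ^+ 2.
  have := sqr_ge0 (y - 1); lra.
have k1 : d * (y ^+ 2 + yT ^+ 2) / 2 <= d * (2 * x ^+ 2 + 2 * b ^+ 2 + (b + 1) ^+ 2) / 2.
  by rewrite ler_pM2r ?invr_gt0 // ler_wpM2l // lerD.
have k2 : K * (y + yT) <= K * (1 + 2 * x ^+ 2 + 2 * b ^+ 2 + (b + 1)).
  by rewrite ler_wpM2l // lerD.
have k3 : d * (y ^+ 2 + yT ^+ 2) / 2 + K * (y + yT) <= A * (1 + x ^+ 2).
  apply: (le_trans (lerD k1 k2)); rewrite AE.
  have x20 : 0 <= x ^+ 2 by exact: sqr_ge0.
  have a1 : 0 <= d * b ^+ 2 + d * (b + 1) ^+ 2 / 2 + K * (2 + 2 * b ^+ 2 + b).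
    by rewrite !addr_ge0 ?mulr_ge0 ?addr_ge0 ?mulr_ge0 ?sqr_ge0.
  have := mulr_ge0 a1 x20; lra.
have k4 := ler_wpM2l e0 k3.
have x20 : 0 <= x ^+ 2 by exact: sqr_ge0.
have k5 : eps * A * x ^+ 2 <= pm / 4 * x ^+ 2 by rewrite ler_wpM2r.
have k6 : M * q * yT ^+ 2 / 2 <= M * q * (b + 1) ^+ 2 / 2.
  by rewrite ler_pM2r ?invr_gt0 // ler_wpM2l // mulr_ge0.
have k7 : pm * x ^+ 2 <= pm * eta ^+ 2.
  have : 0 <= pm * eta ^+ 2 by rewrite mulr_ge0 ?sqr_ge0 ?ltW.
  lra.
by rewrite -(@ler_pXn2r _ 2) ?nnegrE ?(ltW eta0) // -(ler_pM2l pm0).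
Qed.

(** The localisation error, the data error and the proximal term are each at most [kap / 4], so
    together they cannot offset the margin [kap]. *)
Lemma descent_contradiction_scalar (kap c eps d x y b M q Bn l fH gH wH BH a gam fd F eta : R) :
  0 < kap -> 0 <= c -> 0 < q -> 0 <= eps -> 0 <= d -> 0 <= x -> 0 <= y -> 0 <= M ->
  0 <= gam -> gam <= M -> y <= b + 1 -> x <= eta ->
  d * eta * c <= kap / 4 -> c * eps * (d * (b + 1) + 1 + d + M) <= kap / 4 ->
  M * c * (q * (b + 1)) <= kap / 4 ->
  `|Bn - BH| <= eps * d * (y * c) + 1 * d * (x * c) ->
  `|l| <= (eps * q) * d * c -> `|fd| <= eps * c -> `|gH| <= (q * y + eps) * c ->
  fH = F + fd -> BH = F - wH -> a <= wH - kap ->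
  0 <= q * Bn - l + q * (a - fH + gam * gH) -> False.
Proof.
move=> k0 c0 q0 e0 d0 x0 y0 M0 g0 gM yb xe h1 h2 h3 /ler_normlP[_ B1] /ler_normlP[L1 _]
  /ler_normlP[F1 _] /ler_normlP[_ G1] -> BE ha h.
have g1 : gam * gH <= M * ((q * y + eps) * c).
  apply: (@le_trans _ _ (gam * ((q * y + eps) * c))); first by rewrite ler_wpM2l.
  by rewrite ler_wpM2r // mulr_ge0 // addr_ge0 // mulr_ge0 // ltW.
have h' : 0 <= Bn + eps * d * c + (a - (F + fd) + gam * gH).
  rewrite -(pmulr_rge0 _ q0); lra.
have u1 : eps * d * (y * c) <= eps * d * ((b + 1) * c).
  by rewrite ler_wpM2l ?mulr_ge0 // ler_wpM2r.
have u2 : d * (x * c) <= d * (eta * c) by rewrite ler_wpM2l // ler_wpM2r.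
have u3 : M * (q * y * c) <= M * (q * (b + 1) * c).
  by rewrite ler_wpM2l // ler_wpM2r // ler_wpM2l // ltW.
lra.
Qed.

End ScalarEstimates.

Lemma minimizer_combine_scalar (R : realType) (pD cD pT cT hh wTh tau w0 pm x d E Q : R) :
  pD / 2 - cD <= pT / 2 - cT + wTh + 2 * tau + E + Q ->
  pm * x ^+ 2 <= pD - 2 * cD + hh -> pT - 2 * cT + hh <= d * (tau * tau) ->
  wTh <= w0 * tau ->
  pm / 2 * x ^+ 2 <= d / 2 * tau ^+ 2 + w0 * tau + 2 * tau + E + Q.
Proof. move=> h1 h2 h3 h4; rewrite expr2 (expr2 tau); rewrite expr2 in h2; lra. Qed.

Lemma lt_of_le_half (R : realType) (x y : R) : 0 < y -> x <= y / 2 -> x < y.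
Proof. lra. Qed.

Lemma proximal_term_le (R : realType) (M c q t : R) : 0 <= M * c / 2 -> 0 <= q ->
  q <= t / (M * c / 2 + 1) -> M * q * c / 2 <= t.
Proof. by move=> h q0; rewrite ler_pdivlMr; [nra | lra]. Qed.

Lemma ratio_bound' (R : realType) (c x e : R) : 0 <= c -> 0 <= x -> x <= e / (c + 1) -> c * x <= e.
Proof. by move=> c0 x0; rewrite ler_pdivlMr; [nra | lra]. Qed.
Lemma ratio_bound (R : realType) (a c x e : R) : 0 <= a * c -> 0 <= x ->
  x <= e / (a * c + 1) -> a * x * c <= e.
Proof. by move=> c0 x0 /(ratio_bound' c0 x0); rewrite mulrAC. Qed.

(** * Localisation and rank of perturbed minimisers *)

Section Core.
Variable R : realType.
Local Notation C := R[i].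
Variables (k : space_kind) (m n d : nat) (Th : 'I_d -> 'M[C]_(m, n)) (al : {set 'I_d}).
Hypothesis onb : onb_of k Th.
Variables (p : 'I_d -> R) (Xb W0 Fb Dh : 'M[C]_(m, n)).
Variables (phi : 'M[C]_(m, n) -> R) (dom : 'M[C]_(m, n) -> Prop).
Hypothesis p_gt0 : forall j, j \in ~: al -> 0 < p j.
Hypothesis p_le1 : forall j, j \in ~: al -> p j <= 1.
Hypothesis XbV : inV k Xb.
(** With [lowerE]: [W0] is a subgradient certificate at [Xb], valid on the whole domain and not only
    nearby. *)
Hypothesis lower : forall Y, inV k Y -> dom Y -> ip W0 Y <= phi Y.
Hypothesis lowerE : phi Xb = ip W0 Xb.
Hypothesis Dh_feas : feasible k Th al Dh.
Hypothesis Dh_stat : forall H, feasible k Th al H -> wform Th al p Dh H = ip (Fb - W0) H.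
(** [Dh] itself may fail to be an admissible direction from [Xb], as a tangent to the semidefinite
    cone can leave it. Admissible directions arbitrarily close to [Dh] suffice. *)
Hypothesis approx : forall tau, 0 < tau -> exists D a,
  [/\ feasible k Th al D, frob (D - Dh) <= tau, a <= ip W0 Dh + tau & dini phi dom Xb D a].

Definition emp_opt w e rho Ft gam Xt X :=
  [/\ inV k X, dom X, forall j, j \in al -> ip (Th j) (X - Xb) = 0 &
  forall Y, inV k Y -> dom Y -> (forall j, j \in al -> ip (Th j) (Y - Xb) = 0) ->
    obj Th al phi w e rho Ft gam Xt Xb X <= obj Th al phi w e rho Ft gam Xt Xb Y].

(** The noise tolerance carries a factor [rho]: noise of order [rho] would move the scaled error at
    leading order. *)
Definition close_data (eps rho M : R) (w e : 'I_d -> R) Ft (gam : R) Xt :=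
  [/\ forall j, j \in ~: al -> `|w j - p j| <= eps,
      forall j, j \in ~: al -> `|e j| <= eps * rho,
      frob (Ft - Fb) <= eps, frob (Xt - Xb) <= eps & 0 <= gam <= M].

Lemma weights_lower_bound : exists2 pm : R, 0 < pm & forall j, j \in ~: al -> pm <= p j.
Proof.
(* Starting the minimum at 1 also covers an empty complement of [al]. *)
exists (\big[Num.min/1]_(j in ~: al) p j).
  by elim/big_rec: _ => // j x ja x0; rewrite lt_min x0 p_gt0.
by move=> j ja; rewrite (bigD1 j) //= ge_min lexx.
Qed.

Lemma min_lel (x y : R) : Num.min x y <= x. Proof. by rewrite ge_min lexx. Qed.

(* Comparing the minimiser with [Xb + rho D] for [D] near [Dh]: the quadratic form
   is uniformly coercive, so [rho^-1 (X - Xb)] is close to the minimiser [Dh] of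
   the limiting problem. *)
Lemma minimizer_scaled_error (eta M : R) : 0 < eta -> 0 <= M -> exists eps rho0 : R,
  [/\ 0 < eps, 0 < rho0 & forall w e rho Ft gam Xt X eps', 0 < rho -> rho <= rho0 ->
    0 <= eps' -> eps' <= eps ->
    close_data eps' rho M w e Ft gam Xt ->
    emp_opt w e rho Ft gam Xt X -> frob (rC rho^-1 *: (X - Xb) - Dh) <= eta].
Proof.
move=> eta0 M0.
have [pm pm0 hpm] := weights_lower_bound.
pose b := frob Dh; pose w0 := frob W0.
have b0 : 0 <= b by exact: frob_ge0.
have w00 : 0 <= w0 by exact: frob_ge0.
have d0 : 0 <= d%:R :> R by [].
pose K : R := d%:R + 1 + M.
have K0 : 0 <= K by rewrite /K !addr_ge0.
pose A := (d%:R + 2 * K) + (d%:R * b ^+ 2 + d%:R * (b + 1) ^+ 2 / 2 + K * (2 + 2 * b ^+ 2 + b)).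
have A0 : 0 <= A.
  by rewrite /A !addr_ge0 ?mulr_ge0 ?addr_ge0 ?mulr_ge0 ?sqr_ge0 ?invr_ge0.
pose t := pm * eta ^+ 2 / 16.
have t0 : 0 < t by rewrite !mulr_gt0 // exprn_gt0.
(* The trial direction is fixed by [tau] before [rho0], because its admissible step length [r1]
   limits [rho0]. *)
pose tau := Num.min 1 (t / (d%:R + w0 + 2)).
have dw0 : 0 < d%:R + w0 + 2 by lra.
have tau0 : 0 < tau by rewrite lt_min ltr01 divr_gt0.
have tau1 : tau <= 1 by rewrite ge_min lexx.
have tauE : (d%:R + w0 + 2) * tau <= t.
  by rewrite mulrC -ler_pdivlMr // ge_min lexx orbT.
have [Dt [a [[DtV Dta] Dtc ha hdini]]] := approx tau0.
have [r1 r10 hr1] := hdini _ tau0.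
pose eps := Num.min (pm / 4) t / (A + 1).
have A1 : 0 < A + 1 by rewrite ltr_wpDl.
have eps0 : 0 < eps by rewrite divr_gt0 // lt_min t0 divr_gt0.
have epsA : eps * A <= Num.min (pm / 4) t.
  apply: (@le_trans _ _ (eps * (A + 1))); first by rewrite ler_pM2l // lerDl.
  by rewrite divfK // lt0r_neq0.
pose r2 := t / (M * (b + 1) ^+ 2 / 2 + 1).
have mb0 : 0 <= M * (b + 1) ^+ 2 / 2.
  by apply: divr_ge0 => //; apply: mulr_ge0 => //; exact: sqr_ge0.
have r20 : 0 < r2 by rewrite divr_gt0 // ltr_wpDl.
exists eps, (Num.min (r1 / 2) r2); split => //; first by rewrite lt_min r20 divr_gt0.
move=> w e q Ft gam Xt X eps' q0; rewrite le_min => /andP[qr1 qr2] e'0 e'e.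
case=> hw he hF hX /andP[gam0 gamM] [XV Xdom Xa opt].
pose D := rC q^-1 *: (X - Xb).
have DE : X = Xb + rC q *: D.
  by rewrite /D scalerA -rCM mulfV ?lt0r_neq0 // scale1r addrC subrK.
have DV : feasible k Th al D.
  by split=> [|j ja]; [apply/inVZ/inVB | rewrite /D ipZr Xa // mulr0].
have qr1' := lt_of_le_half r10 qr1.
have [tdom tphi] := hr1 q q0 qr1'.
have XbB : Xb - Xb = 0 :> 'M[C]_(m, n) by rewrite subrr.
have oT' : obj Th al phi w e q Ft gam Xt Xb (Xb + rC q *: D)
   <= obj Th al phi w e q Ft gam Xt Xb (Xb + rC q *: Dt).
  rewrite -DE; apply: opt => //; first by apply: inVD => //; exact: inVZ.
  by move=> j ja; rewrite addrC addKr ipZr Dta // mulr0.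
rewrite !obj_expand lerD2l XbB in oT'.
have bl0 H : wform Th al w 0 H = 0.
  by rewrite /wform big1 // => j _; rewrite ip0r mul0r mulr0.
rewrite !bl0 !mulr0 !add0r in oT'.
have lowD : q * ip W0 D <= phi (Xb + rC q *: D) - phi Xb.
  by rewrite lerBrDl lowerE -ipZr -ipDr -DE; exact: lower.
have upT : phi (Xb + rC q *: Dt) - phi Xb <= q * (a + tau) by rewrite lerBlDl.
have hY H : `|ip (Xb - Xt) H| <= eps' * frob H.
  apply: (le_trans (ip_cauchy_abs _ _)); apply: (ler_wpM2r (frob_ge0 H)).
  by rewrite -(frobN (Xb - Xt)) opprB.
have hFH H : `|ip Ft H - ip Fb H| <= eps' * frob H.
  by rewrite -ipBl; apply: (le_trans (ip_cauchy_abs _ _)); exact: (ler_wpM2r (frob_ge0 H)).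
have hbl H : `|wform Th al w H H - wform Th al p H H| <= eps' * d%:R * (frob H * frob H).
  by rewrite wformB; exact: (wform_bound onb).
have hli H : `|noise_form Th al e H| <= (eps' * q) * d%:R * frob H.
  by apply: (noise_form_bound onb) => //; rewrite mulr_ge0 // ltW.
have cD := Dh_stat DV; rewrite ipBl in cD.
have cT := Dh_stat (conj DtV Dta); rewrite ipBl in cT.
have main := minimizer_comparison_scalar q0 (frob_ge0 D) (frob_ge0 Dt) gam0 gamM e'0 d0 (hbl D) (hbl Dt)
  (hli D) (hli Dt) (hFH D) (hFH Dt) (hY D) (hY Dt) cD cT lowD upT ha oT'.
pose Z := D - Dh; pose ZT := Dt - Dh.
(* Completing the square: by stationarity of [Dh], the excess of the limiting quadratic objective at
   [H] is half of this form. *)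
have blZZ H : wform Th al p (H - Dh) (H - Dh) =
    wform Th al p H H - 2 * wform Th al p Dh H + wform Th al p Dh Dh.
  have -> : - Dh = rC (-1) *: Dh by rewrite rCN rC1 scaleN1r.
  rewrite !(wformDr, wformDl, wformZr, wformZl) (wformC Th al p H Dh).
  by move: (wform _ _ _ H H) (wform _ _ _ Dh H) (wform _ _ _ Dh Dh) => u1 u2 u3; ring.
have ZV : feasible k Th al Z.
  split=> [|j ja]; first exact: inVB DV.1 Dh_feas.1.
  by rewrite /Z ipBr DV.2 // Dh_feas.2 // subrr.
have low := wform_coercive onb ZV hpm; rewrite /Z blZZ in low.
have up : wform Th al p ZT ZT <= 1 * d%:R * (tau * tau).
  apply: (le_trans (ler_norm _)).
  apply: (le_trans (wform_bound onb _ _ _ _) _) => [|j ja|].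
  - exact: ler01.
  - by rewrite ger0_norm ?p_le1 // ltW // p_gt0.
  - by rewrite ler_wpM2l ?mulr_ge0 // ler_pM.
rewrite /ZT blZZ mul1r in up.
have wT : ip W0 Dh - ip W0 Dt <= w0 * tau.
  rewrite -ipBr; apply: (le_trans (ip_cauchy _ _)); apply: (ler_wpM2l w00).
  by rewrite -frobN opprB.
have yb : frob D <= frob Z + b.
  by have -> : frob D = frob (Z + Dh); [rewrite /Z subrK | exact: frobD].
have yTb : frob Dt <= b + 1.
  have -> : frob Dt = frob (ZT + Dh) by rewrite /ZT subrK.
  by apply: (le_trans (frobD _ _)); rewrite addrC lerD2l (le_trans Dtc).
apply: (scaled_error_scalar pm0 eta0 (frob_ge0 Z) (frob_ge0 D) (frob_ge0 Dt) b0 w00 d0 M0 K0 e'0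
   (ltW tau0) tau1 (ltW q0) yb yTb erefl tauE).
- apply: (le_trans (ler_wpM2r A0 e'e)); apply: (le_trans epsA); exact: min_lel.
- apply: (le_trans (ler_wpM2r A0 e'e)); apply: (le_trans epsA).
  by rewrite ge_min lexx orbT.
- rewrite -/t; exact: proximal_term_le mb0 (ltW q0) qr2.
exact: minimizer_combine_scalar main low up wT.
Qed.
Hypothesis descent : exists kappa c delta : R, [/\ 0 < kappa, 0 < delta &
  forall X, inV k X -> dom X -> frob (X - Xb) <= delta -> \rank X <> \rank Xb ->
    exists H a, [/\ inV k H, forall j, j \in al -> ip (Th j) H = 0, frob H <= c,
      dini phi dom X H a & a <= ip W0 H - kappa]].

(* Near [Xb], first-order optimality along the direction given by [descent] would
   contradict the stationarity of [Dh]. *)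
Lemma deterministic_rank (M : R) : 0 <= M -> exists eps rho0 : R,
  [/\ 0 < eps, 0 < rho0 & forall w e rho Ft gam Xt X, 0 < rho -> rho <= rho0 ->
    close_data eps rho M w e Ft gam Xt ->
    emp_opt w e rho Ft gam Xt X -> \rank X = \rank Xb].
Proof.
move=> M0; have [kap [c0 [del [kap0 del0 hdesc]]]] := descent.
(* The bound [c0] supplied by [descent] carries no sign information. *)
pose c := `|c0| + 1.
have cp : 0 < c by rewrite ltr_wpDl.
pose b := frob Dh.
have b0 : 0 <= b by exact: frob_ge0.
have dd0 : 0 <= d%:R :> R by [].
have k4 : 0 < kap / 4 by exact: divr_gt0.
pose eta := Num.min 1 (kap / 4 / (d%:R * c + 1)).
have dc1 : 0 < d%:R * c + 1 by rewrite ltr_wpDl // mulr_ge0 // ltW.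
have eta0 : 0 < eta by rewrite lt_min ltr01 divr_gt0.
have eta1 : eta <= 1 by rewrite ge_min lexx.
have etaE : d%:R * eta * c <= kap / 4.
  apply: (ratio_bound _ (ltW eta0)); last by rewrite ge_min lexx orbT.
  by rewrite mulr_ge0 // ltW.
have [e1 [r1 [e10 r10 h1]]] := minimizer_scaled_error eta0 M0.
pose K := d%:R * (b + 1) + 1 + d%:R + M.
have K0 : 0 <= K by rewrite /K !addr_ge0 // mulr_ge0 // addr_ge0.
pose eps := Num.min e1 (kap / 4 / (c * K + 1)).
have cK : 0 <= c * K by rewrite mulr_ge0 // ltW.
have eps0 : 0 < eps by rewrite lt_min e10 divr_gt0 // ltr_wpDl.
have epsE : c * eps * K <= kap / 4.
  rewrite -mulrA (mulrC eps) mulrA.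
  apply: (ratio_bound' cK (ltW eps0)); by rewrite ge_min lexx orbT.
(* Keeps [X] in the ball of radius [del] where [descent] applies, as [X - Xb] has norm at most
   [q * (b + 1)]. *)
pose r2 := del / (b + 1).
pose r3 := kap / 4 / (M * c * (b + 1) + 1).
have b1 : 0 < b + 1 by rewrite ltr_wpDl.
have r20 : 0 < r2 by exact: divr_gt0.
have mcb : 0 <= M * c * (b + 1) by rewrite !mulr_ge0 // ltW.
have r30 : 0 < r3 by rewrite divr_gt0 // ltr_wpDl.
exists eps, (Num.min r1 (Num.min r2 r3)); split => //; first by rewrite !lt_min r10 r20.
move=> w e q Ft gam Xt X q0; rewrite !le_min => /andP[qr1 /andP[qr2 qr3]] cl opt.
have ee1 : eps <= e1 by rewrite ge_min lexx.
have xe := h1 w e q Ft gam Xt X eps q0 qr1 (ltW eps0) ee1 cl opt.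
case: cl opt => hw he hF hX /andP[gam0 gamM] [XV Xdom Xa opt].
pose D := rC q^-1 *: (X - Xb).
have DE : X - Xb = rC q *: D by rewrite /D scalerA -rCM mulfV ?lt0r_neq0 // scale1r.
have yb : frob D <= b + 1.
  have -> : frob D = frob ((D - Dh) + Dh) by rewrite subrK.
  apply: (le_trans (frobD _ _)); rewrite addrC lerD2l.
  exact: le_trans xe eta1.
have qy : frob (X - Xb) = q * frob D by rewrite DE frobZ gtr0_norm.
have Xdel : frob (X - Xb) <= del.
  rewrite qy; apply: (@le_trans _ _ (q * (b + 1))); first by rewrite ler_pM2l.
  by rewrite -ler_pdivlMr.
have [//|/eqP ne] := eqVneq (\rank X) (\rank Xb).
have [H [a [HV Ha Hc hdini ha]]] := hdesc X XV Xdom Xdel ne.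
have Hcc : frob H <= c.
  apply: (le_trans Hc); apply: (le_trans (ler_norm c0)).
  by rewrite /c lerDl.
have XbE Y : Y - Xb = (X - Xb) + (Y - X) by rewrite (addrC (X - Xb)) addrA subrK.
have F : 0 <= wform Th al w (X - Xb) H - noise_form Th al e H + q * (a - ip Ft H + gam * ip (X - Xt) H).
  apply: (first_order q0 (fun t => inVD XV (inVZ t HV)) _ Ha hdini) => Y YV Ydom Ya.
  by apply: opt => // j ja; rewrite XbE ipDr Xa // Ya // addr0.
rewrite DE wformZl in F.
have HF : feasible k Th al H by split.
have BE := Dh_stat HF; rewrite ipBl in BE.
exfalso.
have hB : `|wform Th al w D H - wform Th al p Dh H| <=
    eps * d%:R * (frob D * c) + 1 * d%:R * (frob (D - Dh) * c).
  have -> : wform Th al w D H - wform Th al p Dh H =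
      (wform Th al w D H - wform Th al p D H) + wform Th al p (D - Dh) H.
    have -> : D - Dh = D + rC (-1) *: Dh by rewrite rCN rC1 scaleN1r.
    by rewrite wformDl wformZl mulN1r addrA subrK.
  apply: (le_trans (ler_normD _ _)); apply: lerD.
    rewrite wformB; apply: (le_trans (wform_bound onb _ _ (ltW eps0) hw)).
    apply: ler_wpM2l; first by rewrite mulr_ge0 // ltW.
    exact: (ler_wpM2l (frob_ge0 D)).
  apply: (le_trans (wform_bound onb _ _ ler01 _)) => [j ja|].
    by rewrite ger0_norm ?p_le1 // ltW // p_gt0.
  apply: ler_wpM2l; first by rewrite mulr_ge0.
  exact: (ler_wpM2l (frob_ge0 _)).
have hl : `|noise_form Th al e H| <= (eps * q) * d%:R * c.
  apply: (le_trans (noise_form_bound onb _ _ he)); first by rewrite mulr_ge0 // ltW.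
  by apply: ler_wpM2l => //; rewrite !mulr_ge0 // ltW.
have hf : `|ip (Ft - Fb) H| <= eps * c.
  by apply: (le_trans (ip_cauchy_abs _ _)); apply: ler_pM.
have hg : `|ip (X - Xt) H| <= (q * frob D + eps) * c.
  apply: (le_trans (ip_cauchy_abs _ _)); apply: ler_pM => //.
  have -> : X - Xt = (X - Xb) - (Xt - Xb) by rewrite opprB addrA subrK.
  by apply: (le_trans (frobB _ _)); rewrite qy lerD2l.
have Fsplit : ip Ft H = ip Fb H + ip (Ft - Fb) H by rewrite ipBl addrC subrK.
have mq : M * c * (q * (b + 1)) <= kap / 4.
  rewrite mulrCA [X in X <= _]mulrC.
  exact: (ratio_bound' mcb (ltW q0) qr3).
exact: (descent_contradiction_scalar kap0 (ltW cp) q0 (ltW eps0) dd0 (frob_ge0 (D - Dh)) (frob_ge0 D) M0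
  gam0 gamM yb xe etaE epsE mq hB hl hf hg Fsplit BE ha F).
Qed.

End Core.

(** * The limiting problem *)

Section Blocks.
Variable R : realType.
Local Notation C := R[i].
Implicit Types (m n r d : nat).

(** Column selectors turn [lcols] and [rcols] into right multiplications, so block identities reduce
    to identities between 0-1 matrices. *)
Definition lsel m r : 'M[C]_(m, r) := diagmx m r (fun=> 1).
Definition rsel m r : 'M[C]_(m, m - r) := \matrix_(i, j) (if (i : nat) == (r + j)%N then 1 else 0).

Lemma lcolsE m n r (U : 'M[C]_(m, n)) : lcols r U = U *m lsel n r.
Proof.
apply/matrixP => i j; rewrite mul_diag_col mxE /ent valK.
by case: insubP => [k _ _|_]; rewrite ?rC1 ?mulr1.
Qed.

Lemma rcolsE m r (U : 'M[C]_m) : rcols r U = U *m rsel m r.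
Proof.
apply/matrixP => i j; rewrite !mxE /ent valK.
case: insubP => [k _ ek|].
  rewrite (bigD1 k) //= big1 ?addr0 => [|l ne]; first by rewrite mxE ek eqxx mulr1.
  rewrite mxE; case: eqP => [e|]; last by rewrite mulr0.
  by case/eqP: ne; apply: val_inj; rewrite /= e -ek.
by rewrite -ltn_subRL ltn_ord.
Qed.

Lemma lsel_iso m r : (r <= m)%N -> ctr (lsel m r) *m lsel m r = 1%:M.
Proof.
move=> rm; rewrite ctr_diag diag_mul => [|i mi]; last first.
  by rewrite minnn ltnNge (leq_trans rm mi).
by rewrite -diag_one; apply: eq_diag => i _; rewrite mulr1.
Qed.

Lemma sel_sum m r : (r <= m)%N ->
  lsel m r *m ctr (lsel m r) + rsel m r *m ctr (rsel m r) = 1%:M.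
Proof.
move=> rm; apply/matrixP => i j; rewrite mxE ctr_diag mul_diag_col [X in _ + X]mxE.
have -> : \sum_l rsel m r i l * ctr (rsel m r) l j =
   if (i == j) && (r <= i)%N then 1 else 0.
  case: (ltnP i r) => ir; rewrite ?andbF ?andbT.
    rewrite big1 // => l _; rewrite mxE; case: eqP => [e|]; last by rewrite mul0r.
    by move: ir; rewrite e ltnNge leq_addr.
  have il : (i - r < m - r)%N by rewrite ltn_sub2r // (leq_ltn_trans ir).
  rewrite (bigD1 (Ordinal il)) //= big1 ?addr0 => [|l ne].
    rewrite ctrE !mxE /= subnKC // eqxx mul1r val_eqE eq_sym.
    by case: eqP; rewrite ?conjc1 ?conjc0.
  rewrite mxE; case: eqP => [e|]; last by rewrite mul0r.
  by case/eqP: ne; apply: val_inj; rewrite /= e addKn.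
case: insubP => [k kr ek|]; rewrite ?rC1 ?mulr1.
  change (nat_of_ord k = j) in ek; rewrite !mxE rC1 ek val_eqE.
  case: eqP => [e|ne] /=; last by rewrite addr0.
  by rewrite e leqNgt -ek ltn_ord /= addr0.
rewrite -leqNgt add0r => rj; rewrite !mxE.
by case: eqP => [->|ne] //=; rewrite rj.
Qed.

Lemma sel_orth m r : ctr (lsel m r) *m rsel m r = 0.
Proof.
apply/matrixP => i j; rewrite ctr_diag mul_diag_row mxE.
case: insubP => // k _ ek; rewrite mxE; case: eqP => [e|]; last by rewrite mulr0.
change (nat_of_ord k = i) in ek.
by have := ltn_ord i; rewrite -ek e ltnNge leq_addr.
Qed.

Lemma rsel_iso m r : (r <= m)%N -> ctr (rsel m r) *m rsel m r = 1%:M.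
Proof.
move=> rm; apply/matrixP => i j; rewrite !mxE.
have il : (r + i < m)%N by rewrite -ltn_subRL ltn_ord.
rewrite (bigD1 (Ordinal il)) //= big1 ?addr0 => [|l ne].
  rewrite ctrE !mxE /= eqxx conjc1 mul1r eqn_add2l val_eqE.
  by case: eqP.
rewrite ctrE mxE; case: eqP => [e|]; last by rewrite conjc0 mul0r.
by case/eqP: ne; apply: val_inj.
Qed.

Lemma cols_blocks m r (U : 'M[C]_m) : (r <= m)%N -> ctr U *m U = 1%:M ->
  [/\ ctr (lcols r U) *m lcols r U = 1%:M, ctr (rcols r U) *m rcols r U = 1%:M,
      ctr (lcols r U) *m rcols r U = 0, ctr (rcols r U) *m lcols r U = 0 &
      lcols r U *m ctr (lcols r U) + rcols r U *m ctr (rcols r U) = 1%:M].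
Proof.
move=> rm UU.
have h k l (A : 'M[C]_(m, k)) (B : 'M[C]_(m, l)) : ctr (U *m A) *m (U *m B) = ctr A *m B.
  by rewrite ctrM -mulmxA (mulmxA (ctr U)) UU mul1mx.
rewrite lcolsE rcolsE; split; rewrite ?h ?lsel_iso ?rsel_iso ?sel_orth //.
  by rewrite -(ctrK (ctr _ *m _)) ctrM ctrK sel_orth ctr0.
rewrite !ctrM !mulmxA -mulmxDl -(mulmxA U (lsel _ _)) -(mulmxA U (rsel _ _)).
rewrite -mulmxDr sel_sum //.
by rewrite mulmx1 unitary_ctr.
Qed.

Lemma diag_blocks m n r (U : 'M[C]_m) (V : 'M[C]_n) (g : nat -> R) :
  (r <= m)%N -> (r <= n)%N -> (forall i, (r <= i)%N -> g i = 0) ->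
  U *m diagmx m n g *m ctr V = lcols r U *m diagmx r r g *m ctr (lcols r V).
Proof.
move=> rm rn g0; rewrite !lcolsE ctrM ctr_diag.
have -> : diagmx m n g = lsel m r *m diagmx r r g *m diagmx r n (fun=> 1).
  rewrite diag_mul => [|i ri _]; last by rewrite g0 ?mulr0.
  rewrite diag_mul => [|i ri _]; last by rewrite g0 ?mulr0 // mul0r.
  by apply: eq_diag => i _; rewrite mul1r mulr1.
by rewrite !mulmxA.
Qed.

Lemma conjM_lsel m r : conjM (lsel m r) = lsel m r.
Proof. by apply/matrixP => i j; rewrite !mxE; case: ifP; rewrite ?conjc0 ?conj_rC. Qed.
Lemma conjM_rsel m r : conjM (rsel m r) = rsel m r.
Proof. by apply/matrixP => i j; rewrite !mxE; case: ifP; rewrite ?conjc0 ?conjc1. Qed.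
Lemma conjM_lcols m r (U : 'M[C]_m) : conjM U = U -> conjM (lcols r U) = lcols r U.
Proof. by move=> h; rewrite lcolsE conjMM h conjM_lsel. Qed.
Lemma conjM_rcols m r (U : 'M[C]_m) : conjM U = U -> conjM (rcols r U) = rcols r U.
Proof. by move=> h; rewrite rcolsE conjMM h conjM_rsel. Qed.

(** Expanding the vanishing block gives [T = X G T + T G X - X G T G X]. Sharing the last term
    equally makes the two factors adjoint to each other when [X], [G] and [T] are Hermitian. *)
Lemma tangent_decomp m n (X T : 'M[C]_(m, n)) (G : 'M[C]_(n, m)) :
  (1%:M - X *m G) *m T *m (1%:M - G *m X) = 0 ->
  T = X *m (G *m T *m (1%:M - rC 2^-1 *: (G *m X))) +
      ((1%:M - rC 2^-1 *: (X *m G)) *m T *m G) *m X.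
Proof.
rewrite mulmxBr mulmx1 mulmxBl mul1mx mulmxBl => h.
rewrite !mulmxBr !mulmx1 !mulmxBl !mul1mx -!scalemxAr -!scalemxAl.
rewrite !mulmxA.
have : rC (2^-1) + rC 2^-1 = 1 :> C.
  by rewrite -rCD (_ : 2^-1 + 2^-1 = 1 :> R) //; field.
rewrite !mulmxA in h; move: (rC 2^-1) h => z.
move: (X *m G *m T) (T *m G *m X) (X *m G *m T *m G *m X) => a b c h zz.
have e : c = z *: c + z *: c by rewrite -scalerDl zz scale1r.
have -> : a - z *: c + (b - z *: c) = a + b - c.
  by rewrite {3}e; apply/matrixP => i j; rewrite !mxE; ring.
move: h => /eqP; rewrite subr_eq0 => /eqP h.
by apply/eqP; rewrite eq_sym -subr_eq0 -{1}[T](subrK a) h; apply/eqP/matrixP => i j; rewrite !mxE; ring.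
Qed.

End Blocks.

(** * Inverting the compressed sampling operator *)

Section Surjectivity.
Variable R : realType.
Local Notation C := R[i].
Variables (k : space_kind) (m n d : nat) (Th : 'I_d -> 'M[C]_(m, n)) (al : {set 'I_d}).
Hypothesis onb : onb_of k Th.

Lemma oppmE (X : 'M[C]_(m, n)) : - X = rC (-1) *: X.
Proof. by rewrite rCN rC1 scaleN1r. Qed.

(** For the symmetric kinds membership of zero requires [m = n]. Any basis element provides this, so
    only an empty basis is left as the alternative. *)
Lemma inV0 : inV k (0 : 'M[C]_(m, n)) \/ d = 0%N.
Proof.
case: (posnP d) => [->|d0]; [by right | left].
have [h _ _] := onb; have := inVZ 0 (h (Ordinal d0)).
by rewrite rC0 scale0r.
Qed.

Lemma inV_Th_sum (P : pred 'I_d) (c : 'I_d -> R) (F : 'I_d -> 'M[C]_(m, n)) :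
  (forall j, P j -> inV k (F j)) -> inV k (0 : 'M[C]_(m, n)) ->
  inV k (\sum_(j | P j) rC (c j) *: F j).
Proof. by move=> hF h0; apply: inV_sum => // j Pj; apply: inVZ; exact: hF. Qed.

Lemma ip_expand X Y : inV k X -> ip Y X = \sum_j ip (Th j) Y * ip (Th j) X.
Proof.
case: onb => _ _ h /h e; rewrite {1}e ip_sumr; apply: eq_bigr => j _.
by rewrite ipZr mulrC [ip Y _]ipC.
Qed.

Lemma ip_Qdag p Y j : ip (Th j) (Qdag Th al p Y) = if j \in al then 0 else (p j)^-1 * ip (Th j) Y.
Proof.
have [_ h _] := onb; rewrite /Qdag ip_sumr.
rewrite (eq_bigr (fun i => (p i)^-1 * ip (Th i) Y * (j == i)%:R)) => [|i _]; last by rewrite ipZr h.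
case: ifP => ja.
  rewrite big1 // => i; rewrite inE => ia; case: eqP => [e|]; last by rewrite mulr0.
  by rewrite -e ja in ia.
rewrite (bigD1 j) ?inE ?ja //= eqxx mulr1 big1 ?addr0 // => i /andP[_ ne].
by rewrite eq_sym (negPf ne) mulr0.
Qed.

Lemma ip_Qdag_sum p X Y : inV k X ->
  ip X (Qdag Th al p Y) = \sum_(j in ~: al) (p j)^-1 * (ip (Th j) Y * ip (Th j) X).
Proof.
move=> XV; rewrite /Qdag ip_sumr; apply: eq_bigr => j _.
by rewrite ipZr (ipC X) -mulrA.
Qed.

Lemma Qdag_inV p Y : inV k (0 : 'M[C]_(m, n)) -> inV k (Qdag Th al p Y).
Proof. by have [h _ _] := onb; move=> h0; exact: inV_Th_sum. Qed.

Lemma QdagD p X Y : Qdag Th al p (X + Y) = Qdag Th al p X + Qdag Th al p Y.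
Proof. by rewrite /Qdag -big_split; apply: eq_bigr => j _ /=; rewrite ipDr mulrDr rCD scalerDl. Qed.
Lemma QdagZ p t X : Qdag Th al p (rC t *: X) = rC t *: Qdag Th al p X.
Proof. by rewrite /Qdag scaler_sumr; apply: eq_bigr => j _; rewrite ipZr scalerA -rCM mulrCA. Qed.
Lemma QdagN p X : Qdag Th al p (- X) = - Qdag Th al p X.
Proof. by rewrite (oppmE X) QdagZ -oppmE. Qed.

(* With [P] the projection onto the (2,2) block and [Q = Qdag], the operator
   [P Q P + (1 - P)] is injective by nondegeneracy, hence onto, being a square
   matrix in the coordinates of the basis. *)
Lemma compressed_surj m' n' (p : 'I_d -> R) (U : 'M[C]_(m, m')) (V : 'M[C]_(n, n')) X0 :
  (forall j, j \in ~: al -> 0 < p j) ->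
  ctr U *m U = 1%:M -> ctr V *m V = 1%:M ->
  (forall X, inV k X -> inV k (U *m (ctr U *m X *m V) *m ctr V)) ->
  constraint_nondegenerate k Th al U V ->
  inV k X0 -> U *m (ctr U *m X0 *m V) *m ctr V = X0 ->
  exists2 X, inV k X & U *m (ctr U *m Qdag Th al p (U *m (ctr U *m X *m V) *m ctr V) *m V) *m ctr V = X0.
Proof.
move=> p0 UU VV PV nd X0V X0E.
have [d0|d0] := inV0; last first.
  exists X0 => //.
  have [_ _ h] := onb; rewrite (h _ X0V) big1 => [|j _]; last by move: (ltn_ord j); rewrite {2}d0.
  by rewrite /Qdag big1 ?(mulmx0, mul0mx) // => j _; move: (ltn_ord j); rewrite {2}d0.
pose P X := U *m (ctr U *m X *m V) *m ctr V.
have PP X : P (P X) = P X.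
  by rewrite /P !mulmxA -(mulmxA U (ctr U)) UU mulmx1 -(mulmxA _ (ctr V) V) VV mulmx1.
have Padj X Y : ip (P X) Y = ip X (P Y).
  by rewrite /P -!mulmxA !(ip_mull U) ip_mull ctrK !mulmxA ip_mulr ip_mulr !ctrK ?mulmxA.
have PD X Y : P (X + Y) = P X + P Y by rewrite /P mulmxDr mulmxDl mulmxDr mulmxDl.
have PZ t X : P (rC t *: X) = rC t *: P X.
  by rewrite /P -scalemxAr -scalemxAl -scalemxAr -scalemxAl.
have PN X : P (- X) = - P X by rewrite (oppmE X) PZ -oppmE.
pose L X := P (Qdag Th al p (P X)) + (X - P X).
have LD X Y : L (X + Y) = L X + L Y.
  by rewrite /L PD QdagD PD opprD [RHS]addrACA; congr (_ + _); exact: addrACA.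
have LZ t X : L (rC t *: X) = rC t *: L X.
  by rewrite /L PZ QdagZ PZ -scalerBr -scalerDr.
have LV X : inV k X -> inV k (L X).
  move=> XV; apply: inVD; last by apply: inVB => //; exact: PV.
  by apply: PV; exact: Qdag_inV.
pose mat (y : 'cV[R]_d) : 'M[C]_(m, n) := \sum_j rC (y j 0) *: Th j.
have [ThV hip hexp] := onb.
have matV y : inV k (mat y) by exact: inV_Th_sum.
have coomat y i : ip (Th i) (mat y) = y i 0.
  rewrite /mat ip_sumr (bigD1 i) //= ipZr hip eqxx mulr1 big1 ?addr0 // => j ne.
  by rewrite ipZr hip eq_sym (negPf ne) mulr0.
pose A : 'M[R]_d := \matrix_(i, j) ip (Th i) (L (Th j)).
have Lsum (y : 'cV[R]_d) : L (mat y) = \sum_j rC (y j 0) *: L (Th j).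
  rewrite /mat; elim/big_rec2: _ => [|j X Y _ e].
    by rewrite -[X in L X](scale0r 0) -rC0 LZ scale0r.
  by rewrite LD LZ e.
have AE y i : (A *m y) i 0 = ip (Th i) (L (mat y)).
  by rewrite mxE Lsum ip_sumr; apply: eq_bigr => j _; rewrite mxE ipZr mulrC.
(* [ip X (L X)] is a weighted sum of squares of the sampled coefficients of [P X] plus the squared
   norm of [X - P X]; both must vanish. *)
have Linj X : inV k X -> L X = 0 -> X = 0.
  move=> XV LX0.
  have e : ip (P X) (Qdag Th al p (P X)) + ip (X - P X) (X - P X) = 0.
    have <- : ip X (L X) = 0 by rewrite LX0 ip0r.
    have -> : ip X (L X) = ip X (P (Qdag Th al p (P X))) + ip X (X - P X) by exact: ipDr.
    rewrite -Padj; congr (_ + _).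
    by rewrite ipBl Padj (_ : P (X - P X) = 0) ?ip0r ?subr0 // PD PN PP subrr.
  have PXV := PV _ XV; rewrite -/(P X) in PXV.
  rewrite ip_Qdag_sum // in e.
  have s0 : 0 <= \sum_(j in ~: al) (p j)^-1 * (ip (Th j) (P X) * ip (Th j) (P X)).
    by apply: sumr_ge0 => j ja; rewrite mulr_ge0 ?invr_ge0 ?(ltW (p0 _ ja)) // -expr2 sqr_ge0.
  move/eqP: e; rewrite paddr_eq0 ?ip_ge0 // => /andP[/eqP e1 /eqP /ip_eq0 e2].
  have XP : P X = X by move/eqP: e2; rewrite subr_eq0 => /eqP <-.
  rewrite XP in e1.
  have zb j : j \in ~: al -> ip (Th j) X = 0.
    move=> ja; move/eqP: e1; rewrite psumr_eq0 => [/allP/(_ j (mem_index_enum _))|i ia]; last first.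
      by rewrite mulr_ge0 ?invr_ge0 ?(ltW (p0 _ ia)) // -expr2 sqr_ge0.
    by rewrite ja /= -expr2 mulf_eq0 invr_eq0 gt_eqF ?p0 //= sqrf_eq0 => /eqP.
  (* [H] shares the fixed coefficients of [X] and has no (2,2) block. It is thus orthogonal to
     [X = P X], while [ip X X = ip H X] because the sampled coefficients of [X] vanish. *)
  have [H [HV UHV hH]] := nd (fun j => ip (Th j) X).
  have XH : ip H X = 0.
    by rewrite -XP -Padj /P UHV mulmx0 mul0mx ip0l.
  apply: ip_eq0; rewrite -XH !(ip_expand _ XV); apply: eq_bigr => j _.
  have [ja|ja] := boolP (j \in al); first by rewrite hH.
  by rewrite zb ?inE // !mulr0.
have Au : A \in unitmx.
  rewrite -unitmx_tr -row_free_unit; apply: inj_row_free => v vA.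
  have : A *m v^T = 0 by rewrite -(trmxK A) -trmx_mul vA trmx0.
  move=> Av; have L0 : L (mat v^T) = 0.
    rewrite (hexp _ (LV _ (matV v^T))) big1 // => i _.
    by rewrite -AE Av mxE rC0 scale0r.
  have M0 := Linj _ (matV _) L0.
  apply/matrixP => i j; rewrite ord1 mxE.
  by have := coomat v^T j; rewrite M0 ip0r mxE => <-.
pose y := invmx A *m (\col_j ip (Th j) X0).
have Ly : L (mat y) = X0.
  rewrite (hexp _ (LV _ (matV y))) [in RHS](hexp _ X0V); apply: eq_bigr => i _.
  by rewrite -AE /y mulKVmx // mxE.
exists (mat y) => //; rewrite -/(P (mat y)) -/(P _).
have PL : P (L (mat y)) = P (Qdag Th al p (P (mat y))).
  by rewrite /L PD PP PD PN PP subrr addr0.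
by rewrite -PL Ly.
Qed.

End Surjectivity.

(** * Spectral data of the limiting problem *)

Section Setup.
Variable R : realType.
Local Notation C := R[i].
Implicit Types (m n r d : nat).

(** The Moore-Penrose inverse when [r] is the rank of the decomposed matrix. *)
Definition svd_pinv m n r (U : 'M[C]_m) (s : nat -> R) (V : 'M[C]_n) : 'M[C]_(n, m) :=
  lcols r V *m diagmx r r (fun i => (s i)^-1) *m ctr (lcols r U).

Lemma svd_pinvP b m n (X : 'M[C]_(m, n)) U s V : is_svd b X U s V ->
  let r := \rank X in let G := svd_pinv r U s V in
  [/\ X = lcols r U *m diagmx r r s *m ctr (lcols r V),
      X *m G = lcols r U *m ctr (lcols r U), G *m X = lcols r V *m ctr (lcols r V) &
      X *m G *m X = X].
Proof.
move=> h r G; have hr := svd_rank h; case: h => -[UU VV] _ _ [s0 sz] XE.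
have rm : (r <= m)%N := rank_leq_row X; have rn : (r <= n)%N := rank_leq_col X.
have E : X = lcols r U *m diagmx r r s *m ctr (lcols r V).
  rewrite {1}XE; apply: diag_blocks => // i ri; apply/eqP.
  by have := s0 i; rewrite le_eqVlt hr ltnNge ri orbF eq_sym.
have [u1 u2 u3 u4 u5] := cols_blocks rm UU; have [v1 v2 v3 v4 v5] := cols_blocks rn VV.
have ne i : (i < r)%N -> s i != 0 by rewrite -hr => /lt0r_neq0.
have sv : diagmx r r s *m diagmx r r (fun i => (s i)^-1) = 1%:M.
  rewrite diag_mul => [|i h1]; last by rewrite minnn ltnNge h1.
  by rewrite -diag_one; apply: eq_diag => i; rewrite minnn => /ne /mulfV.
have vs : diagmx r r (fun i => (s i)^-1) *m diagmx r r s = 1%:M by exact: mulmx1C.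
have XG : X *m G = lcols r U *m ctr (lcols r U).
  rewrite {1}E /G /svd_pinv !mulmxA -(mulmxA _ (ctr (lcols r V))) v1 mulmx1.
  by rewrite -(mulmxA _ (diagmx r r s)) sv mulmx1.
have GX : G *m X = lcols r V *m ctr (lcols r V).
  rewrite {1}E /G /svd_pinv !mulmxA -(mulmxA _ (ctr (lcols r U))) u1 mulmx1.
  by rewrite -(mulmxA _ _ (diagmx r r s)) vs mulmx1.
split=> //; rewrite XG {1}E !mulmxA -(mulmxA (lcols r U) (ctr _)) u1 mulmx1.
by rewrite -E.
Qed.

Lemma ghat_diagE m n (f : 'cV[R]_(minn m n) -> 'cV[R]_(minn m n)) s r :
  ghat_diag f s r = 1%:M - diagmx r r (ofcv (f (tocv (minn m n) s))).
Proof.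
apply/matrixP => i j; rewrite !mxE val_eqE; case: eqP => [->|_]; last by rewrite subr0.
by rewrite rCD rCN rC1.
Qed.

Lemma specop_blocks k m n (f : 'cV[R]_(minn m n) -> 'cV[R]_(minn m n))
    (X : 'M[C]_(m, n)) U s V : symmetric_fun f -> is_svd (kind_real k) X U s V ->
  let r := \rank X in
  specop k f X = lcols r U *m diagmx r r (ofcv (f (tocv (minn m n) s))) *m ctr (lcols r V).
Proof.
move=> sf h r; rewrite (specop_svd sf h); have hr := svd_rank h.
case: h => _ _ _ [s0 _] _; apply: diag_blocks.
- exact: rank_leq_row.
- exact: rank_leq_col.
move=> i ri; apply: symmetric_fun_zero => //; apply/eqP.
by have := s0 i; rewrite le_eqVlt hr ltnNge ri orbF eq_sym.
Qed.

(** Nondegeneracy at unit coordinate vectors. These matrices restore the fixed coefficients without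
    leaving the tangent space. *)
Lemma dual_tangents k m n m' n' d (Th : 'I_d -> 'M[C]_(m, n)) (al : {set 'I_d})
    (U2 : 'M[C]_(m, m')) (V2 : 'M[C]_(n, n')) :
  constraint_nondegenerate k Th al U2 V2 ->
  exists T : 'I_d -> 'M[C]_(m, n), [/\ forall j, inV k (T j),
    forall j, ctr U2 *m T j *m V2 = 0 &
    forall i j, i \in al -> j \in al -> ip (Th i) (T j) = (i == j)%:R].
Proof.
move=> nd.
have /choice[T hT] : forall j : 'I_d, exists T : 'M[C]_(m, n),
    [/\ inV k T, ctr U2 *m T *m V2 = 0 & forall i, i \in al -> ip (Th i) T = (i == j)%:R].
  by move=> j; exact: (nd (fun i => (i == j)%:R)).
by exists T; split=> [j|j|i j ia _]; have [h1 h2 h3] := hT j => //; exact: h3.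
Qed.

Section Limit.
Variables (k : space_kind) (m n d : nat) (Th : 'I_d -> 'M[C]_(m, n)) (al : {set 'I_d})
  (p : 'I_d -> R) (Xb : 'M[C]_(m, n)) (Ub : 'M[C]_m) (sb : nat -> R) (Vb : 'M[C]_n)
  (f : 'cV[R]_(minn m n) -> 'cV[R]_(minn m n)).
Hypothesis onb : onb_of k Th.
Hypothesis p_gt0 : forall j, j \in ~: al -> 0 < p j.
Hypothesis sf : symmetric_fun f.
Hypothesis svd : is_svd (kind_real k) Xb Ub sb Vb.
Local Notation r := (\rank Xb).
Local Notation U1 := (lcols r Ub).
Local Notation U2 := (rcols r Ub).
Local Notation V1 := (lcols r Vb).
Local Notation V2 := (rcols r Vb).
Hypothesis nd : constraint_nondegenerate k Th al U2 V2.
Hypothesis inV_out : forall X, inV k X -> inV k (ctr U2 *m X *m V2).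
Hypothesis inV_in : forall Z, inV k Z -> inV k (U2 *m Z *m ctr V2).
Hypothesis inV_zero : inV k (0 : 'M[C]_(m, n)).

(* [limW] is the limiting dual certificate; [limD] is the limit of
   [rho^-1 (Xhat - Xb)].  That [limD] has no (2,2) block is the defining equation
   of [Lam]. *)
Definition Lam := B2inv k Th al p Ub Vb (B1 Th al p Ub Vb (ghat_diag f sb r)).
Definition limW : 'M[C]_(m, n) := U1 *m ctr V1 - U2 *m Lam *m ctr V2.
Definition limD : 'M[C]_(m, n) := Qdag Th al p (specop k f Xb - limW).

(** Justifies the choice in [B2inv]: a solution exists by [compressed_surj], applied to the
    right-hand side embedded in the (2,2) block. *)
Lemma LamP : inV k Lam /\ B2 Th al p Ub Vb Lam = B1 Th al p Ub Vb (ghat_diag f sb r).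
Proof.
have [[UU VV] _ _ _ _] := svd.
have [u1 u2 u3 u4 u5] := cols_blocks (rank_leq_row Xb) UU.
have [v1 v2 v3 v4 v5] := cols_blocks (rank_leq_col Xb) VV.
have [W WE] : exists W, W = B1 Th al p Ub Vb (ghat_diag f sb r) by eexists.
rewrite /Lam -WE.
have WV : inV k W by rewrite WE; apply: inV_out; exact: Qdag_inV.
have can (Z : 'M[C]_(m - r, n - r)) : ctr U2 *m (U2 *m Z *m ctr V2) *m V2 = Z.
  by rewrite !mulmxA u2 mul1mx -mulmxA v2 mulmx1.
have e : U2 *m (ctr U2 *m (U2 *m W *m ctr V2) *m V2) *m ctr V2 = U2 *m W *m ctr V2.
  by rewrite can.
have [X XV hX] := compressed_surj onb p_gt0 u2 v2 (fun X h => inV_in (inV_out h)) nd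
  (inV_in WV) e.
have : exists Z, inV k Z /\ B2 Th al p Ub Vb Z = W.
  exists (ctr U2 *m X *m V2); split; first exact: inV_out.
  by apply: etrans (can W); rewrite -hX; apply: esym; exact: can.
case=> Z hZ; exact: (@xgetPex _ (0 : 'M[C]_(m - r, n - r))
  [set Z | inV k Z /\ B2 Th al p Ub Vb Z = W] (ex_intro _ Z hZ)).
Qed.

(** Puts the linear term in the form on which [B2] and [B1] act, so that the (2,2) block of its
    image under [Qdag] is the difference of the two sides of [LamP]. *)
Lemma specop_sub_limW : specop k f Xb - limW =
  U2 *m Lam *m ctr V2 - U1 *m ghat_diag f sb r *m ctr V1.
Proof.
rewrite (specop_blocks sf svd) ghat_diagE /limW mulmxBr mulmx1 mulmxBl.
by rewrite !opprB addrCA.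
Qed.

Lemma limD_compressed : ctr U2 *m limD *m V2 = 0.
Proof.
rewrite /limD specop_sub_limW QdagD QdagN mulmxDr mulmxDl mulmxN mulNmx.
by have [_ e] := LamP; apply/eqP; rewrite subr_eq0; apply/eqP.
Qed.

Lemma limD_feas : feasible k Th al limD.
Proof.
split=> [|j ja]; first exact: Qdag_inV.
by rewrite (ip_Qdag _ onb) ja.
Qed.

(** [Qdag] inverts the weights of [wform] coefficient by coefficient. *)
Lemma limD_stat H : feasible k Th al H -> wform Th al p limD H = ip (specop k f Xb - limW) H.
Proof.
move=> [HV Ha]; rewrite (ip_expand onb _ HV) (bigID (mem al)) /= big1 ?add0r => [|j ja].
  rewrite /wform (eq_bigl (fun j => j \notin al)) => [|j]; last by rewrite inE.
  apply: eq_bigr => j ja; rewrite (ip_Qdag _ onb) (negPf ja) !mulrA mulfV ?mul1r //.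
  by rewrite gt_eqF // p_gt0 // inE.
by rewrite Ha // mulr0.
Qed.

End Limit.
End Setup.

(** * Rank stability under perturbation *)

Section Cases.
Variable R : realType.
Local Notation C := R[i].

Lemma prob_weight_le1 d (al : {set 'I_d}) (p : 'I_d -> R) j :
  prob_weights al p -> j \in ~: al -> p j <= 1.
Proof.
move=> [p0 p1] ja; rewrite -p1 (bigD1 j) //= lerDl; apply: sumr_ge0 => i /andP[ia _].
exact: ltW (p0 _ ia).
Qed.

Lemma ip_orth_diff m m' m'' l (U1 : 'M[C]_(m, m')) (U2 : 'M[C]_(m, m''))
    (A : 'M[C]_(m', l)) (B : 'M[C]_(m'', l)) :
  ctr U1 *m U1 = 1%:M -> ctr U2 *m U2 = 1%:M -> ctr U1 *m U2 = 0 ->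
  ip (U1 *m A - U2 *m B) (U1 *m A - U2 *m B) = ip A A + ip B B.
Proof.
move=> u1 u2 u3.
have z : ip (U1 *m A) (U2 *m B) = 0 by rewrite ip_mull mulmxA u3 mul0mx ip0r.
rewrite ipBl !ipBr (ip_iso A A u1) (ip_iso B B u2) z [ip (U2 *m B) _]ipC z.
by rewrite subr0 sub0r opprK.
Qed.

Lemma limW_real m m' m'' n n' (U1 : 'M[C]_(m, m')) (U2 : 'M[C]_(m, m''))
    (V1 : 'M[C]_(n, m')) (V2 : 'M[C]_(n, n')) (L : 'M[C]_(m'', n')) :
  conjM U1 = U1 -> conjM V1 = V1 -> conjM U2 = U2 -> conjM V2 = V2 -> conjM L = L ->
  conjM (U1 *m ctr V1 - U2 *m L *m ctr V2) = U1 *m ctr V1 - U2 *m L *m ctr V2.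
Proof.
have cB (A B : 'M[C]_(m, n)) : conjM (A - B) = conjM A - conjM B by exact: map_mxB.
by move=> h1 h2 h3 h4 h5; rewrite cB !conjMM !conjM_ctr h1 h2 h3 h4 h5.
Qed.

(** The two blocks have orthogonal ranges and orthogonal domains, so squared norms add on both
    sides. *)
Lemma limW_contr m m' m'' n n'' (U1 : 'M[C]_(m, m')) (U2 : 'M[C]_(m, m''))
    (V1 : 'M[C]_(n, m')) (V2 : 'M[C]_(n, n'')) (L : 'M[C]_(m'', n'')) :
  ctr U1 *m U1 = 1%:M -> ctr U2 *m U2 = 1%:M -> ctr U1 *m U2 = 0 ->
  V1 *m ctr V1 + V2 *m ctr V2 = 1%:M -> specnorm L <= 1 ->
  contr (U1 *m ctr V1 - U2 *m L *m ctr V2).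
Proof.
move=> u1 u2 u3 v5 L1 l Q.
have -> : (U1 *m ctr V1 - U2 *m L *m ctr V2) *m Q =
    U1 *m (ctr V1 *m Q) - U2 *m (L *m (ctr V2 *m Q)) by rewrite mulmxBl -!mulmxA.
rewrite ip_orth_diff //.
have -> : ip Q Q = ip (ctr V1 *m Q) (ctr V1 *m Q) + ip (ctr V2 *m Q) (ctr V2 *m Q).
  by rewrite !ip_mull !ctrK -ipDr !mulmxA -mulmxDl v5 mul1mx.
rewrite lerD2l; apply: (le_trans (specnorm_bound _ _)).
rewrite -[X in _ <= X]mul1r ler_wpM2r ?ip_ge0 //.
by rewrite -[X in _ <= X](expr1n _ 2) lerXn2r ?nnegrE ?specnorm_ge0.
Qed.

(** The (2,2) block kills the factors built on [U1] and [V1], on which only [U1 *m ctr V1] acts. *)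
Lemma limW_polar m n r r2 (U1 : 'M[C]_(m, r)) (V1 : 'M[C]_(n, r)) (U2 : 'M[C]_(m, r2)) r3
    (V2 : 'M[C]_(n, r3)) L (s : nat -> R) X :
  ctr U1 *m U1 = 1%:M -> ctr U1 *m U2 = 0 -> ctr V1 *m V1 = 1%:M -> ctr V2 *m V1 = 0 ->
  (forall i, 0 <= s i) -> X = U1 *m diagmx r r s *m ctr V1 ->
  contr (U1 *m ctr V1 - U2 *m L *m ctr V2) -> polar X (U1 *m ctr V1 - U2 *m L *m ctr V2).
Proof.
move=> u1 u3 v1 v4 s0 XE cW; split=> //.
pose q i := Num.sqrt (s i).
exists r, (U1 *m diagmx r r q), (V1 *m diagmx r r q); split.
- rewrite XE ctrM ctr_diag mulmxA -(mulmxA U1 (diagmx r r q)) diag_mul => [|i h1]; last first.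
    by rewrite minnn ltnNge h1.
  by congr (_ *m _ *m _); apply: eq_diag => i _; rewrite -expr2 sqr_sqrtr.
- rewrite mulmxBl !mulmxA -(mulmxA U1 (ctr V1)) v1 mulmx1.
  by rewrite -(mulmxA _ (ctr V2)) v4 mulmx0 mul0mx subr0.
rewrite ctrB !ctrM !ctrK mulmxBl !mulmxA -(mulmxA V1 (ctr U1)) u1 mulmx1.
rewrite -(mulmxA _ (ctr U2) U1).
have -> : ctr U2 *m U1 = 0 by rewrite -(ctrK (ctr U2 *m U1)) ctrM ctrK u3 ctr0.
by rewrite mulmx0 mul0mx subr0.
Qed.

Lemma rect_deterministic k m n d (Th : 'I_d -> 'M[C]_(m, n)) (al : {set 'I_d})
    (p : 'I_d -> R) (Xb : 'M[C]_(m, n)) (Ub : 'M[C]_m) (sb : nat -> R) (Vb : 'M[C]_n)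
    (f : 'cV[R]_(minn m n) -> 'cV[R]_(minn m n)) (M : R) :
  k = KReal \/ k = KComplex -> onb_of k Th -> prob_weights al p -> inV k Xb ->
  is_svd (kind_real k) Xb Ub sb Vb -> symmetric_fun f ->
  constraint_nondegenerate k Th al (rcols (\rank Xb) Ub) (rcols (\rank Xb) Vb) ->
  specnorm (B2inv k Th al p Ub Vb (B1 Th al p Ub Vb (ghat_diag f sb (\rank Xb)))) < 1 ->
  0 <= M ->
  exists eps rho0 : R, [/\ 0 < eps, 0 < rho0 &
    forall w e rho Ft gam Xt X, 0 < rho -> rho <= rho0 ->
    close_data al p Xb (specop k f Xb) eps rho M w e Ft gam Xt ->
    emp_opt k Th al Xb (@nucnorm R m n) (fun=> True) w e rho Ft gam Xt X ->
    \rank X = \rank Xb].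
Proof.
move=> hk onb pw XbV svd sf nd L1 M0.
have [UU VV] : ctr Ub *m Ub = 1%:M /\ ctr Vb *m Vb = 1%:M by case: svd.
have [u1 u2 u3 u4 u5] := cols_blocks (rank_leq_row Xb) UU.
have [v1 v2 v3 v4 v5] := cols_blocks (rank_leq_col Xb) VV.
have [XE XG GX XGX] := svd_pinvP svd.
have sb0 i : 0 <= sb i by case: svd => _ _ _ [].
have [Ur Vr] : (kind_real k -> conjM Ub = Ub) /\ (kind_real k -> conjM Vb = Vb).
  by case: svd => _ h _ _ _; split=> /h [/realmx_conjM ? /realmx_conjM ?].
have V0 : inV k (0 : 'M[C]_(m, n)) by apply/(inV_rect _ hk) => _; rewrite /conjM map_mx0.
set r := \rank Xb in nd L1 u1 u2 u3 u4 u5 v1 v2 v3 v4 v5 XE XG GX XGX.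
have Vout X : inV k X -> inV k (ctr (rcols r Ub) *m X *m rcols r Vb).
  move=> /(inV_rect _ hk) h; apply/(inV_rect _ hk) => kr.
  by rewrite !conjMM conjM_ctr !conjM_rcols ?h ?Ur ?Vr.
have Vin Z : inV k Z -> inV k (rcols r Ub *m Z *m ctr (rcols r Vb)).
  move=> /(inV_rect _ hk) h; apply/(inV_rect _ hk) => kr.
  by rewrite !conjMM conjM_ctr !conjM_rcols ?h ?Ur ?Vr.
have [LV _] := LamP f onb pw.1 svd nd Vout Vin V0.
set L := Lam k Th al p Xb Ub sb Vb f in LV.
set W := limW k Th al p Xb Ub sb Vb f.
have WE : W = lcols r Ub *m ctr (lcols r Vb) - rcols r Ub *m L *m ctr (rcols r Vb) by [].
have cW : contr W by rewrite WE; apply: limW_contr => //; exact: ltW.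
have pW : polar Xb W by rewrite WE; apply: (limW_polar _ _ _ _ sb0 XE) => //; rewrite -WE.
have WV : inV k W.
  apply/(inV_rect _ hk) => kr; rewrite WE; apply: limW_real.
  - by rewrite conjM_lcols ?Ur.
  - by rewrite conjM_lcols ?Vr.
  - by rewrite conjM_rcols ?Ur.
  - by rewrite conjM_rcols ?Vr.
  by have /(inV_rect _ hk) := LV; apply.
have [T [TV Tz Tdual]] := dual_tangents nd.
set G := svd_pinv r Ub sb Vb in XG GX XGX.
have UG : 1%:M - Xb *m G = rcols r Ub *m ctr (rcols r Ub) by rewrite XG -u5 addrC addKr.
have VG : 1%:M - G *m Xb = rcols r Vb *m ctr (rcols r Vb) by rewrite GX -v5 addrC addKr.
have tg X : ctr (rcols r Ub) *m X *m rcols r Vb = 0 ->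
    (1%:M - Xb *m G) *m X *m (1%:M - G *m Xb) = 0.
  move=> h; rewrite UG VG !mulmxA -(mulmxA _ (ctr _) X).
  by rewrite -(mulmxA _ _ (rcols r Vb)) h mulmx0 mul0mx.
have TE j := tangent_decomp (tg _ (Tz j)).
(* Behind the projection [1 - Xb G] only the block [- L] of [W] remains, so its spectral norm bounds
   the pairing. *)
have hs0 (u : 'cV[C]_m) (v : 'cV[C]_n) : frob u <= 1 -> frob v <= 1 -> Xb *m v = 0 ->
    ip W ((1%:M - Xb *m G) *m (u *m ctr v)) <= specnorm L.
  move=> hu hv _; rewrite UG -mulmxA -{1}(ctrK (rcols r Ub)) -ip_mull.
  have -> : ctr (rcols r Ub) *m W = - (L *m ctr (rcols r Vb)).
    rewrite WE mulmxBr mulmxA u4 mul0mx sub0r.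
    by rewrite -(mulmxA (rcols r Ub)) (mulmxA (ctr _)) u2 mul1mx.
  rewrite ipNl -ipNr ip_mulr ctrK.
  have -> : - (ctr (rcols r Ub) *m (u *m ctr v)) *m rcols r Vb =
      (- (ctr (rcols r Ub) *m u)) *m ctr (ctr (rcols r Vb) *m v).
    by rewrite !mulNmx ctrM ctrK !mulmxA.
  apply: (le_trans (ip_specnorm_rank1 _ _ _)).
  have cU : contr (ctr (rcols r Ub)) by apply: contr_ctr; exact: contr_iso.
  have cV : contr (ctr (rcols r Vb)) by apply: contr_ctr; exact: contr_iso.
  rewrite frobN -mulrA -[X in _ <= X]mulr1 ler_wpM2l ?specnorm_ge0 //.
  rewrite -[X in _ <= X]mulr1 ler_pM //.
    exact: (le_trans (frob_contr _ cU)).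
  exact: (le_trans (frob_contr _ cV)).
have [ThV _ _] := onb.
have hdesc := rect_descent hk ThV TV WV TE Tdual pW XGX.
have XGh : ctr (Xb *m G) = Xb *m G by rewrite XG ctrM ctrK.
have GXh : ctr (G *m Xb) = G *m Xb by rewrite GX ctrM ctrK.
have {}hdesc := hdesc _ XGh GXh L1 hs0.
have DF := limD_feas al p Xb Ub sb Vb f onb V0.
have DS := @limD_stat _ _ _ _ _ _ al p Xb Ub sb Vb f onb pw.1.
have DT := tangent_decomp (tg _ (limD_compressed onb pw.1 sf svd nd Vout Vin V0)).
apply: (@deterministic_rank _ k m n d Th al onb p Xb W (specop k f Xb)
  (limD k Th al p Xb Ub sb Vb f)) => //.
- exact: pw.1.
- by move=> j; exact: prob_weight_le1.
- by move=> Y _ _; exact: nuc_ge.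
- by rewrite (polar_nuc pW).
(* The nuclear norm has no domain restriction, so [limD] itself is admissible; the zero matrix fills
   the error slot of [dini_nuc]. *)
- move=> tau tau0; exists (limD k Th al p Xb Ub sb Vb f), (ip W (limD k Th al p Xb Ub sb Vb f) + nucnorm (0 : 'M[C]_(m, n))).
  split=> //; first by rewrite subrr frob0 ltW.
    rewrite lerD2l; apply: (le_trans (nuc_frob _)).
    by rewrite frob0 mulr0 ltW.
  rewrite {1}DT -[X in dini _ _ _ X]addr0 {3}DT; exact: dini_nuc.
case: hdesc => kap [c [del [h1 h2 h3]]]; exists kap, c, del; split=> // X XV _.
exact: h3.
Qed.

End Cases.

(** * Rank stability in the semidefinite case *)

Section PsdCase.
Variable R : realType.
Local Notation C := R[i].

(** The eigenvalue bound yields the margin for [psd_descent], the factorisation the global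
    inequality between the trace and [W0]. *)
Lemma pd_spectral n (L : 'M[C]_n) : is_pd L ->
  (exists2 lam : R, 0 < lam & forall w : 'cV[C]_n, lam * ip w w <= ip w (L *m w)) /\
  exists B : 'M[C]_n, L = B *m ctr B.
Proof.
move=> /pdP[Lh Lp]; have [V [e [VV LE _]]] := herm_spectral Lh.
have VV' := unitary_ctr VV.
have e0 (i : 'I_n) : 0 < e i.
  have Vi0 : col i V != 0.
    apply/eqP => z; have : (ctr V *m V) i i = 1 by rewrite VV mxE eqxx.
    rewrite mxE big1 => [/esym/eqP|j _]; first by rewrite oner_eq0.
    by move/matrixP/(_ j 0): z; rewrite !mxE => ->; rewrite mulr0.
  have := Lp _ Vi0; have ->  : L *m col i V = rC (e i) *: col i V.
    rewrite {1}LE -mulmxA -mulmxA colE (mulmxA (ctr V)) VV mul1mx.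
    rewrite scalemxAr; congr (_ *m _); apply/matrixP => a b.
    rewrite mul_diag_row valK !mxE; case: (eqVneq a i) => [->|_] //=.
    by rewrite !mulr0.
  by rewrite ipZr pmulr_lgt0 // -frobE exprn_gt0 // lt_def frob_ge0 andbT; apply: contra_neq Vi0; exact: frob_eq0.
split.
  exists (\big[Num.min/1]_(i < n) e i).
    by elim/big_rec: _ => // i x _ x0; rewrite lt_min x0 e0.
  move=> w; have -> : ip w (L *m w) = ip (ctr V *m w) (diagmx n n e *m (ctr V *m w)).
    by rewrite {1}LE -!mulmxA -{1}(ctrK V) -ip_mull.
  have -> : ip w w = ip (ctr V *m w) (ctr V *m w) by rewrite ip_mull ctrK mulmxA VV' mul1mx.
  rewrite ip_diag_sq ip_rows mulr_sumr; apply: ler_sum => i _.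
  by rewrite ler_wpM2r ?ip_ge0 // (bigD1 i) //= ge_min lexx.
pose q i := if (i < n)%N then Num.sqrt (e i) else 0.
exists (V *m diagmx n n q); rewrite ctrM ctr_diag mulmxA -(mulmxA V (diagmx n n q)).
rewrite diag_mul => [|i h]; last by rewrite minnn ltnNge h.
rewrite {1}LE; congr (_ *m _ *m _); apply: eq_diag => i; rewrite minnn /q => h.
by rewrite h -expr2 sqr_sqrtr // ltW // (e0 (Ordinal h)).
Qed.

Lemma ip_psd_ge0 n l (B : 'M[C]_(n, l)) (Y : 'M[C]_n) : is_psd Y -> 0 <= ip (B *m ctr B) Y.
Proof.
move=> /psdP[_ pY].
have -> : ip (B *m ctr B) Y = ip B (Y *m B) by rewrite ip_mulr ctrK.
have -> : ip B (Y *m B) = \sum_j ip (col j B) (Y *m col j B).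
  rewrite ipE exchange_big; apply: eq_bigr => j _; rewrite ipE; apply: eq_bigr => i _.
  rewrite big_ord1 !mxE; have -> // : \sum_j0 Y i j0 * B j0 j = \sum_j0 Y i j0 * col j B j0 0.
  by apply: eq_bigr => l0 _; rewrite mxE.
by apply: sumr_ge0 => j _; exact: pY.
Qed.

Lemma split_shift n (O P A B X Y : 'M[C]_n) :
  X + Y = P -> O - P + (A + B) = O + (A - X + (B - Y)).
Proof. by move=> <-; rewrite -addrA opprD (addrC (- X - Y)) addrACA. Qed.

Lemma psd_deterministic k n d (Th : 'I_d -> 'M[C]_n) (al : {set 'I_d})
    (p : 'I_d -> R) (Xb Pb : 'M[C]_n) (lb : nat -> R)
    (f : 'cV[R]_(minn n n) -> 'cV[R]_(minn n n)) (M : R) :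
  k = KSym \/ k = KHerm -> onb_of k Th -> prob_weights al p -> inV k Xb -> is_psd Xb ->
  is_svd (kind_real k) Xb Pb lb Pb -> symmetric_fun f ->
  constraint_nondegenerate k Th al (rcols (\rank Xb) Pb) (rcols (\rank Xb) Pb) ->
  is_pd (1%:M + B2inv k Th al p Pb Pb (B1 Th al p Pb Pb (ghat_diag f lb (\rank Xb)))) ->
  0 <= M ->
  exists eps rho0 : R, [/\ 0 < eps, 0 < rho0 &
    forall w e rho Ft gam Xt X, 0 < rho -> rho <= rho0 ->
    close_data al p Xb (specop k f Xb) eps rho M w e Ft gam Xt ->
    emp_opt k Th al Xb (ip 1%:M) (@is_psd R n) w e rho Ft gam Xt X ->
    \rank X = \rank Xb].
Proof.
move=> hk onb pw XbV Xpsd svd sf nd pd M0.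
have UU : ctr Pb *m Pb = 1%:M by case: svd => -[].
have [u1 u2 u3 u4 u5] := cols_blocks (rank_leq_row Xb) UU.
have [XE XG GX XGX] := svd_pinvP svd.
have Ur : kind_real k -> conjM Pb = Pb.
  by case: svd => _ h _ _ _ /h [/realmx_conjM].
have V0 l : inV k (0 : 'M[C]_l).
  by apply/(inV_sym _ hk); rewrite ctr0; split=> // _; rewrite /conjM map_mx0.
set r := \rank Xb in nd pd u1 u2 u3 u4 u5 XE XG GX XGX.
have Vout X : inV k X -> inV k (ctr (rcols r Pb) *m X *m rcols r Pb).
  move=> /(inV_sym _ hk)[h1 h2]; apply/(inV_sym _ hk); split=> [kr|].
    by rewrite !conjMM conjM_ctr !conjM_rcols ?h1 ?Ur.
  by rewrite !ctrM ctrK h2 mulmxA.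
have Vin (Z : 'M[C]_(n - r, n - r)) : inV k Z -> inV k (rcols r Pb *m Z *m ctr (rcols r Pb)).
  move=> /(inV_sym _ hk)[h1 h2]; apply/(inV_sym _ hk); split=> [kr|].
    by rewrite !conjMM conjM_ctr !conjM_rcols ?h1 ?Ur.
  by rewrite !ctrM ctrK h2 mulmxA.
have [LV _] := LamP f onb pw.1 svd nd Vout Vin (V0 n).
set L := Lam k Th al p Xb Pb lb Pb f in LV.
set W := limW k Th al p Xb Pb lb Pb f.
have WE : W = lcols r Pb *m ctr (lcols r Pb) - rcols r Pb *m L *m ctr (rcols r Pb) by [].
have pdL : is_pd (1%:M + L) by exact: pd.
have Lh : ctr L = L by have /(inV_sym _ hk)[] := LV.
have Xh : ctr Xb = Xb by have /(inV_sym _ hk)[] := XbV.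
set G := svd_pinv r Pb lb Pb in XG GX XGX.
have Gh : ctr G = G by rewrite /G /svd_pinv !ctrM ctrK ctr_diag mulmxA.
clearbody G.
have piV : inV k (1%:M - Xb *m G).
  apply: inVB; first exact: inV1.
  apply/(inV_sym _ hk); split=> [kr|]; rewrite XG; last by rewrite ctrM ctrK.
  by rewrite conjMM conjM_ctr conjM_lcols ?Ur.
have WV : inV k W.
  rewrite WE; apply: inVB; last exact: Vin.
  have -> : lcols r Pb *m ctr (lcols r Pb) = 1%:M - (1%:M - Xb *m G).
    by rewrite XG opprB addrC subrK.
  by apply: inVB => //; exact: inV1.
have UG : 1%:M - Xb *m G = rcols r Pb *m ctr (rcols r Pb) by rewrite XG -u5 addrC addKr.
have VG : 1%:M - G *m Xb = rcols r Pb *m ctr (rcols r Pb) by rewrite GX -u5 addrC addKr.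
have U2X : ctr (rcols r Pb) *m Xb = 0 by rewrite {1}XE !mulmxA u4 !mul0mx.
(* [1 - W] vanishes on the range of [Xb] and acts as [1 + L] on its kernel; this is where the
   positivity hypothesis enters. *)
have W1 : 1%:M - W = rcols r Pb *m (1%:M + L) *m ctr (rcols r Pb).
  by rewrite WE mulmxDr mulmx1 mulmxDl -u5 opprB addrC addrA subrK addrC.
have WX : W *m Xb = Xb.
  rewrite WE mulmxBl -(mulmxA _ (ctr (rcols r Pb))) U2X mulmx0 subr0.
  by rewrite -XG XGX.
have [T [TV Tz Tdual]] := dual_tangents nd.
have tg X : ctr (rcols r Pb) *m X *m rcols r Pb = 0 ->
    (1%:M - Xb *m G) *m X *m (1%:M - G *m Xb) = 0.
  move=> h; rewrite UG VG !mulmxA -(mulmxA _ (ctr _) X).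
  by rewrite -(mulmxA _ _ (rcols r Pb)) h mulmx0 mul0mx.
have TE X : inV k X -> ctr (rcols r Pb) *m X *m rcols r Pb = 0 ->
    X = Xb *m (G *m X *m (1%:M - rC 2^-1 *: (G *m Xb)))
      + ctr (G *m X *m (1%:M - rC 2^-1 *: (G *m Xb))) *m Xb.
  move=> /(inV_sym _ hk)[_ Xhh] /tg /tangent_decomp {1}->; congr (_ + _ *m _).
  by rewrite !ctrM ctrB ctr1 ctrZ ctrM Gh Xh Xhh mulmxA.
have TE' j := TE _ (TV j) (Tz j).
have [[lam lam0 hlam] [B LB]] := pd_spectral pdL.
have hl (v : 'cV_n) : ip v v = 1 -> Xb *m v = 0 -> lam <= ip (1%:M - W) (v *m ctr v).
  move=> vv Xv; pose w := ctr (rcols r Pb) *m v.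
  have vE : v = rcols r Pb *m w.
    by rewrite /w mulmxA -VG mulmxBl mul1mx -mulmxA Xv mulmx0 subr0.
  have ww : ip w w = 1 by rewrite -vv [in RHS]vE ip_iso.
  have := hlam w; rewrite ww mulr1 W1 ip_rank1 -(mulmxA _ (ctr _) v) -/w => h.
  by rewrite -mulmxA ip_mull -/w ipC.
(* The projection onto the kernel of [Xb], corrected by dual tangents to be feasible. As
   [Xb G = G Xb] is half of the sum of both products, [J] is the identity plus a tangent. *)
pose J := (1%:M - Xb *m G) + \sum_(j in al) rC (- ip (Th j) (1%:M - Xb *m G)) *: T j.
pose MJ := \sum_(j in al) rC (- ip (Th j) (1%:M - Xb *m G)) *:
  (G *m T j *m (1%:M - rC 2^-1 *: (G *m Xb))) - rC 2^-1 *: G.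
have [ThV _ _] := onb.
have JV : inV k J by apply: inVD => //; apply: inV_Th_sum.
have Ja j : j \in al -> ip (Th j) J = 0 by move=> ja; exact: feasible_corr ja.
have JE : J = 1%:M + (Xb *m MJ + ctr MJ *m Xb).
  rewrite /J (tangent_sum al _ TE') /MJ.
  set S := (\sum_(j in al) rC (- ip (Th j) (1%:M - Xb *m G)) *: (G *m T j *m _)).
  have -> : \sum_(j in al) rC (- ip (Th j) (1%:M - Xb *m G)) *:
      ctr (G *m T j *m (1%:M - rC 2^-1 *: (G *m Xb))) = ctr S.
    by rewrite /S ctr_sum; apply: eq_bigr => j _; rewrite ctrZ.
  have hh : rC 2^-1 *: (Xb *m G) + rC 2^-1 *: (G *m Xb) = Xb *m G.
    have -> : G *m Xb = Xb *m G by rewrite GX XG.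
    by rewrite -scalerDl -rCD (_ : 2^-1 + 2^-1 = 1 :> R) ?rC1 ?scale1r //; field.
  have s1 : Xb *m (S - rC 2^-1 *: G) = Xb *m S - rC 2^-1 *: (Xb *m G).
    by rewrite mulmxBr scalemxAr.
  have s2 : ctr (S - rC 2^-1 *: G) *m Xb = ctr S *m Xb - rC 2^-1 *: (G *m Xb).
    by rewrite ctrB ctrZ Gh mulmxBl scalemxAl.
  by rewrite s1 s2; exact: split_shift hh.
have GXh : ctr (G *m Xb) = G *m Xb by rewrite GX ctrM ctrK.
have hdesc := psd_descent hk ThV TV WV TE' Tdual JV JE Ja Xpsd WX XGX GXh lam0 hl.
have DF := limD_feas al p Xb Pb lb Pb f onb (V0 n).
have DS := @limD_stat _ _ _ _ _ _ al p Xb Pb lb Pb f onb pw.1.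
have DT := TE _ DF.1 (limD_compressed onb pw.1 sf svd nd Vout Vin (V0 n)).
set Dl := limD k Th al p Xb Pb lb Pb f in DF DS DT.
have tan0 Y A : Y = Xb *m A + ctr A *m Xb -> ip 1%:M Y = ip W Y.
  move=> ->; apply/eqP; rewrite -subr_eq0 -ipBl; apply/eqP.
  have z1 : (1%:M - W) *m Xb = 0 by rewrite mulmxBl mul1mx WX subrr.
  have Wh : ctr W = W by have /(inV_sym _ hk)[] := WV.
  have z2 : Xb *m (1%:M - W) = 0.
    by rewrite -(ctrK (Xb *m _)) ctrM ctrB ctr1 Wh Xh z1 ctr0.
  rewrite ipDr [X in X + _]ipC ip_mull Xh z2 ip0r add0r.
  by rewrite ipC ip_mulr Xh z1 ip0r.
apply: (@deterministic_rank _ k n n d Th al onb p Xb W (specop k f Xb) Dl) => //.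
- exact: pw.1.
- by move=> j; exact: prob_weight_le1.
- move=> Y _ Yp; rewrite -subr_ge0 -ipBl W1 LB.
  have -> : rcols r Pb *m (B *m ctr B) *m ctr (rcols r Pb) =
     (rcols r Pb *m B) *m ctr (rcols r Pb *m B) by rewrite ctrM !mulmxA.
  exact: ip_psd_ge0.
(* [Xb] is tangent at itself, which makes the equality of trace and [W] there an instance of
   [tan0]. *)
- have XGG : Xb = Xb *m (rC 2^-1 *: (G *m Xb)) + ctr (rC 2^-1 *: (G *m Xb)) *m Xb.
    rewrite ctrZ GXh -scalemxAr -scalemxAl mulmxA XGX.
    have -> : G *m Xb *m Xb = Xb.
      by rewrite GX -XG XGX.
    by rewrite -scalerDl -rCD (_ : 2^-1 + 2^-1 = 1 :> R) ?rC1 ?scale1r //; field.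
  exact: tan0 XGG.
(* The tilt [t J] may change both the direction and its trace by at most [tau]; [c] dominates both
   costs. *)
- move=> tau tau0; pose c := frob J + `|ip 1%:M J| + 1.
  have c0 : 0 < c by rewrite ltr_wpDl // addr_ge0.
  pose t := tau / c; have t0 : 0 < t by exact: divr_gt0.
  have tc : t * c = tau by rewrite /t divfK // lt0r_neq0.
  exists (Dl + rC t *: J), (ip 1%:M (Dl + rC t *: J)); split.
  + split=> [|j ja]; first by apply: inVD; [exact: DF.1 | exact: inVZ].
    by rewrite ipDr ipZr DF.2 // Ja // mulr0 addr0.
  + rewrite addrC addKr frobZ gtr0_norm // -tc ler_pM2l // /c -addrA lerDl.
    by rewrite addr_ge0.
  + rewrite ipDr ipZr (tan0 _ _ DT) lerD2l -tc ler_pM2l //.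
    apply: (le_trans (ler_norm _)); rewrite /c [frob J + _]addrC -addrA lerDl.
    by rewrite addr_ge0.
  + exact: dini_psd_tangent Xpsd t0 DT JE.
Qed.

End PsdCase.

(** * Weak laws for the sampling model *)

Section Probability.
Variables (R : realType) (dT : measure_display) (T : measurableType dT)
  (P : probability T R).
Local Open Scope ereal_scope.

(** The joint law is the product of the marginals, by uniqueness of product measures; Fubini then
    integrates out the centred [Y] first. *)
Lemma indep_integral_mul0 (X Y : T -> R) :
  measurable_fun setT X -> measurable_fun setT Y ->
  (forall A B, measurable A -> measurable B ->
     P (X @^-1` A `&` Y @^-1` B) = P (X @^-1` A) * P (Y @^-1` B)) ->
  P.-integrable setT (EFin \o Y) -> \int[P]_w (Y w)%:E = 0 ->
  P.-integrable setT (fun w => (X w * Y w)%:E) ->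
  \int[P]_w (X w * Y w)%:E = 0.
Proof.
move=> mX mY ind iY EY iXY.
pose X' : {RV P >-> R} := HB.pack X (isMeasurableFun.Build _ _ _ _ X mX).
pose Y' : {RV P >-> R} := HB.pack Y (isMeasurableFun.Build _ _ _ _ Y mY).
pose Z w := (X w, Y w).
have mZ : measurable_fun setT Z by apply/measurable_fun_pairP; split.
pose Z' : {RV P >-> (R * R)%type} := HB.pack Z (isMeasurableFun.Build _ _ _ _ Z mZ).
pose f (z : R * R) : \bar R := (z.1 * z.2)%:E.
have mf : @measurable_fun _ _ (R * R)%type (\bar R) setT f by apply/measurable_EFinP; exact: measurable_funM.
have uniq A : measurable A ->
    (distribution P X' \x distribution P Y') A = distribution P Z' A.
  by apply: product_measure_unique => B D mB mD; exact: ind.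
have iZ : (distribution P Z').-integrable setT f by exact: integrable_pushforward.
have E1 : \int[distribution P X' \x distribution P Y']_z f z = \int[P]_w f (Z w).
  rewrite (eq_measure_integral (distribution P Z')) => [|A mA _]; last exact: uniq.
  by rewrite integral_distribution.
rewrite (_ : \int[P]_w _ = \int[P]_w f (Z w)) // -E1.
have iprod : (distribution P X' \x distribution P Y').-integrable setT f.
  apply/integrableP; split=> //.
  have /integrableP[_] := iZ; congr (_ < _).
  by apply: eq_measure_integral => A mA _; apply/esym/uniq.
rewrite -integral12_prod_meas1 //.
rewrite (_ : fubini_F _ _ = cst 0) ?integral0 //.
apply/funext => x; rewrite /fubini_F /f /=.
under eq_integral do rewrite EFinM.
have iY' : (distribution P Y').-integrable setT EFin.
  by apply: integrable_pushforward.
rewrite integralZl // integral_distribution //=; first by rewrite EY mule0.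
Qed.
Lemma measurable_gt (X : T -> R) (a : R) : measurable_fun setT X ->
  measurable [set w | (a < X w)%R].
Proof.
move=> mX; rewrite (_ : [set w | _] = setT `&` X @^-1` `]a, +oo[%classic).
  exact: mX.
by rewrite setTI; apply/seteqP; split=> w /=; rewrite in_itv /= andbT.
Qed.

Lemma ler_norm_sqr (x y : R) : (`|x * y| <= x ^+ 2 + y ^+ 2)%R.
Proof. by rewrite ler_norml; apply/andP; split; nra. Qed.

Lemma integrable_sqr (X : T -> R) (c : R) : measurable_fun setT X ->
  \int[P]_w ((X w) ^+ 2)%:E <= c%:E -> P.-integrable setT (fun w => ((X w) ^+ 2)%:E).
Proof.
move=> mX h; apply/integrableP; split.
  by apply/measurable_EFinP; exact: measurable_funX.
apply: le_lt_trans (ltry c); apply: le_trans h.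
by under eq_integral do rewrite abse_EFin ger0_norm ?sqr_ge0 //.
Qed.

Lemma integrable_mul (X Y : T -> R) : measurable_fun setT X -> measurable_fun setT Y ->
  P.-integrable setT (fun w => ((X w) ^+ 2)%:E) ->
  P.-integrable setT (fun w => ((Y w) ^+ 2)%:E) ->
  P.-integrable setT (fun w => (X w * Y w)%:E).
Proof.
move=> mX mY iX iY; apply: le_integrable (integrableD measurableT iX iY) => //.
  by apply/measurable_EFinP; exact: measurable_funM.
move=> w _; rewrite /= lee_fin [leRHS]ger0_norm ?ler_norm_sqr //.
by rewrite addr_ge0 // sqr_ge0.
Qed.

(** Chebyshev's inequality: orthogonality removes the cross terms, so the second moment of the sum
    is at most [q]. *)
Lemma weak_law (Z : nat -> T -> R) (q : nat) (a : R) : (0 < a)%R ->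
  (forall i, measurable_fun setT (Z i)) ->
  (forall i, \int[P]_w ((Z i w) ^+ 2)%:E <= 1) ->
  (forall i l, i != l -> \int[P]_w (Z i w * Z l w)%:E = 0) ->
  P [set w | (a < `|\sum_(i < q) Z i w|)%R] <= (q%:R / a ^+ 2)%:E.
Proof.
move=> a0 mZ Z2 ZZ.
have iZ i : P.-integrable setT (fun w => ((Z i w) ^+ 2)%:E).
  exact: (@integrable_sqr _ 1).
have iZZ i l : P.-integrable setT (fun w => (Z i w * Z l w)%:E) by exact: integrable_mul.
pose S w := (\sum_(i < q) Z i w)%R.
have mS : measurable_fun setT S by exact: measurable_sum.
have ES : \int[P]_w ((S w) ^+ 2)%:E <= q%:R%:E.
  under eq_integral => w _.
    rewrite expr2 /S mulr_suml -sumEFin.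
    under eq_bigr do rewrite mulr_sumr -sumEFin.
    over.
  rewrite integral_sum //; last by move=> i; exact: integrable_sum.
  rewrite -[q in q%:R](card_ord q) -sumr_const -sumEFin lee_sum // => i _.
  rewrite integral_sum // (bigD1 i) //= big1 => [|l li]; last first.
    by rewrite ZZ // eq_sym.
  by rewrite adde0; under eq_integral do rewrite -expr2; exact: Z2.
rewrite EFinM muleC lee_pdivlMl ?exprn_gt0 //.
apply: le_trans ES.
have mS2 : measurable_fun setT (fun w => ((S w) ^+ 2)%:E).
  by apply/measurable_EFinP; exact: measurable_funX.
have := le_integral_abse P measurableT mS2 (exprn_gt0 2 a0).
under [X in _ <= X -> _]eq_integral do rewrite abse_EFin ger0_norm ?sqr_ge0 //.
apply: le_trans; rewrite lee_pmul2l ?lte_fin ?exprn_gt0 //.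
have mabs : measurable_fun setT (fun w => `|S w|%R) by exact: measurableT_comp.
apply: le_measure; rewrite ?inE.
- exact: measurable_gt.
- by apply: emeasurable_fun_c_infty => //; exact: measurableT_comp.
- move=> w /= aS; split=> //; rewrite lee_fin ger0_norm ?sqr_ge0 // -[leRHS]real_normK ?num_real //.
  by rewrite lerXn2r ?nnegrE // ltW.
Qed.

(** The product is 0 off [E]. If [A] misses 0, its preimage lies in [E], where the hypothesis
    applies; otherwise pass to complements. *)
Lemma indep_restrict (E : set T) (U Y : T -> R) :
  measurable E -> measurable_fun setT U -> measurable_fun setT Y ->
  (forall A B, measurable A -> measurable B ->
     P ((E `&` U @^-1` A) `&` Y @^-1` B) = P (E `&` U @^-1` A) * P (Y @^-1` B)) ->
  forall A B, measurable A -> measurable B ->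
    P ((fun w => U w * \1_E w)%R @^-1` A `&` Y @^-1` B) =
    P ((fun w => U w * \1_E w)%R @^-1` A) * P (Y @^-1` B).
Proof.
move=> mE mU mY ind.
have pre0 (A : set R) : ~ A 0%R -> (fun w => U w * \1_E w)%R @^-1` A = E `&` U @^-1` A.
  move=> A0; apply/seteqP; split=> w /=; rewrite indicE.
    by case: (boolP (w \in E)) => [/set_mem Ew|_]; rewrite ?mulr1 ?mulr0.
  by move=> [Ew Aw]; rewrite mem_set // mulr1.
have mpre (V : T -> R) A : measurable_fun setT V -> measurable A -> measurable (V @^-1` A).
  by move=> mV mA; rewrite -[X in measurable X]setTI; exact: mV.
move=> A B mA mB; case: (pselect (A 0%R)) => [A0|/pre0 ->]; last exact: ind.
have mC : measurable (E `&` U @^-1` (~` A)).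
  by apply: measurableI => //; apply: mpre => //; exact: measurableC.
have mD := mpre _ _ mY mB.
have -> : (fun w => U w * \1_E w)%R @^-1` A = ~` (E `&` U @^-1` (~` A)).
  by rewrite -pre0 => [|/(_ A0)//]; apply/seteqP; split=> w /= => [Aw /(_ Aw)|/contrapT].
set C := E `&` _ in mC *; set D := Y @^-1` B in mD *.
have CD : P (D `&` C) = P C * P D by rewrite setIC; apply: ind => //; exact: measurableC.
have -> : P (~` C `&` D) = P D - P (D `&` C).
  by rewrite setIC -setDE; apply: measureD; rewrite // ltey_eq fin_num_measure.
rewrite CD probability_setC //.
rewrite -(fineK (fin_num_measure P _ mC)) -(fineK (fin_num_measure P _ mD)).
by rewrite -EFinM -!EFinB -EFinM mulrBl mul1r.
Qed.

Lemma integral_cst_probability (x : R) : \int[P]_w x%:E = x%:E.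
Proof. by rewrite integral_cst //= probability_setT mule1. Qed.

(** * Deviations of the empirical frequencies and of the averaged noise *)

Section Sampling.
Variables (d : nat) (al : {set 'I_d}) (p : 'I_d -> R).
Variables (om : nat -> T -> 'I_d) (xi : nat -> T -> R).
Hypothesis sm : sampling_model P al p om xi.

Definition hit (j : 'I_d) i := [set w | om i w = j].

Let code (z : nat + nat) : T -> R :=
  match z with inl i => fun w => (om i w : nat)%:R%R | inr i => xi i end.

Let indep : indep_family P code.
Proof. by have [_ _ _ _] := sm. Qed.

Lemma measurable_hit j i : measurable (hit j i).
Proof. by have [h _ _ _ _] := sm; exact: h. Qed.

Lemma measurable_noise i : measurable_fun setT (xi i).
Proof. by case: indep => h _; exact: (h (inr i)). Qed.

Lemma hitE j i : hit j i = code (inl i) @^-1` [set j%:R%R].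
Proof.
apply/seteqP; split=> w /= [].
  by move->.
by move/eqP; rewrite eqr_nat => /eqP /val_inj.
Qed.

Lemma probability_hit j i : j \notin al -> P (hit j i) = (p j)%:E.
Proof. by have [_ h _ _ _] := sm => /negbTE ja; rewrite h ja. Qed.

Lemma hit_indep j i l A B : i != l -> measurable A -> measurable B ->
  P ((\1_(hit j i) : T -> R) @^-1` A `&` (\1_(hit j l) : T -> R) @^-1` B) =
  P ((\1_(hit j i) : T -> R) @^-1` A) * P ((\1_(hit j l) : T -> R) @^-1` B).
Proof.
move=> il mA mB; have [_ h] := indep.
have e i' : (\1_(hit j i') : T -> R) =
    (\1_[set j%:R%R : R] : R -> R) \o code (inl i').
  by apply/funext => w; rewrite /= !indicE; congr (_%:R)%R; rewrite hitE.
have mg : measurable_fun setT (\1_[set j%:R%R : R] : R -> R) by exact: measurable_indic.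
have mp (D : set R) : measurable D -> measurable ((\1_[set j%:R%R : R] : R -> R) @^-1` D).
  by move=> mD; rewrite -[X in measurable X]setTI; exact: mg.
rewrite !e; set g := \1_[set j%:R%R] in mg mp *.
pose S z := if z == inl i :> nat + nat then g @^-1` A else g @^-1` B.
have := h [:: inl i; inl l] S.
rewrite !big_cons !big_nil setIT mule1 /S eqxx.
have -> : (inl l == inl i :> nat + nat) = false by apply/negbTE; rewrite eq_sym.
apply=> [|z]; first by rewrite /= inE andbT.
by case: ifP => _; exact: mp.
Qed.

(** Both hits are grouped with [xi i], leaving the centred [xi l] alone; this cancels the cross
    moments of the terms in [noise_deviation]. *)
Lemma noise_indep j i l A B : i != l -> measurable A -> measurable B ->
  P (((hit j i `&` hit j l) `&` xi i @^-1` A) `&` xi l @^-1` B) =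
  P ((hit j i `&` hit j l) `&` xi i @^-1` A) * P (xi l @^-1` B).
Proof.
move=> il mA mB; have [_ h] := indep.
pose S (z : nat + nat) : set R := match z with
  inl _ => [set j%:R%R] | inr a => if a == i then A else B end.
have mS z : measurable (S z).
  by case: z => [_|a] /=; [exact: measurable_set1 | case: ifP].
have u4 : uniq [:: inl i; inl l; inr i; inr l : nat + nat].
  by rewrite /= !inE !andbT /= !orbF; apply/andP; split; [exact: il | exact: il].
have u3 : uniq [:: inl i; inl l; inr i : nat + nat] by rewrite /= !inE !orbF !andbT.
have := h _ _ u4 mS; have := h _ _ u3 mS.
rewrite !big_cons !big_nil !setIT !mule1 /= eqxx (negbTE (_ : l != i)); last by rewrite eq_sym.
rewrite -/(code (inl i)) -/(code (inl l)) -!hitE => e3 e4.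
by rewrite -!setIA e4 e3 !muleA.
Qed.

Lemma measurable_indic_hit j i : measurable_fun setT (\1_(hit j i) : T -> R).
Proof. by apply: measurable_indic; exact: measurable_hit. Qed.

Lemma integrable_indic_hit j i : P.-integrable setT (EFin \o (\1_(hit j i) : T -> R)).
Proof. by apply: integrable_indic => //; exact: measurable_hit. Qed.

Lemma integral_indic_hit j i : j \notin al -> \int[P]_w (\1_(hit j i) w)%:E = (p j)%:E.
Proof.
move=> ja; rewrite integral_indic ?setIT //; first exact: probability_hit.
exact: measurable_hit.
Qed.

Lemma hit_prob_itv j : j \notin al -> (0 <= p j <= 1)%R.
Proof.
move=> ja; rewrite -!lee_fin -(probability_hit 0 ja) measure_ge0 probability_le1 //.
exact: measurable_hit.
Qed.

Lemma hit_deviation j (q : nat) (a : R) : j \notin al -> (0 < a)%R ->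
  P [set w | (a < `|\sum_(i < q) (\1_(hit j i) w - p j)|)%R] <= (q%:R / a ^+ 2)%:E.
Proof.
move=> ja a0; have p01 := hit_prob_itv ja.
pose Z i w : R := (\1_(hit j i) w - p j)%R.
have mZ i : measurable_fun setT (Z i).
  by apply: measurable_funB => //; exact: measurable_indic_hit.
have Zb i w : ((Z i w) ^+ 2 <= 1)%R.
  by rewrite /Z indicE; case: (w \in _); rewrite ?mulr1n ?mulr0n; nra.
have Z2 i : \int[P]_w ((Z i w) ^+ 2)%:E <= 1.
  rewrite -[leRHS](probability_setT P) -[leRHS]mul1e -integral_cst //.
  apply: ge0_le_integral => //; first by move=> w _; rewrite lee_fin sqr_ge0.
    by apply/measurable_EFinP; exact: measurable_funX.
  by move=> w _; rewrite lee_fin.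
have iZ i : P.-integrable setT (EFin \o Z i).
  rewrite (_ : EFin \o Z i = (EFin \o (\1_(hit j i) : T -> R)) \- (EFin \o cst (p j))) //.
  by apply: integrableB => //; [exact: integrable_indic_hit | exact: finite_measure_integrable_cst].
have Z1 i : \int[P]_w (Z i w)%:E = 0.
  rewrite integralB_EFin //; [|exact: integrable_indic_hit|exact: finite_measure_integrable_cst].
  rewrite integral_indic_hit // (_ : \int[P]__ _ = (p j)%:E) ?subee //.
  exact: integral_cst_probability.
apply: (@weak_law Z) => // i l il; apply: indep_integral_mul0 => //; last first.
  by apply: integrable_mul => //; apply: (@integrable_sqr _ 1).
move=> A B mA mB.
have msub : measurable_fun setT (fun x : R => (x - p j)%R) by exact: measurable_funB.
have mp D : measurable D -> measurable ((fun x : R => (x - p j)%R) @^-1` D).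
  by move=> mD; rewrite -[X in measurable X]setTI; exact: msub.
exact: (hit_indep j il (mp _ mA) (mp _ mB)).
Qed.

Lemma noise_deviation j (q : nat) (a : R) : (0 < a)%R ->
  P [set w | (a < `|\sum_(i < q) (xi i w * \1_(hit j i) w)|)%R] <= (q%:R / a ^+ 2)%:E.
Proof.
move=> a0; have [_ _ _ hxi _] := sm.
pose Z i w : R := (xi i w * \1_(hit j i) w)%R.
have mxi := measurable_noise.
have mZ i : measurable_fun setT (Z i).
  by apply: measurable_funM => //; exact: measurable_indic_hit.
have xi2 i : \int[P]_w ((xi i w) ^+ 2)%:E = 1.
  by have [_ _] := hxi i; rewrite unlock.
have xi1 i : \int[P]_w (xi i w)%:E = 0.
  by have [_ + _] := hxi i; rewrite unlock.
have ZX i w : ((Z i w) ^+ 2 <= (xi i w) ^+ 2)%R.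
  by rewrite /Z indicE; case: (w \in _); rewrite ?mulr1 // mulr0 expr0n /= sqr_ge0.
have Z2 i : \int[P]_w ((Z i w) ^+ 2)%:E <= 1.
  rewrite -(xi2 i); apply: ge0_le_integral => //.
  - by move=> w _; rewrite lee_fin sqr_ge0.
  - by apply/measurable_EFinP; exact: measurable_funX.
  - by apply/measurable_EFinP; exact: measurable_funX.
  - by move=> w _; rewrite lee_fin.
apply: (@weak_law Z) => // i l il.
pose E := hit j i `&` hit j l.
have mE : measurable E by apply: measurableI; exact: measurable_hit.
have mXE : measurable_fun setT (fun w => (xi i w * \1_E w)%R).
  by apply: measurable_funM => //; exact: measurable_indic.
have e w : (Z i w * Z l w = (xi i w * \1_E w) * xi l w)%R.
  by rewrite /Z /E indicI /=; ring.
under eq_integral do rewrite e.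
apply: indep_integral_mul0 => //.
- by apply: indep_restrict => // A B; exact: noise_indep.
- by have [] := hxi l.
apply: integrable_mul => //; last by apply: (@integrable_sqr _ 1); rewrite ?xi2.
apply: (@integrable_sqr _ 1) => //; rewrite -[leRHS](xi2 i); apply: ge0_le_integral => //.
- by move=> w _; rewrite lee_fin sqr_ge0.
- by apply/measurable_EFinP; exact: measurable_funX.
- by apply/measurable_EFinP; exact: measurable_funX.
- move=> w _; rewrite lee_fin indicE.
  by case: (w \in _); rewrite ?mulr1 // mulr0 expr0n /= sqr_ge0.
Qed.

End Sampling.
End Probability.

Lemma cvg_probability1 (R : realType) (dT : measure_display) (T : measurableType dT)
    (P : probability T R) (G : nat -> set T) : (forall q, measurable (G q)) ->
  (forall e : R, 0 < e -> \forall q \near \oo, (P (~` G q) <= e%:E)%E) ->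
  (fun q => P (G q)) @ \oo --> 1%E.
Proof.
move=> mG h; apply/fine_cvgP; split.
  by near=> q; rewrite fin_num_measure.
apply/cvgrPdist_le => e e0; apply: filterS (h _ e0) => q.
rewrite probability_setC //= -(fineK (fin_num_measure P _ (mG q))) -EFinB lee_fin => he.
by rewrite ger0_norm // subr_ge0 -lee_fin fineK ?probability_le1 // fin_num_measure.
Unshelve. all: by end_near. Qed.

Lemma cvg_probability0 (R : realType) (dT : measure_display) (T : measurableType dT)
    (P : probability T R) (G : nat -> set T) : (forall q, measurable (G q)) ->
  (fun q => P (G q)) @ \oo --> 0%E ->
  forall e : R, 0 < e -> \forall q \near \oo, (P (G q) <= e%:E)%E.
Proof.
move=> mG /fine_cvgP[_ /cvgrPdist_le h] e e0; apply: filterS (h _ e0) => q /=.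
rewrite sub0r normrN ger0_norm ?fine_ge0 // -lee_fin fineK //.
exact: fin_num_measure.
Qed.

Lemma union_bound (R : realType) (dT : measure_display) (T : measurableType dT)
    (P : probability T R) (I : eqType) (s : seq I) (A : I -> set T) (c : R) :
  (forall i, measurable (A i)) -> (forall i, (P (A i) <= c%:E)%E) ->
  exists B, [/\ measurable B, (P B <= ((size s)%:R * c)%:E)%E &
    forall w i, i \in s -> A i w -> B w].
Proof.
move=> mA hA; elim: s => [|i s [B [mB PB hB]]].
  by exists set0; split=> //; rewrite measure0 mul0r.
exists (A i `|` B); split; first exact: measurableU.
  apply: (le_trans (measureU2 P (mA i) mB)).
  by rewrite /= mulrSr mulrDl mul1r addrC EFinD leeD.
by move=> w l; rewrite inE => /orP[/eqP ->|ls Al]; [left | right; exact: (hB _ _ ls)].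
Qed.

Lemma measurable_frob (R : realType) (dT : measure_display) (T : measurableType dT)
    m n (X : T -> 'M[R[i]]_(m, n)) (L : 'M[R[i]]_(m, n)) :
  random_matrix X -> measurable_fun setT (fun w => frob (X w - L)).
Proof.
move=> mX; under eq_fun do rewrite -[frob _]ger0_norm // -sqrtr_sqr frobE.
have msqrt : measurable_fun setT (@Num.sqrt R).
  by apply: continuous_measurable_fun; exact: sqrt_continuous.
apply: (measurableT_comp msqrt).
under eq_fun do rewrite ipE; apply: measurable_sum => i; apply: measurable_sum => j.
under eq_fun do rewrite !mxE.
have [h1 h2] := mX i j.
have e1 : measurable_fun setT (fun w => complex.Re (X w i j - L i j)).
  rewrite (_ : (fun w => _) = (fun w => complex.Re (X w i j) - complex.Re (L i j))).
    exact: measurable_funB.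
  by apply/funext => w; case: (X w i j) => a b; case: (L i j).
have e2 : measurable_fun setT (fun w => complex.Im (X w i j - L i j)).
  rewrite (_ : (fun w => _) = (fun w => complex.Im (X w i j) - complex.Im (L i j))).
    exact: measurable_funB.
  by apply/funext => w; case: (X w i j) => a b; case: (L i j).
by apply: measurable_funD; exact: measurable_funM.
Qed.

(** * Consistency *)

(** Chebyshev's bound for a mean of [q] terms at accuracy [eps] is [1 / (q * eps ^+ 2)]. *)
Lemma mean_variance_le (R : realType) (c eps q : R) : 0 < c -> 0 < eps -> 0 < q ->
  (c * eps ^+ 2)^-1 <= q -> q / (q * eps) ^+ 2 <= c.
Proof.
move=> c0 e0 q0 h.
have -> : q / (q * eps) ^+ 2 = (q * eps ^+ 2)^-1 by field; rewrite !gt_eqF.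
have e2 : 0 < eps ^+ 2 by exact: exprn_gt0.
rewrite -[leRHS]invrK lef_pV2 ?posrE ?invr_gt0 ?mulr_gt0 //.
by rewrite -ler_pdivrMr // -invfM.
Qed.

(** Here [s] is the square root of the sample size, and accuracy of order [r] is affordable once
    [s * r] is large. The summand 1 gives [s * r <= (s * r) ^+ 2]. *)
Lemma scaled_mean_variance_le (R : realType) (c eps nu s r : R) :
  0 < c -> 0 < eps -> 0 < nu -> 0 < s -> 0 < r ->
  1 + nu ^+ 2 / (eps ^+ 2 * c) <= s * r -> s ^+ 2 / (s ^+ 2 * (eps * r / nu)) ^+ 2 <= c.
Proof.
move=> c0 e0 n0 s0 r0 h.
have -> : s ^+ 2 / (s ^+ 2 * (eps * r / nu)) ^+ 2 = nu ^+ 2 / (eps ^+ 2 * c) * c / (s * r) ^+ 2.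
  by field; rewrite !gt_eqF.
have t0 : 0 < nu ^+ 2 / (eps ^+ 2 * c) by rewrite divr_gt0 ?mulr_gt0 ?exprn_gt0.
rewrite ler_pdivrMr ?exprn_gt0 ?mulr_gt0 // mulrC ler_pM2l //.
apply: (@le_trans _ _ (s * r)); first by lra.
by rewrite expr2 ler_peMr ?mulr_ge0 ?ltW //; lra.
Qed.

Section Consistency.
Variables (R : realType) (dT : measure_display) (T : measurableType dT)
  (P : probability T R).
Local Notation C := R[i].
Variables (k : space_kind) (m n d : nat) (Th : 'I_d -> 'M[C]_(m, n)) (al : {set 'I_d}).
Variables (p : 'I_d -> R) (Xb : 'M[C]_(m, n)).
Variables (om : nat -> T -> 'I_d) (xi : nat -> T -> R) (nu : R).

Definition freq q w j : R := q%:R^-1 * \sum_(i < q) \1_(hit om j i) w.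
Definition noise q w j : R := nu * (q%:R^-1 * \sum_(i < q) (xi i w * \1_(hit om j i) w)).

Lemma sum_om (q : nat) (w : T) (g : 'I_q -> 'I_d -> R) :
  \sum_(i < q) g i (om i w) = \sum_j \sum_(i < q) \1_(hit om j i) w * g i j.
Proof.
rewrite exchange_big; apply: eq_bigr => i _.
rewrite (bigD1 (om i w)) //= indicE mem_set // mul1r big1 ?addr0 // => j jo.
by rewrite indicE memNset ?mul0r // => /= /esym /eqP; rewrite (negbTE jo).
Qed.

(** The first sum is the noise energy; being free of [X], it drops out of every comparison. *)
Lemma lsq_lossE q w X : (0 < q)%N -> (forall j, j \in al -> ip (Th j) (X - Xb) = 0) ->
  lsq_loss Th Xb om xi nu q w X = (2 * q%:R)^-1 * \sum_(i < q) (nu * xi i w) ^+ 2 +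
    (2^-1 * wform Th al (freq q w) (X - Xb) (X - Xb) - noise_form Th al (noise q w) (X - Xb)).
Proof.
move=> q0 Xal; have qn : q%:R != 0 :> R by rewrite pnatr_eq0 -lt0n.
have big_al (F : 'I_d -> R) : (forall j, j \in al -> F j = 0) ->
    \sum_j F j = \sum_(j in ~: al) F j.
  by move=> F0; rewrite (bigID (mem (~: al))) /= [X in _ + X]big1 ?addr0 // => j; rewrite inE negbK => /F0.
set D := X - Xb in Xal *.
have e (i : 'I_q) : (obs Th Xb om xi nu i w - ip (Th (om i w)) X) ^+ 2 =
   (nu * xi i w) ^+ 2 + (ip (Th (om i w)) D ^+ 2 - 2 * nu * xi i w * ip (Th (om i w)) D).
  by rewrite /obs /D ipBr; ring.
rewrite /lsq_loss (eq_bigr _ (fun i _ => e i)) big_split /= mulrDr; congr (_ + _).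
rewrite (sum_om w (fun i j => ip (Th j) D ^+ 2 - 2 * nu * xi i w * ip (Th j) D)).
rewrite big_al; last first.
  by move=> j /Xal ->; rewrite big1 // => i _; rewrite expr0n /= !mulr0 subr0 mulr0.
rewrite /wform /noise_form [in RHS]mulr_sumr -sumrB mulr_sumr; apply: eq_bigr => j _.
rewrite /freq /noise; set y := ip _ _.
under eq_bigr do rewrite mulrBr.
rewrite sumrB -mulr_suml.
rewrite [X in _ - X](_ : _ = \sum_(i < q) xi i w * \1_(hit om j i) w * (2 * nu * y)); last first.
  by apply: eq_bigr => i _; ring.
rewrite -mulr_suml; set S1 := \sum_(i < q) _; set S2 := \sum_(i < q) _.
by field; rewrite qn.
Qed.

Hypothesis sm : sampling_model P al p om xi.

Lemma freq_noise_close (rho : nat -> R) (eps e : R) : 0 < nu -> 0 < eps -> 0 < e ->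
  (forall q, 0 < rho q) -> (fun q => Num.sqrt q%:R * rho q) @ \oo --> +oo ->
  \forall q \near \oo, exists B, [/\ measurable B, (P B <= e%:E)%E &
    forall w, ~ B w -> forall j, j \in ~: al ->
      `|freq q w j - p j| <= eps /\ `|noise q w j| <= eps * rho q].
Proof.
move=> nu0 eps0 e0 rho0 /cvgryPge hrho.
(* Two families of [d] bad events share the probability [e]; [d.+1] keeps [c] positive when
   [d = 0]. *)
pose c := e / (2 * d.+1%:R).
have c0 : 0 < c by rewrite divr_gt0 // mulr_gt0.
near=> q.
have q0 : (0 < q)%N by near: q; exact: nbhs_infty_gt.
have qR : 0 < q%:R :> R by rewrite ltr0n.
have qn : q%:R != 0 :> R by rewrite lt0r_neq0.
have qi : `|q%:R^-1| = q%:R^-1 :> R by rewrite ger0_norm // invr_ge0 ltW.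
have h1 : q%:R / (q%:R * eps) ^+ 2 <= c.
  by apply: mean_variance_le => //; near: q; exact: nbhs_infty_ger.
have h2 : q%:R / (q%:R * (eps * rho q / nu)) ^+ 2 <= c.
  rewrite -[q%:R]sqr_sqrtr //; apply: scaled_mean_variance_le; rewrite ?sqrtr_gt0 //.
  by near: q; exact: hrho.
(* Fixed indices get the empty event, as only sampled frequencies are to be controlled. *)
pose A1 (j : 'I_d) := if j \in al then set0 else
  [set w | q%:R * eps < `|\sum_(i < q) (\1_(hit om j i) w - p j)|].
pose A2 (j : 'I_d) :=
  [set w | q%:R * (eps * rho q / nu) < `|\sum_(i < q) (xi i w * \1_(hit om j i) w)|].
have mA1 j : measurable (A1 j).
  rewrite /A1; case: ifP => // _; apply: measurable_gt; apply: measurableT_comp => //.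
  apply: measurable_sum => i; apply: measurable_funB => //; exact: measurable_indic_hit sm _ _.
have mA2 j : measurable (A2 j).
  apply: measurable_gt; apply: measurableT_comp => //.
  apply: measurable_sum => i; apply: measurable_funM; first exact: measurable_noise sm _.
  exact: measurable_indic_hit sm _ _.
have PA1 j : (P (A1 j) <= c%:E)%E.
  rewrite /A1; case: ifP => [_|/negbT ja]; first by rewrite measure0 lee_fin ltW.
  by apply: (le_trans (hit_deviation sm q ja _)); rewrite ?mulr_gt0 // lee_fin.
have PA2 j : (P (A2 j) <= c%:E)%E.
  apply: (le_trans (noise_deviation sm j q _)); rewrite ?lee_fin //.
  by rewrite mulr_gt0 // divr_gt0 // mulr_gt0.
have [B1 [mB1 PB1 hB1]] := union_bound (enum 'I_d) mA1 PA1.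
have [B2 [mB2 PB2 hB2]] := union_bound (enum 'I_d) mA2 PA2.
exists (B1 `|` B2); split; first exact: measurableU.
  apply: (le_trans (measureU2 P mB1 mB2)); apply: (le_trans (leeD PB1 PB2)).
  rewrite -EFinD lee_fin size_enum_ord /c -mulrDl.
  rewrite mulrA ler_pdivrMr ?mulr_gt0 // [leLHS]mulrC ler_pM2l //.
  by rewrite mulr2n mulrDl mul1r mulrSr; lra.
move=> w nB j jal; split.
  rewrite leNgt; apply/negP => h; apply: nB; left; apply: (hB1 w j); first exact: mem_enum.
  rewrite /A1; rewrite inE in jal; rewrite (negbTE jal) /=.
  rewrite sumrB sumr_const card_ord -[p j *+ q]mulr_natl -ltr_pdivlMl //.
  by rewrite -qi -normrM mulrBr mulKf.
rewrite leNgt; apply/negP => h; apply: nB; right; apply: (hB2 w j); first exact: mem_enum.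
rewrite /A2 /= -ltr_pdivlMl // ltr_pdivrMr // [X in _ < X]mulrC.
by rewrite -qi -normrM -[X in X * `|_|](gtr0_norm nu0) -normrM.
Unshelve. all: by end_near. Qed.

Lemma fixed_coefE X : fixed_coef Th al Xb X <->
  (forall j, j \in al -> ip (Th j) (X - Xb) = 0).
Proof.
split=> h j ja; first by rewrite ipBr h // subrr.
by apply/eqP; rewrite -subr_eq0 -ipBr h.
Qed.

Lemma drop_const (c a b e a' b' e' : R) :
  c + (a - b) + e <= c + (a' - b') + e' -> a - b + e <= a' - b' + e'.
Proof. by lra. Qed.

Lemma RC_optimal_emp_opt f (rho : nat -> R) (gam : nat -> T -> R)
    (Xt : nat -> T -> 'M[C]_(m, n)) q w X : (0 < q)%N ->
  RC_optimal k Th al Xb om xi nu f rho gam Xt q w X ->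
  emp_opt k Th al Xb (@nucnorm R m n) (fun=> True) (freq q w) (noise q w) (rho q)
    (specop k f (Xt q w)) (gam q w) (Xt q w) X.
Proof.
move=> q0 [XV /fixed_coefE Xal opt]; split; [exact: XV|exact: I|exact: Xal|].
move=> Y YV _ Yal; have /fixed_coefE Yfix := Yal; move: (opt Y YV Yfix).
rewrite /RC_objective (lsq_lossE w q0 Xal) (lsq_lossE w q0 Yal); exact: drop_const.
Qed.

(** [G] can fail only on three events of probability at most [e / 3] each: atypical sampling, [Xt]
    far from [Xb], and large [gam]. *)
Lemma consistency (f : 'cV[R]_(minn m n) -> 'cV[R]_(minn m n)) (rho : nat -> R)
    (gam : nat -> T -> R) (Xt : nat -> T -> 'M[C]_(m, n)) (G : nat -> set T) :
  0 < nu -> specop_continuous_at k f Xb -> (forall q w, inV k (Xt q w)) ->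
  cvg_in_prob P Xt Xb -> (forall q, 0 < rho q) -> rho @ \oo --> 0 ->
  (fun q => Num.sqrt q%:R * rho q) @ \oo --> +oo ->
  (forall q w, 0 <= gam q w) -> bounded_in_prob P gam ->
  (forall q, measurable (G q)) ->
  (forall M, 0 <= M -> exists eps rho0, [/\ 0 < eps, 0 < rho0 &
     forall q w, (0 < q)%N -> rho q <= rho0 ->
       close_data al p Xb (specop k f Xb) eps (rho q) M (freq q w) (noise q w)
         (specop k f (Xt q w)) (gam q w) (Xt q w) -> G q w]) ->
  (fun q => P (G q)) @ \oo --> 1%E.
Proof.
move=> nu0 fcont XtV [mXt Xtcvg] rho0 /cvgr0Pnorm_le rhocvg rhooo gam0 [mgam gamb] mG hG.
apply: cvg_probability1 => // e e0.
have e3 : 0 < e / 3 by rewrite divr_gt0.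
have [M0 [q0 gM]] := gamb _ e3.
(* The bound extracted from [bounded_in_prob] may be negative. *)
have M_ge0 : 0 <= Num.max M0 0 by rewrite le_max lexx orbT.
have [eps [r0 [eps0 r00 hq]]] := hG _ M_ge0.
have [del del0 fdel] := fcont _ eps0.
(* [eps] controls the proximal centre itself, [del / 2] its image under the spectral operator; the
   half provides the strict inequality that continuity asks for. *)
pose t := Num.min eps (del / 2).
have t0 : 0 < t by rewrite lt_min eps0 divr_gt0.
have mB3 q : measurable [set w | t < frob (Xt q w - Xb)].
  by apply: measurable_gt; exact: measurable_frob.
have hB3 := cvg_probability0 mB3 (Xtcvg _ t0) e3.
have hB := freq_noise_close nu0 eps0 e3 rho0 rhooo.
near=> q.
have qgt0 : (0 < q)%N by near: q; exact: nbhs_infty_gt.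
have [B [mB PB hB']] : exists B, [/\ measurable B, (P B <= (e / 3)%:E)%E &
    forall w, ~ B w -> forall j, j \in ~: al ->
      `|freq q w j - p j| <= eps /\ `|noise q w j| <= eps * rho q].
  by near: q.
have PB3 : (P [set w | (t < frob (Xt q w - Xb))%R] <= (e / 3)%:E)%E by near: q.
have rq : `|rho q| <= r0 by near: q; exact: rhocvg.
have PB4 : (P [set w | (M0 < `|gam q w|)%R] < (e / 3)%:E)%E.
  by apply: gM; near: q; exact: nbhs_infty_ge.
have mB4 : measurable [set w | M0 < `|gam q w|].
  by apply: measurable_gt; exact: measurableT_comp.
have mB34 := measurableU _ _ (mB3 q) mB4.
apply: (@le_trans _ _ (P (B `|` ([set w | t < frob (Xt q w - Xb)] `|` [set w | M0 < `|gam q w|])))).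
  apply: le_measure; rewrite ?inE; [exact: measurableC|exact: measurableU|].
  move=> w /= nG; apply: contrapT => /not_orP[nB /not_orP[n3 n4]]; apply: nG.
  have {n3} n3 : frob (Xt q w - Xb) <= t by rewrite leNgt; exact/negP.
  have {n4} n4 : `|gam q w| <= M0 by rewrite leNgt; exact/negP.
  apply: (hq q w) => //; first by rewrite (le_trans (ler_norm _)).
  split.
  - by move=> j ja; case: (hB' w nB j ja).
  - by move=> j ja; case: (hB' w nB j ja).
  - apply/ltW/fdel => //; apply: (le_lt_trans n3); rewrite /t gt_min.
    by rewrite [X in _ || X]ltr_pdivrMr // ltr_pMr // ltr1n orbT.
  - by apply: (le_trans n3); rewrite /t ge_min lexx.
  - by rewrite gam0 le_max (le_trans (ler_norm _) n4).
apply: (le_trans (measureU2 P mB mB34)); apply: (le_trans (leeD PB (measureU2 P (mB3 q) mB4))).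
apply: (le_trans (leeD (lexx _) (leeD PB3 (ltW PB4)))).
by rewrite -!EFinD lee_fin; lra.
Unshelve. all: by end_near. Qed.

End Consistency.

Lemma RCplus_optimal_emp_opt (R : realType) (dT : measure_display) (T : measurableType dT)
    (k : space_kind) (n d : nat) (Th : 'I_d -> 'M[R[i]]_n) (al : {set 'I_d}) (Xb : 'M[R[i]]_n)
    (om : nat -> T -> 'I_d) (xi : nat -> T -> R) (nu : R) f (rho : nat -> R)
    (gam : nat -> T -> R) (Xt : nat -> T -> 'M[R[i]]_n) q w X : (0 < q)%N ->
  RCplus_optimal k Th al Xb om xi nu f rho gam Xt q w X ->
  emp_opt k Th al Xb (ip 1%:M) (@is_psd R n) (freq R om q w) (noise om xi nu q w) (rho q)
    (specop k f (Xt q w)) (gam q w) (Xt q w) X.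
Proof.
move=> q0 [XV Xp /fixed_coefE Xal opt]; split; [exact: XV|exact: Xp|exact: Xal|].
move=> Y YV Yp Yal; have /fixed_coefE Yfix := Yal; move: (opt Y YV Yp Yfix).
rewrite /RCplus_objective (lsq_lossE om xi nu w q0 Xal) (lsq_lossE om xi nu w q0 Yal).
rewrite (ipBl X) (ipBl Y); exact: drop_const.
Qed.

Theorem mainTheorem18 :
  (* Rectangular case: V = R^{n1 x n2} or C^{n1 x n2}, problem (RC) *)
  (forall (R : realType) (dT : measure_display) (T : measurableType dT)
     (P : probability T R) (k : space_kind) (n1 n2 d : nat)
     (Th : 'I_d -> 'M[R[i]]_(n1, n2)) (al : {set 'I_d}) (p : 'I_d -> R)
     (Xb : 'M[R[i]]_(n1, n2)) (Ub : 'M[R[i]]_n1) (sb : nat -> R) (Vb : 'M[R[i]]_n2)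
     (f : 'cV[R]_(minn n1 n2) -> 'cV[R]_(minn n1 n2))
     (om : nat -> T -> 'I_d) (xi : nat -> T -> R) (nu : R)
     (rho : nat -> R) (gam : nat -> T -> R)
     (Xt Xh : nat -> T -> 'M[R[i]]_(n1, n2)),
     (k = KReal \/ k = KComplex) ->
     onb_of k Th -> prob_weights al p ->
     inV k Xb -> (1 <= \rank Xb)%N ->
     is_svd (kind_real k) Xb Ub sb Vb ->
     sampling_model P al p om xi -> 0 < nu ->
     symmetric_fun f -> specop_continuous_at k f Xb ->
     (forall q w, inV k (Xt q w)) -> cvg_in_prob P Xt Xb ->
     (forall q, 0 < rho q) -> rho @ \oo --> 0 ->
     (fun q => Num.sqrt q%:R * rho q) @ \oo --> +oo ->
     (forall q w, 0 <= gam q w) -> bounded_in_prob P gam ->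
     constraint_nondegenerate k Th al (rcols (\rank Xb) Ub) (rcols (\rank Xb) Vb) ->
     specnorm (B2inv k Th al p Ub Vb
                 (B1 Th al p Ub Vb (ghat_diag f sb (\rank Xb)))) < 1 ->
     (forall q, (0 < q)%N -> forall w,
        RC_optimal k Th al Xb om xi nu f rho gam Xt q w (Xh q w)) ->
     (forall q, measurable [set w | \rank (Xh q w) = \rank Xb]) ->
     (fun q => P [set w | \rank (Xh q w) = \rank Xb]) @ \oo --> 1%E)
  /\
  (* Positive semidefinite case: V = S^n (real symmetric or Hermitian), problem (RC+) *)
  (forall (R : realType) (dT : measure_display) (T : measurableType dT)
     (P : probability T R) (k : space_kind) (n d : nat)
     (Th : 'I_d -> 'M[R[i]]_(n, n)) (al : {set 'I_d}) (p : 'I_d -> R)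
     (Xb : 'M[R[i]]_n) (Pb : 'M[R[i]]_n) (lb : nat -> R)
     (f : 'cV[R]_(minn n n) -> 'cV[R]_(minn n n))
     (om : nat -> T -> 'I_d) (xi : nat -> T -> R) (nu : R)
     (rho : nat -> R) (gam : nat -> T -> R)
     (Xt Xh : nat -> T -> 'M[R[i]]_n),
     (k = KSym \/ k = KHerm) ->
     onb_of k Th -> prob_weights al p ->
     inV k Xb -> is_psd Xb -> (1 <= \rank Xb)%N ->
     is_svd (kind_real k) Xb Pb lb Pb ->
     (exists X0 : 'M[R[i]]_n, [/\ inV k X0, is_pd X0 & fixed_coef Th al Xb X0]) ->
     sampling_model P al p om xi -> 0 < nu ->
     symmetric_fun f -> specop_continuous_at k f Xb ->
     (forall q w, inV k (Xt q w) /\ is_psd (Xt q w)) -> cvg_in_prob P Xt Xb ->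
     (forall q, 0 < rho q) -> rho @ \oo --> 0 ->
     (fun q => Num.sqrt q%:R * rho q) @ \oo --> +oo ->
     (forall q w, 0 <= gam q w) -> bounded_in_prob P gam ->
     constraint_nondegenerate k Th al (rcols (\rank Xb) Pb) (rcols (\rank Xb) Pb) ->
     is_pd (1%:M + B2inv k Th al p Pb Pb
                  (B1 Th al p Pb Pb (ghat_diag f lb (\rank Xb)))) ->
     (forall q, (0 < q)%N -> forall w,
        RCplus_optimal k Th al Xb om xi nu f rho gam Xt q w (Xh q w)) ->
     (forall q, measurable [set w | \rank (Xh q w) = \rank Xb]) ->
     (fun q => P [set w | \rank (Xh q w) = \rank Xb]) @ \oo --> 1%E).
Proof.
split.
- move=> R dT T P k n1 n2 d Th al p Xb Ub sb Vb f om xi nu rho gam Xt Xh hk onb pw XbV _ svd sm nu0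
    sf fc XtV Xtc rho0 rhoc rhoo gam0 gamb nd small opt mG.
  apply: (consistency sm nu0 fc XtV Xtc rho0 rhoc rhoo gam0 gamb mG) => M M0.
  have [eps [r0 [h1 h2 h3]]] := rect_deterministic hk onb pw XbV svd sf nd small M0.
  exists eps, r0; split=> // q w q0 rq cd; apply: h3 (rho0 q) rq cd _.
  exact: RC_optimal_emp_opt (opt q q0 w).
move=> R dT T P k n d Th al p Xb Pb lb f om xi nu rho gam Xt Xh hk onb pw XbV Xbp _ svd _ sm nu0
  sf fc XtV Xtc rho0 rhoc rhoo gam0 gamb nd pos opt mG.
have XtV' q w : inV k (Xt q w) by case: (XtV q w).
apply: (consistency sm nu0 fc XtV' Xtc rho0 rhoc rhoo gam0 gamb mG) => M M0.
have [eps [r0 [h1 h2 h3]]] := psd_deterministic hk onb pw XbV Xbp svd sf nd pos M0.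
exists eps, r0; split=> // q w q0 rq cd; apply: h3 (rho0 q) rq cd _.
exact: RCplus_optimal_emp_opt (opt q q0 w).
Qed.
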